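(* Let $n\ge2$ be an integer and let $\alpha,t$ be real numbers with $n<\alpha$ and $\frac n\alpha<t<1$. Let $t'$ be defined by $\frac1t+\frac1{t'}=1$. Then there is a positive constant $\widetilde{\mathscr C}(n,\alpha,1,t)$ such that $$\int_{\partial\mathbb R^n_+} f\log f\,dx+\frac{n-1}{\alpha-\frac nt}\,\log\left(\frac{\|\widetilde E_\alpha f\|_{L^{t'}(\mathbb R^n_+)}}{\widetilde{\mathscr C}(n,\alpha,1,t)}\right)\ \ge\ 0$$ for every nonnegative function $f\in L^1(\partial\mathbb R^n_+)$ with $\int_{\partial\mathbb R^n_+}f(x)\,dx=1$ and $f\log f\in L^1(\partial\mathbb R^n_+)$; moreover, with $\widetilde{\mathscr C}(n,\alpha,1,t)$ the sharp (largest possible) constant, there exists a radially symmetric, non-increasing, bounded function $f$ in this class for which equality holds.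
   Context: $\mathbb R^n_+:=\{x=(x',x_n)\in\mathbb R^n:x_n>0\}$, and $\partial\mathbb R^n_+=\{x_n=0\}$ is identified with $\mathbb R^{n-1}$ with Lebesgue measure. For a nonnegative measurable $f$ on $\partial\mathbb R^n_+$, $\widetilde E_\alpha f(x):=\int_{\partial\mathbb R^n_+}|x-y|^{\alpha-n}f(y)\,dy\in[0,\infty]$ for $x=(x',x_n)\in\mathbb R^n_+$, where $|x-y|=(|x'-y|^2+x_n^2)^{1/2}$. For real $p\ne0$, $\|g\|_{L^p(\mathbb R^n_+)}:=\left(\int_{\mathbb R^n_+}|g|^p\,dx\right)^{1/p}$. Note that $0<t<1$ gives $t'<0$; for negative exponents the usual conventions $0^{t'}=\infty$, $\infty^{t'}=0$, $0^{1/t'}=\infty$, $\infty^{1/t'}=0$ are used, and $\log\infty=\infty$. Also $0\log0=0$. ''Radially symmetric, non-increasing'' means $f(y)=\varphi(|y|)$ with $\varphi$ non-increasing. *)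

(* Defs.v *)
From HB Require Import structures.
From mathcomp Require Import all_boot all_order all_algebra.
From mathcomp Require Import all_classical all_reals all_analysis.

Set Implicit Arguments.
Unset Strict Implicit.
Unset Printing Implicit Defensive.

Import Order.TTheory GRing.Theory Num.Theory.
Import numFieldNormedType.Exports.

Local Open Scope classical_set_scope.
Local Open Scope ring_scope.
Local Open Scope ereal_scope.

(* Points of R^k are k-tuples, with the product (= Borel) sigma-algebra; the
   library has no k-dimensional Lebesgue measure.  It is built by recursion:
   [lebesgueT k.+1] is [lebesgue_measure \x lebesgueT k] transported along
   (x, v) |-> x :: v, and [lebesgueT 0] is the Dirac mass on the only point. *)
Section tuple_cons.
Context {R : realType} {k : nat}.

Definition tcons (p : R * k.-tuple R) : k.+1.-tuple R := [tuple of p.1 :: p.2].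

Definition tuncons (v : k.+1.-tuple R) : R * k.-tuple R :=
  (thead v, [tuple of behead v]).

Lemma tconsK : cancel tcons tuncons.
Proof. by case=> x v; congr pair; apply/val_inj. Qed.

Lemma measurable_tcons : measurable_fun [set: R * k.-tuple R] tcons.
Proof. by apply: measurable_cons. Qed.

Lemma measurable_tuncons : measurable_fun [set: k.+1.-tuple R] tuncons.
Proof.
by apply: measurable_fun_pair; [exact: measurable_tnth|exact: measurable_behead].
Qed.

End tuple_cons.

Section lebesgue_cons.
Context {R : realType} {k : nat}.
Variable mu : {sigma_finite_measure set (k.-tuple R) -> \bar R}.

Definition lebesgue_cons : set (k.+1.-tuple R) -> \bar R :=
  pushforward (lebesgue_measure \x mu) (@tcons R k).

Let measurable_tcons_pre (A : set (k.+1.-tuple R)) :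
  measurable A -> measurable (@tcons R k @^-1` A).
Proof. by move=> mA; rewrite -[X in measurable X]setTI; exact: measurable_tcons. Qed.

Let lebesgue_cons0 : lebesgue_cons set0 = 0.
Proof. by rewrite /lebesgue_cons /pushforward preimage_set0 measure0. Qed.

Let lebesgue_cons_ge0 A : 0 <= lebesgue_cons A.
Proof. by rewrite /lebesgue_cons /pushforward. Qed.

Let lebesgue_cons_sigma_additive : semi_sigma_additive lebesgue_cons.
Proof.
move=> F mF tF mUF; rewrite /lebesgue_cons /pushforward preimage_bigcup.
apply: measure_semi_sigma_additive => [n||].
- exact: measurable_tcons_pre.
- apply/trivIsetP => /= i j _ _ ij; rewrite -preimage_setI.
  by move/trivIsetP : tF => /(_ _ _ _ _ ij) ->//; rewrite preimage_set0.
- by rewrite -preimage_bigcup; exact: measurable_tcons_pre.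
Qed.

HB.instance Definition _ := isMeasure.Build _ _ _ lebesgue_cons
  lebesgue_cons0 lebesgue_cons_ge0 lebesgue_cons_sigma_additive.

Let lebesgue_cons_sigma_finite : sigma_finite setT lebesgue_cons.
Proof.
have /sigma_finiteP[F [TF ndF Foo]] :=
  sigma_finiteT (@lebesgue_measure R : {sigma_finite_measure set _ -> \bar R}).
have /sigma_finiteP[G [TG ndG Goo]] := sigma_finiteT mu.
exists (fun i => @tuncons R k @^-1` (F i `*` G i)) => [|i].
  rewrite -preimage_bigcup (_ : \bigcup_i _ = setT) ?preimage_setT//.
  rewrite -setXTT TF TG predeqE => -[x y]; split=> [[i _ []/= ? ?]|].
    by split; exists i.
  move=> [/= [i _ Fix] [j _ Gjy]]; exists (maxn i j) => //; split.
  - by move: x Fix; exact/subsetPset/ndF/leq_maxl.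
  - by move: y Gjy; exact/subsetPset/ndG/leq_maxr.
have [mF Fi] := Foo i; have [mG Gi] := Goo i.
have mFG : measurable (F i `*` G i : set (R * k.-tuple R)) by exact: measurableX.
split; first by rewrite -[X in measurable X]setTI; exact: measurable_tuncons.
rewrite /lebesgue_cons /pushforward -comp_preimage.
rewrite (_ : _ \o _ = id); last by apply/funext => p /=; rewrite tconsK.
rewrite preimage_id product_measure1E// lte_mul_pinfty// ge0_fin_numE//.
Qed.

HB.instance Definition _ := Measure_isSigmaFinite.Build _ _ _ lebesgue_cons
  lebesgue_cons_sigma_finite.

End lebesgue_cons.

Fixpoint lebesgueT {R : realType} (k : nat) :
    {sigma_finite_measure set (k.-tuple R) -> \bar R} :=
  match k with
  | 0 => [the {sigma_finite_measure set (0.-tuple R) -> \bar R} of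
            @dirac _ _ ([tuple] : 0.-tuple R) R]
  | k.+1 => [the {sigma_finite_measure set (k.+1.-tuple R) -> \bar R} of
               lebesgue_cons (lebesgueT k)]
  end.

Lemma lebesgueT_box {R : realType} (k : nat) (A : 'I_k -> set R) :
  (forall i, measurable (A i)) ->
  lebesgueT k [set v : k.-tuple R | forall i, A i (tnth v i)] =
  \prod_(i < k) lebesgue_measure (A i).
Proof.
elim: k A => [|k IH] A mA.
  by rewrite big_ord0 /= diracE mem_set// => -[].
rewrite big_ord_recl -IH // /= /lebesgue_cons /pushforward.
have mB : measurable [set v : k.-tuple R | forall i, A (lift ord0 i) (tnth v i)].
  rewrite (_ : [set _ | _] =
    \bigcap_(i in [set: 'I_k]) ((fun v : k.-tuple R => tnth v i) @^-1` A (lift ord0 i))).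
    apply: fin_bigcap_measurable => // i _.
    by rewrite -[X in measurable X]setTI; exact: measurable_tnth.
  by apply/seteqP; split => [v Av i _|v Av i]; exact: Av.
rewrite -product_measure1E//; last exact: mA.
congr (_ _); apply/seteqP; split => -[x v] /=.
  move=> H; split; first by have := H ord0.
  by move=> i; have := H (lift ord0 i); rewrite tnthS.
move=> [Hx Hv] i; case: (unliftP ord0 i) => [j|] ->; last exact: Hx.
by rewrite tnthS; exact: Hv.
Qed.

(* [poweR] sends 0 to 0 and +oo to +oo for every nonzero exponent; here, for
   r < 0, 0 is sent to +oo and +oo to 0 (this is what [inve] does). *)
Definition epow {R : realType} (x : \bar R) (r : R) : \bar R :=
  if (0 <= r)%R then x `^ r else (x `^ (- r))^-1.

(* R^n is R^(n-1) * R, a point being x = (x', x_n), and the boundary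
   {x_n = 0} of the half space is R^(n-1). *)
Definition half_space {R : realType} (n : nat) : set (n.-1.-tuple R * R) :=
  [set x | (0 < x.2)%R].
Arguments half_space : clear implicits.

(* Meant for real p != 0, negative p included, unlike the library's [Lnorm]. *)
Definition Lp_half_space {R : realType} (n : nat) (p : R)
    (g : n.-1.-tuple R * R -> \bar R) : \bar R :=
  epow (\int[lebesgueT n.-1 \x lebesgue_measure]_(x in half_space R n)
          epow `|g x| p) p^-1.
Arguments Lp_half_space {R} n p g.

Definition enorm {R : realType} {k : nat} (y : k.-tuple R) : R :=
  Num.sqrt (\sum_(i < k) tnth y i ^+ 2)%R.

(* |x - y| for x = (x', x_n) and y on the boundary *)
Definition edist {R : realType} {k : nat} (x : k.-tuple R * R)
    (y : k.-tuple R) : R :=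
  Num.sqrt ((\sum_(i < k) (tnth x.1 i - tnth y i) ^+ 2) + x.2 ^+ 2)%R.

Definition Etilde {R : realType} (n : nat) (alpha : R) (f : n.-1.-tuple R -> R)
    (x : n.-1.-tuple R * R) : \bar R :=
  \int[lebesgueT n.-1]_y (edist x y `^ (alpha - n%:R) * f y)%:E.
Arguments Etilde {R} n alpha f x.

(* [ln 0 = 0], so [f y * ln (f y)] is 0 where f vanishes. *)
Definition entropy {R : realType} (k : nat) (f : k.-tuple R -> R) : \bar R :=
  \int[lebesgueT k]_y (f y * ln (f y))%:E.

Definition entropy_class {R : realType} (k : nat) (f : k.-tuple R -> R) : Prop :=
  [/\ forall y, (0 <= f y)%R,
      (lebesgueT k).-integrable [set: k.-tuple R] (EFin \o f),
      \int[lebesgueT k]_y (f y)%:E = 1 &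
      (lebesgueT k).-integrable [set: k.-tuple R]
        (fun y => (f y * ln (f y))%:E)].

Definition radial_nonincreasing {R : realType} (k : nat) (f : k.-tuple R -> R) :
    Prop :=
  exists phi : R -> R,
    {in Num.nneg &, {homo phi : s t / (s <= t)%R >-> (t <= s)%R}} /\
    forall y, f y = phi (enorm y).

(* left-hand side of the inequality, with C in the role of the constant *)
Definition log_functional {R : realType} (n : nat) (alpha t t' C : R)
    (f : n.-1.-tuple R -> R) : \bar R :=
  entropy f +
  ((n%:R - 1) / (alpha - n%:R / t))%:E *
  lne (Lp_half_space n t' (Etilde n alpha f) / C%:E).
Arguments log_functional {R} n alpha t t' C f.

(* Main.v *)
(* Put q = - t' > 0 and K(x, y) = |x - y|^(alpha - n).  Up to an additive
   constant the functional is the free energy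
     F(f) = \int f ln f - (ka / q) ln (\int (K f)^(- q)),
   with ka = (n - 1) / (alpha - n / t); this ka makes F invariant under the
   mass-preserving dilations and the translations of the boundary.  The theorem
   says that F attains its minimum over the probability densities, at a
   symmetric one: the sharp constant is exp (min F / ka).

   Existence: f |-> ln (\int (K f)^(- q)) is convex, so F is bounded above by
   the functional with this term replaced by its tangent at f, and the Gibbs
   variational principle minimizes the latter: replacing f by the Gibbs state
   of the potential of K f does not increase F.  Start from a minimizing
   sequence, dilated and translated so that K f >= 1 with bounded moments.  The
   potentials then grow like |y|^(alpha - n), uniformly, with a uniform modulus
   of continuity; by Tychonoff's theorem they accumulate pointwise, and
   dominated convergence makes the Gibbs state of a limit potential a minimizer.

   Symmetry: polarization in any hyperplane keeps the entropy and does not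
   increase F, strictly so unless f dominates its reflection on one of the two
   sides.  The side is the one containing the barycenter, because the first
   moment of f orthogonally to a hyperplane is negative when f is larger on the
   negative side.  Comparing y and z in their bisecting hyperplane shows that f
   is non-increasing in the distance to its barycenter, hence radial about it. *)
From HB Require Import structures.
Require Import Defs.
From mathcomp Require Import all_boot all_order all_algebra.
From mathcomp Require Import all_classical all_reals all_analysis.
From mathcomp Require Import measurable_realfun ring lra.

Set Implicit Arguments.
Unset Strict Implicit.
Unset Printing Implicit Defensive.

Import Order.TTheory GRing.Theory Num.Theory.
Import numFieldNormedType.Exports.

Local Open Scope classical_set_scope.
Local Open Scope ring_scope.

(** A minimizing sequence may spread, concentrate or escape by translation. Lower semicontinuity on
    densities is avoided: after normalization each density is traded for a Gibbs state whose
    potential lies in one fixed class, with two-sided growth bounds and a common modulus, and on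
    that class the free energy is continuous. Tightness comes from the growth of the kernel: K
    dominates the weight in y up to a weight in x, so one nearly minimal value of K f bounds the
    moment of f. The exponents fit because 1/q = 1/t - 1: the hypothesis t > n/alpha says at once
    that ka is positive and that the weight to the power -q is integrable on the half space. A
    density with infinite moment has K f infinite everywhere, so its functional is +oo and it can be
    discarded. Symmetry comes after existence because strictness of polarization needs sets of
    positive measure, which the continuity of a Gibbs state supplies; its exponential decay gives
    the first moments that define the barycenter. *)

Section real_integral.
Context {d} {T : measurableType d} {R : realType}.
Context (mu : {measure set T -> \bar R}) (D : set T) (mD : measurable D).
Implicit Types f g h : T -> R.
Local Notation intg f := (mu.-integrable D (EFin \o (f : T -> R))).

Lemma intg_measurable f : intg f -> measurable_fun D f.
Proof. by move=> /(measurable_int mu) /measurable_EFinP. Qed.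

Lemma intg_dominated f g : measurable_fun D f -> intg g ->
  (forall x, D x -> `|f x| <= g x) -> intg f.
Proof.
move=> mf ig fg; apply: (le_integrable mD _ _ ig) => [|x Dx]; first exact/measurable_EFinP.
by rewrite /= lee_fin (le_trans (fg _ Dx))// ler_norm.
Qed.

Lemma eq_intg f g : (forall x, D x -> f x = g x) -> intg f -> intg g.
Proof.
move=> fg; apply: eq_integrable => // x /set_mem Dx /=; by rewrite fg.
Qed.

Lemma intgD f g : intg f -> intg g -> intg (fun x => f x + g x).
Proof. by move=> *; rewrite (_ : _ \o _ = (EFin \o f) \+ (EFin \o g))%E//; exact: integrableD. Qed.

Lemma intgB f g : intg f -> intg g -> intg (fun x => f x - g x).
Proof. by move=> *; rewrite (_ : _ \o _ = (EFin \o f) \- (EFin \o g))%E//; exact: integrableB. Qed.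

Lemma intgZ c f : intg f -> intg (fun x => c * f x).
Proof. by move=> *; rewrite (_ : _ \o _ = (fun x => c%:E * (EFin \o f) x)%E)//; exact: integrableZl. Qed.

Lemma intgN f : intg f -> intg (fun x => - f x).
Proof. by move=> i; apply: eq_intg (intgZ (-1) i) => x _; rewrite mulN1r. Qed.

Lemma intg_norm f : intg f -> intg (fun x => `|f x|).
Proof. exact: integrable_norm. Qed.

Lemma integral_EFin f : intg f ->
  (\int[mu]_(x in D) (f x)%:E = (\int[mu]_(x in D) f x)%:E)%E.
Proof. by move=> i; rewrite /Rintegral fineK//; exact: integrable_fin_num. Qed.

Lemma intg_lty f : measurable_fun D f -> (forall x, D x -> 0 <= f x) ->
  (\int[mu]_(x in D) (f x)%:E < +oo)%E -> intg f.
Proof.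
move=> mf f0 foo; apply/integrableP; split; first exact/measurable_EFinP.
rewrite (eq_integral (fun x => (f x)%:E))// => x /set_mem Dx /=.
by rewrite ger0_norm// f0.
Qed.

Lemma eq_Rint f g : (forall x, D x -> f x = g x) ->
  \int[mu]_(x in D) f x = \int[mu]_(x in D) g x.
Proof. by move=> fg; apply: eq_Rintegral => x /set_mem; exact: fg. Qed.

Lemma Rint_dominated (f_ : nat -> T -> R) f g :
  (forall n, measurable_fun D (f_ n)) -> measurable_fun D f ->
  (forall x, D x -> f_ ^~ x @ \oo --> f x) -> intg g ->
  (forall n x, D x -> `|f_ n x| <= g x) ->
  (fun n => \int[mu]_(x in D) f_ n x) @ \oo --> \int[mu]_(x in D) f x.
Proof.
move=> mf_ mf ff ig fg.
have := @dominated_convergence _ T R mu D mD (fun n => EFin \o f_ n) (EFin \o f)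
  (EFin \o g).
case.
- by move=> n; exact/measurable_EFinP.
- exact/measurable_EFinP.
- by apply: aeW => x Dx; apply/cvg_EFin; [exact: nearW|exact: ff].
- exact: ig.
- by apply: aeW => x n Dx; rewrite lee_fin fg.
move=> if_ _; rewrite (@integral_EFin f)// => cv.
have: fine \o (fun n => \int[mu]_(x in D) (f_ n x)%:E)%E @ \oo --> \int[mu]_(x in D) f x.
  exact: fine_cvg.
exact.
Qed.

Lemma Rint_eq0_ae f : intg f -> (forall x, D x -> 0 <= f x) ->
  \int[mu]_(x in D) f x = 0 -> {ae mu, forall x, D x -> f x = 0}.
Proof.
move=> fi f0 f00; have mf := intg_measurable fi.
have mEf : measurable_fun D (EFin \o f) by exact/measurable_EFinP.
have /(ae_eq_integral_abs mu mD mEf).1 :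
    (\int[mu]_(x in D) `|(EFin \o f) x| = 0)%E.
  under eq_integral => x /set_mem Dx do rewrite /= ger0_norm ?(f0 _ Dx)//.
  by rewrite integral_EFin// f00.
by apply: filterS => x /[apply] -[].
Qed.

(** Replaces an almost everywhere statement by one actual zero; strictness arguments then need a
    contradiction at a single point only. *)
Lemma Rint_eq0 f (A : set T) : intg f -> (forall x, D x -> 0 <= f x) ->
  \int[mu]_(x in D) f x = 0 -> measurable A -> A `<=` D -> (0 < mu A)%E ->
  exists2 x, A x & f x = 0.
Proof.
move=> fi f0 /(Rint_eq0_ae fi f0)[N [mN N0 DN]] mA AD A0; apply: contrapT => H.
have : (mu A <= mu N)%E.
  apply: le_measure; rewrite ?inE// => x Ax; apply: DN => /= /(_ (AD _ Ax)) fx0.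
  by apply: H; exists x.
by rewrite N0 leNgt A0.
Qed.

Lemma Rint_gt0 f : intg f -> (0 < mu D)%E -> (forall x, D x -> 0 < f x) ->
  0 < \int[mu]_(x in D) f x.
Proof.
move=> fi D0 f0; rewrite lt_neqAle Rintegral_ge0 ?andbT; last by move=> x /f0/ltW.
apply/eqP => /esym f00; have f0' x : D x -> 0 <= f x by move=> /f0/ltW.
have [//|x Dx fx0] := Rint_eq0 fi f0' f00 mD _ D0.
by move: (f0 _ Dx); rewrite fx0 ltxx.
Qed.

Lemma intg_sum n (F : 'I_n -> T -> R) : (forall i, intg (F i)) ->
  intg (fun x => \sum_(i < n) F i x) /\
  \int[mu]_(x in D) (\sum_(i < n) F i x) = \sum_(i < n) \int[mu]_(x in D) F i x.
Proof.
elim: n F => [|n IH] F iF.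
  have E x : D x -> 0 = \sum_(i < 0) F i x by rewrite big_ord0.
  split; first by apply: (eq_intg E); exact: integrable0.
  by rewrite big_ord0 -(eq_Rint E) /Rintegral integral0.
have [i1 E1] := IH (fun i => F (widen_ord (leqnSn n) i)) (fun i => iF _).
have E x : D x -> \sum_(i < n) F (widen_ord (leqnSn n) i) x + F ord_max x = \sum_(i < n.+1) F i x.
  by rewrite big_ord_recr.
split; first by apply: (eq_intg E); exact: intgD.
by rewrite -(eq_Rint E) RintegralD// E1 big_ord_recr.
Qed.
End real_integral.

(** * Tonelli's theorem with one integral restricted to a set *)

Section tonelli.
Context {d1 d2} {X : measurableType d1} {Y : measurableType d2} {R : realType}.
Context (P : {sigma_finite_measure set X -> \bar R}) (D : set X) (mD : measurable D).
Context (nu : {sigma_finite_measure set Y -> \bar R}).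

Lemma ge0_tonelli (F : X * Y -> \bar R) : measurable_fun setT F ->
  (forall p, 0 <= F p)%E ->
  (\int[P]_(x in D) \int[nu]_y F (x, y) = \int[nu]_y \int[P]_(x in D) F (x, y))%E.
Proof.
move=> mF F0.
(* The restriction to [D] becomes an indicator factor, so that Tonelli on the whole product
   applies. *)
pose G p := ((\1_D p.1)%:E * F p)%E.
have mG : measurable_fun setT G.
  apply: emeasurable_funM => //; apply/measurable_EFinP.
  by apply: measurableT_comp => //; exact: measurable_indic.
have G0 p : (0 <= G p)%E by rewrite mule_ge0// lee_fin.
have := fubini_tonelli G mG G0; rewrite /G/= => E.
rewrite integral_mkcond [RHS](_ : _ = \int[nu]_y \int[P]_x G (x, y))%E; last first.
  apply: eq_integral => y _; rewrite integral_mkcond; apply: eq_integral => x _.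
  by rewrite /G/= indicE patchE; case: ifP; rewrite ?mul1e ?mul0e.
rewrite -E; apply: eq_integral => x _; rewrite patchE indicE; case: ifP => _.
  by apply: eq_integral => y _; rewrite mul1e.
by rewrite integral0_eq// => y _; rewrite mul0e.
Qed.

Lemma measurable_ge0_int (F : X * Y -> \bar R) : measurable_fun setT F ->
  (forall p, 0 <= F p)%E -> measurable_fun setT (fun x => \int[nu]_y F (x, y))%E.
Proof. by move=> mF F0; exact: measurable_fun_fubini_tonelli_F. Qed.

Lemma measurable_ge0_int2 (F : X * Y -> \bar R) : measurable_fun setT F ->
  (forall p, 0 <= F p)%E -> measurable_fun setT (fun y => \int[P]_(x in D) F (x, y))%E.
Proof.
move=> mF F0.
pose G p := ((\1_D p.1)%:E * F p)%E.
have mG : measurable_fun setT G.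
  apply: emeasurable_funM => //; apply/measurable_EFinP.
  by apply: measurableT_comp => //; exact: measurable_indic.
have G0 p : (0 <= G p)%E by rewrite mule_ge0// lee_fin.
rewrite (_ : (fun y => _) = (fun y => \int[P]_x G (x, y))%E).
  exact: measurable_fun_fubini_tonelli_G.
apply/funext => y; rewrite integral_mkcond; apply: eq_integral => x _.
by rewrite /G/= indicE patchE; case: ifP; rewrite ?mul1e ?mul0e.
Qed.

(** A real integral is the finite part of an extended one, and the two agree only under
    integrability. Hence the assumptions on both kinds of inner integral; the last one makes the
    common value finite. *)
Lemma Rint_tonelli (F : X -> Y -> R) :
  measurable_fun setT (fun p : X * Y => F p.1 p.2) ->
  (forall x y, 0 <= F x y) ->
  (forall x, nu.-integrable setT (EFin \o F x)) ->
  (forall y, P.-integrable D (EFin \o (F ^~ y))) ->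
  P.-integrable D (EFin \o fun x => \int[nu]_y F x y) ->
  nu.-integrable setT (EFin \o fun y => \int[P]_(x in D) F x y) /\
  \int[P]_(x in D) \int[nu]_y F x y = \int[nu]_y \int[P]_(x in D) F x y.
Proof.
move=> mF F0 iF1 iF2 iF.
have mEF : measurable_fun setT (fun p => (F p.1 p.2)%:E) by exact/measurable_EFinP.
have H : (\int[P]_(x in D) (\int[nu]_y F x y)%R%:E =
          \int[nu]_y (\int[P]_(x in D) F x y)%R%:E)%E.
  under eq_integral do rewrite -(integral_EFin measurableT (iF1 _)).
  under [RHS]eq_integral do rewrite -(integral_EFin mD (iF2 _)).
  by rewrite (ge0_tonelli mEF)// => p; rewrite lee_fin.
have i2 : nu.-integrable setT (EFin \o fun y => \int[P]_(x in D) F x y).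
  apply: intg_lty => //.
  - apply/measurable_EFinP.
    rewrite (_ : (_ \o _) = (fun y => \int[P]_(x in D) (F x y)%:E)%E).
      by apply: (measurable_ge0_int2 mEF) => p; rewrite lee_fin.
    by apply/funext => y /=; rewrite (integral_EFin mD (iF2 _)).
  - by move=> y _; apply: Rintegral_ge0.
  - by rewrite -H integral_EFin// ltry.
split=> //; apply: EFin_inj; rewrite -integral_EFin//.
by rewrite H integral_EFin.
Qed.

End tonelli.

(** * Limits of real sequences and pointwise accumulation *)

Section sequence_limits.
Context {R : realType}.
Implicit Types (u v : nat -> R) (l m : R).

Lemma cvg_seq_le u v l m : u @ \oo --> l -> v @ \oo --> m ->
  (forall n, u n <= v n) -> l <= m.
Proof. by move=> ul vm uv; apply: (ler_cvg_to ul vm); exact: nearW. Qed.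

Lemma cvg_seq_le_cst u l m : u @ \oo --> l -> (forall n, u n <= m) -> l <= m.
Proof. by move=> ul um; apply: (cvg_seq_le ul (cvg_cst m)). Qed.

Lemma cvg_seq_ge_cst u l m : u @ \oo --> l -> (forall n, m <= u n) -> m <= l.
Proof. by move=> ul um; apply: (cvg_seq_le (cvg_cst m) ul). Qed.

Lemma cvg_seq_le_cst_from u l m N : u @ \oo --> l ->
  (forall n, (N <= n)%N -> u n <= m) -> l <= m.
Proof.
move=> ul um; have cm : (fun=> m : R) @ \oo --> m by exact: cvg_cst.
by apply: (ler_cvg_to ul cm); exists N.
Qed.

Lemma cvg_seq_powR u l r : 0 < l -> (forall n, 0 < u n) -> u @ \oo --> l ->
  (fun n => u n `^ r) @ \oo --> l `^ r.
Proof.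
move=> l0 u0 ul; rewrite /powR (gt_eqF l0).
rewrite (_ : (fun n => _) = (fun n => expR (r * ln (u n)))); last first.
  by apply/funext => n; rewrite (gt_eqF (u0 n)).
apply: continuous_cvg; first exact: continuous_expR.
apply: cvgM; first exact: cvg_cst.
by apply: continuous_cvg => //; exact: continuous_ln.
Qed.

(** For uncountable [Y] the product of segments is compact but not sequentially so: Tychonoff gives
    a cluster point, not a convergent subsequence. The conclusion keeps what a cluster point offers,
    approximation on finitely many points at arbitrarily late indices. *)
Lemma pointwise_accumulation {Y : choiceType} (lo hi : Y -> R) (V_ : nat -> Y -> R) :
  (forall k y, lo y <= V_ k y <= hi y) ->
  exists V : Y -> R, forall (ys : seq Y) e N, 0 < e ->
    exists2 k, (N <= k)%N & forall y, y \in ys -> `|V y - V_ k y| < e.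
Proof.
move=> VA; pose A (y : Y) : set R := [set r | lo y <= r <= hi y].
have Aco := @tychonoff Y (fun=> R) A.
have {}Aco : compact [set g : prod_topology (fun _ : Y => R) | forall y, A y (g y)].
  apply: Aco => y; rewrite (_ : A y = `[lo y, hi y]%classic).
    exact: segment_compact.
  by apply/seteqP; split => r /=; rewrite in_itv.
have [|V [_ clV]] := Aco ((V_ : nat -> prod_topology (fun _ : Y => R)) @ \oo) _.
  by exists 0%N => // k _ y; exact: VA.
exists V => ys e N e0.
(* Finitely many evaluations, each continuous, cut out a neighbourhood in the product topology. *)
have nV : nbhs V [set g : prod_topology (fun _ : Y => R) | forall y, y \in ys -> `|V y - g y| < e].
  elim: ys => [|y ys IH]; first by apply: filterS filterT.
  have ny : nbhs V [set g : prod_topology (fun _ : Y => R) | `|V y - g y| < e].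
    apply: (@proj_continuous Y (fun=> R) y V [set r | `|V y - r| < e]).
    exact: nbhsx_ballx.
  apply: filterS (filterI ny IH) => g /= [gy gys] z; rewrite inE => /predU1P[->//|].
  exact: gys.
have [g [[k Nk <-] kV]] : (V_ @` [set k | (N <= k)%N] : set (prod_topology (fun _ : Y => R))) `&`
    [set g : prod_topology (fun _ : Y => R) |
       forall y, y \in ys -> `|V y - g y| < e] !=set0.
  by apply: clV nV; exists N => // k Nk /=; exists k.
by exists k.
Qed.

End sequence_limits.

(** * Elementary inequalities for powers and logarithms *)

Section real_inequalities.
Context {R : realType}.
Implicit Types x y r s q : R.

Lemma ln_le_subr1 x : 0 < x -> ln x <= x - 1.
Proof.
move=> x0; have := @le_ln1Dx R (x - 1); rewrite [1 + _]addrC subrK; apply; lra.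
Qed.

Lemma ln_lt_subr1 x : 0 < x -> x != 1 -> ln x < x - 1.
Proof.
move=> x0 x1; have l0 : ln x != 0 by rewrite ln_eq0.
by have := expR_gt1Dx l0; rewrite lnK ?posrE// ltrBrDl.
Qed.

Lemma le_powRN x y r : 0 <= r -> 0 < x -> x <= y -> y `^ (- r) <= x `^ (- r).
Proof.
move=> r0 x0 xy; have y0 := lt_le_trans x0 xy.
rewrite !powRN lef_pV2 ?posrE ?powR_gt0// ge0_ler_powR// nnegrE ltW//.
Qed.

(** The left-hand side is the tangent at [y] of the power -q. By homogeneity only the ratio s = x/y
    matters, and exp(-q ln s) >= 1 - q ln s > 1 - q (s - 1). *)
Lemma powRN_tangent_lt x y q : 0 < q -> 0 < x -> 0 < y -> x != y ->
  y `^ (- q) * (1 + q - q * (x / y)) < x `^ (- q).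
Proof.
move=> q0 x0 y0 xy; have s0 : 0 < x / y by rewrite divr_gt0.
have xE : x = y * (x / y) by rewrite mulrC divfK ?gt_eqF.
set s := x / y in s0 xE *; have s1 : s != 1.
  by apply: contra xy => /eqP s1; rewrite xE s1 mulr1.
rewrite xE powRM ?(ltW y0) ?(ltW s0)// ltr_pM2l ?powR_gt0//.
rewrite /powR gt_eqF//; apply: lt_le_trans (expR_ge1Dx _).
by have := ln_lt_subr1 s0 s1; rewrite -(ltr_pM2l q0); lra.
Qed.

Lemma powRN_tangent x y q : 0 < q -> 0 < x -> 0 < y ->
  y `^ (- q) * (1 + q - q * (x / y)) <= x `^ (- q).
Proof.
move=> q0 x0 y0; have [->|xy] := eqVneq x y; last exact/ltW/powRN_tangent_lt.
by rewrite divff ?gt_eqF// mulr1 addrK mulr1.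
Qed.

(* Convexity of [x `^ (- q)]. *)
Lemma powRN_spread a b a' b' q : 0 < q -> 0 < a -> 0 < b -> 0 < a' -> 0 < b' ->
  a' <= a -> a' <= b -> a' + b' = a + b ->
  a `^ (- q) + b `^ (- q) <= a' `^ (- q) + b' `^ (- q) /\
  (a' < a -> a' < b ->
   a `^ (- q) + b `^ (- q) < a' `^ (- q) + b' `^ (- q)).
Proof.
wlog ab : a b / a <= b => [H q0 a0 b0 a'0 b'0 a'a a'b E|q0 a0 b0 a'0 b'0 a'a a'b E].
  have [ab|/ltW ba] := leP a b; first by apply: H => //.
  have E2 : a' + b' = b + a by rewrite E addrC.
  have [H1 H2] := H b a ba q0 b0 a0 a'0 b'0 a'b a'a E2.
  by rewrite [a `^ _ + _]addrC; split=> // ? ?; exact: H2.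
(* [g] is minus the derivative of the power -q, hence non-increasing. Passing to [a'] and [b'] moves
   [a] down and [b] up by the same amount, so the tangents at [a] and [b] give the inequality. *)
pose g y := q * y `^ (- (q + 1)).
have g0 y : 0 < y -> y `^ (- q) = y * y `^ (- (q + 1)).
  move=> y0; have -> : - q = 1 + - (q + 1) by ring.
  by rewrite powRD ?powRr1 ?(ltW y0)//; apply/implyP; rewrite (gt_eqF y0).
have tangE x y : 0 < x -> 0 < y ->
    y `^ (- q) * (1 + q - q * (x / y)) = y `^ (- q) + g y * (y - x).
  by move=> x0 y0; rewrite /g g0//; field; rewrite gt_eqF.
have gab : g b <= g a.
  by rewrite /g ler_pM2l// le_powRN// addr_ge0// ltW.
have b'b : b' = b + (a - a') by rewrite -(addKr a' b') E; ring.
have Hb := powRN_tangent q0 b'0 b0; rewrite tangE// in Hb.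
have gd : g b * (a - a') <= g a * (a - a') by rewrite ler_wpM2r// subr_ge0.
have bE : g b * (b - b') = - (g b * (a - a')) by rewrite b'b; ring.
rewrite bE in Hb; split.
  by have := powRN_tangent q0 a'0 a0; rewrite tangE//; lra.
move=> lt1 _; have := powRN_tangent_lt q0 a'0 a0 (negbT (lt_eqF lt1)).
by rewrite tangE//; lra.
Qed.

(** The tangent of x ln x at [y]; the case x = 0 relies on ln 0 = 0. *)
Lemma xlnx_ge x y : 0 <= x -> 0 < y -> x * ln y + x - y <= x * ln x.
Proof.
rewrite le_eqVlt => /predU1P[<-|x0] y0; first by rewrite !mul0r; lra.
have := ln_le_subr1 (divr_gt0 y0 x0); rewrite ln_div ?posrE//.
rewrite -(ler_pM2l x0) mulrBr mulrBr mulrCA divff ?gt_eqF//; lra.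
Qed.

(** The arithmetic of one descent step: [H], [H'] are the entropies of a density and of its Gibbs
    state, [G], [G'] their negative masses, [Z] the logarithm of the partition function. Since ln r
    <= r - 1, the terms linear in [r] cancel. *)
Lemma tangent_combine (ka q r G G' H H' Z : R) : 0 < ka -> 0 < q -> 0 < r ->
  0 < G -> r `^ (- q) * G <= G' -> H' = - (ka * r) - Z -> - ka - Z <= H ->
  H' - ka / q * ln G' <= H - ka / q * ln G.
Proof.
move=> ka0 q0 r0 G0 rG -> HZ; have rp : 0 < r `^ (- q) by rewrite powR_gt0.
have lG : - q * (r - 1) + ln G <= ln G'.
  apply: (@le_trans _ _ (ln (r `^ (- q) * G))); last first.
    by rewrite ler_ln// posrE ?mulr_gt0// (lt_le_trans _ rG)// mulr_gt0.
  by rewrite lnM ?posrE// ln_powR lerD2r !mulNr lerN2 ler_pM2l// ln_le_subr1.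
have kq : 0 < ka / q by rewrite divr_gt0.
have E : ka / q * (- q * (r - 1)) = - ka * (r - 1) by field; rewrite gt_eqF.
by move: lG; rewrite -(ler_pM2l kq) mulrDr E; lra.
Qed.

End real_inequalities.

(** * Free energy of a kernel on an abstract pair of spaces *)

Section log_kernel_functional.
Context {d1 d2} {X : measurableType d1} {Y : measurableType d2} {R : realType}.
Context (P : {sigma_finite_measure set X -> \bar R}) (D : set X) (mD : measurable D).
Context (nu : {sigma_finite_measure set Y -> \bar R}).
Context (K : X -> Y -> R) (a : X -> R) (b : Y -> R) (c0 q ka : R).
Implicit Types (f V : Y -> R) (u : X -> R).

Definition kint f x := \int[nu]_y (K x y * f y).
Definition negmass u := \int[P]_(x in D) (u x `^ (- q)).
(** For u = K f this is the first variation at [f] of the interaction term - ka/q ln (negmass (K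
    f)). *)
Definition potential u y :=
  ka / negmass u * \int[P]_(x in D) (K x y * u x `^ (- (q + 1))).
Definition partition V := \int[nu]_y expR (- V y).
Definition gibbs V y := expR (- V y) / partition V.
Definition ent f := \int[nu]_y (f y * ln (f y)).
Definition free_energy f := ent f - ka / q * ln (negmass (kint f)).
(** A pseudometric on [Y] for which the potentials of all comparable functions are Lipschitz with
    one constant. *)
Definition moddist y z :=
  \int[P]_(x in D) (`|K x y - K x z| * a x `^ (- (q + 1))).

(** The finite [b]-moment is what makes [kint f] finite everywhere. *)
Definition density f := [/\ (forall y, 0 <= f y), measurable_fun setT f,
  nu.-integrable setT (EFin \o fun y => b y * f y),
  \int[nu]_y f y = 1 & nu.-integrable setT (EFin \o fun y => f y * ln (f y))].

Definition comparable c C u := [/\ 0 < c, measurable_fun setT u &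
  forall x, c * a x <= u x <= C * a x].

(** The lower bound makes exp(-V) integrable with all the moments used; the upper bound keeps the
    partition function away from zero. One [C] serves both as additive and as multiplicative
    constant. *)
Definition confining c C V := [/\ 0 < c, measurable_fun setT V &
  forall y, c * b y - C <= V y <= C * b y].

Hypothesis mK : measurable_fun setT (fun p : X * Y => K p.1 p.2).
Hypotheses (ma : measurable_fun setT a) (mb : measurable_fun setT b).
Hypotheses (a1 : forall x, 1 <= a x) (b1 : forall y, 1 <= b y).
Hypothesis K0 : forall x y, 0 <= K x y.
Hypothesis c01 : 1 <= c0.
(** These three bounds are the quasi-triangle inequalities of a power of the distance, with [a] and
    [b] playing the distances to the origin. *)
Hypothesis Kab : forall x y, K x y <= c0 * (a x * b y).
Hypothesis aKb : forall x y, a x <= c0 * (K x y + b y).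
Hypothesis bKa : forall x y, b y <= c0 * (K x y + a x).
Hypotheses (q0 : 0 < q) (ka0 : 0 < ka).
Hypothesis ia : P.-integrable D (EFin \o fun x => a x `^ (- q)).
Hypothesis PD : (0 < P D)%E.
Hypothesis ib : forall c, 0 < c ->
  nu.-integrable setT (EFin \o fun y => b y * expR (- (c * b y))).
Hypothesis nuT : (0 < nu setT)%E.
Hypothesis kint_pos : forall f, density f ->
  exists2 c, 0 < c & forall x, c <= kint f x.

Let a0 x : 0 < a x. Proof. exact: lt_le_trans (a1 x). Qed.
Let b0 y : 0 < b y. Proof. exact: lt_le_trans (b1 y). Qed.
Let c00 : 0 < c0. Proof. exact: lt_le_trans c01. Qed.
Let mT := @measurableT _ Y.

Let mK1 x : measurable_fun setT (K x).
Proof. exact: (measurableT_comp mK (measurable_pair1 x)). Qed.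

Let mK2 y : measurable_fun D (K ^~ y).
Proof.
apply: measurable_funS (measurableT_comp mK (measurable_pair2 y)) => //.
Qed.

Let mpow r u : measurable_fun setT u -> measurable_fun D (fun x => u x `^ r).
Proof.
move=> mu; apply: measurable_funS (measurableT_comp (measurable_powR r) mu) => //.
Qed.

(** * Bounds on K f and on functions comparable to the weight *)

Lemma density_int f : density f -> nu.-integrable setT (EFin \o f).
Proof.
move=> [f0 mf ibf _ _]; apply: intg_dominated ibf _ => // y _.
by rewrite ger0_norm// ler_peMl.
Qed.

Lemma density_kint f x : density f ->
  nu.-integrable setT (EFin \o fun y => K x y * f y).
Proof.
move=> [f0 mf ibf _ _].
apply: (intg_dominated mT (g := fun y => (c0 * a x) * (b y * f y))) => [||y _].
- exact: measurable_funM.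
- exact: intgZ.
- rewrite ger0_norm ?mulr_ge0// mulrA ler_wpM2r//.
  by rewrite -mulrA.
Qed.

Lemma kint_le f x : density f -> kint f x <= c0 * (\int[nu]_y (b y * f y)) * a x.
Proof.
move=> df; have := density_kint x df; case: df => f0 mf ibf _ _ ik.
rewrite mulrAC -RintegralZl//; apply: le_Rintegral => //; first exact: intgZ.
by move=> y _; rewrite mulrA ler_wpM2r// -mulrA.
Qed.

Lemma weight_le_kint f x : density f ->
  a x <= c0 * (kint f x + \int[nu]_y (b y * f y)).
Proof.
move=> df; have ik := density_kint x df; have i1 := density_int df.
case: df => f0 mf ibf f1 _.
rewrite -RintegralD// -RintegralZl//; last exact: intgD.
rewrite -[leLHS]mulr1 -f1 -RintegralZl//; apply: le_Rintegral => //.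
- exact: intgZ.
- by apply: intgZ => //; exact: intgD.
- by move=> y _; rewrite -mulrDl mulrA ler_wpM2r.
Qed.

Lemma measurable_kint f : density f -> measurable_fun setT (kint f).
Proof.
move=> df; apply/measurable_EFinP.
have mF : measurable_fun setT (fun p : X * Y => (K p.1 p.2 * f p.2)%:E).
  apply/measurable_EFinP/measurable_funM => //.
  by case: df => _ mf _ _ _; exact: measurableT_comp.
rewrite (_ : _ \o _ = (fun x => \int[nu]_y (K x y * f y)%:E)%E).
  by apply: (measurable_ge0_int nu mF) => p; rewrite lee_fin mulr_ge0//; case: df.
by apply/funext => x /=; rewrite integral_EFin//; exact: density_kint.
Qed.

Lemma comparable_kint f : density f -> exists c C, comparable c C (kint f).
Proof.
move=> df; have [c cp cf] := kint_pos df.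
set m := \int[nu]_y (b y * f y).
have m0 : 0 <= m.
  by apply: Rintegral_ge0 => y _; rewrite mulr_ge0 ?(ltW (b0 _))//; case: df.
have cm : 0 < c0 * (1 + m / c) by rewrite mulr_gt0// ltr_wpDr// divr_ge0// ltW.
(* Since K f >= c, the moment satisfies m <= (m / c) K f, so [weight_le_kint] gives a <= c0 (1 + m /
   c) K f. *)
exists (c0 * (1 + m / c))^-1, (c0 * m); split.
- by rewrite invr_gt0.
- exact: measurable_kint.
- move=> x; rewrite kint_le// andbT ler_pdivrMl// (le_trans (weight_le_kint x df))//.
  rewrite -mulrA ler_pM2l// mulrDl mul1r lerD2l -/m.
  by rewrite -mulrA ler_peMr// ler_pdivlMl// mulr1.
Qed.

Lemma comparable_gt0 c C u (x : X) : comparable c C u -> 0 < u x.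
Proof. by move=> [c_0 _ /(_ x)/andP[cu _]]; exact: lt_le_trans (mulr_gt0 c_0 (a0 x)) cu. Qed.

Lemma comparable_ub c C u (x : X) : comparable c C u -> 0 < C.
Proof.
move=> cu; have := comparable_gt0 x cu; case: cu => _ _ /(_ x)/andP[_ uC] u0.
by rewrite -(pmulr_lgt0 _ (a0 x)) (lt_le_trans u0).
Qed.

Lemma comparable_pow_le c C u (x : X) r : 0 <= r -> comparable c C u ->
  u x `^ (- r) <= c `^ (- r) * a x `^ (- r).
Proof.
move=> r0 [c_0 _ /(_ x)/andP[cu _]]; rewrite -powRM ?(ltW (a0 x)) ?(ltW c_0)//.
by rewrite le_powRN// mulr_gt0.
Qed.

Lemma comparable_pow_ge c C u (x : X) r : 0 <= r -> comparable c C u ->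
  C `^ (- r) * a x `^ (- r) <= u x `^ (- r).
Proof.
move=> r0 cu; have C0 := comparable_ub x cu.
rewrite -powRM ?(ltW (a0 x)) ?(ltW C0)//.
by rewrite le_powRN// ?(comparable_gt0 x cu)//; case: cu => _ _ /(_ x)/andP[].
Qed.

Lemma weight_powS x : a x * a x `^ (- (q + 1)) = a x `^ (- q).
Proof.
have -> : - q = 1 + - (q + 1) by ring.
rewrite powRD; last by apply/implyP; rewrite (gt_eqF (a0 x)).
by rewrite powRr1// ltW.
Qed.

Lemma weight_pow_int : P.-integrable D (EFin \o fun x => a x `^ (- (q + 1))).
Proof.
apply: intg_dominated ia _ => //; first exact: mpow.
move=> x _; rewrite ger0_norm ?powR_ge0// -weight_powS.
by rewrite ler_peMl// powR_ge0.
Qed.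

Lemma comparable_int c C u : comparable c C u ->
  P.-integrable D (EFin \o fun x => u x `^ (- q)).
Proof.
move=> cu; have [_ mu _] := cu.
apply: (intg_dominated mD (g := fun x => c `^ (- q) * a x `^ (- q))).
- exact: mpow.
- exact: intgZ.
- by move=> x _; rewrite ger0_norm ?powR_ge0// (comparable_pow_le _ _ cu)// ltW.
Qed.

Lemma comparable_intS c C u : comparable c C u ->
  P.-integrable D (EFin \o fun x => u x `^ (- (q + 1))).
Proof.
move=> cu; have [_ mu _] := cu; have q10 : 0 <= q + 1 by rewrite addr_ge0// ltW.
apply: (intg_dominated mD (g := fun x => c `^ (- (q + 1)) * a x `^ (- (q + 1)))).
- exact: mpow.
- by apply: intgZ => //; exact: weight_pow_int.
- by move=> x _; rewrite ger0_norm ?powR_ge0// (comparable_pow_le _ _ cu).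
Qed.

Lemma comparable_intM c C u (w : X -> R) (M : R) : comparable c C u -> measurable_fun D w ->
  (forall x, 0 <= w x <= M * a x) ->
  P.-integrable D (EFin \o fun x => w x * u x `^ (- (q + 1))).
Proof.
move=> cu mw wa; have [_ mu _] := cu.
have q10 : 0 <= q + 1 by rewrite addr_ge0// ltW.
apply: (intg_dominated mD (g := fun x => (M * c `^ (- (q + 1))) * a x `^ (- q))).
- by apply: measurable_funM => //; exact: mpow.
- exact: intgZ.
- move=> x _; have /andP[w0 wM] := wa x.
  rewrite ger0_norm ?mulr_ge0 ?powR_ge0// -weight_powS mulrACA.
  by rewrite ler_pM ?powR_ge0// (comparable_pow_le _ _ cu).
Qed.

Lemma comparable_intK c C u y : comparable c C u ->
  P.-integrable D (EFin \o fun x => K x y * u x `^ (- (q + 1))).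
Proof.
move=> cu; apply: (comparable_intM (M := c0 * b y) cu) => // x.
by rewrite K0/= (le_trans (Kab x y))// -mulrA [b y * _]mulrC.
Qed.

Lemma negmass_gt0 c C u : comparable c C u -> 0 < negmass u.
Proof.
move=> cu; apply: Rint_gt0 => //; first exact: comparable_int cu.
by move=> x _; rewrite powR_gt0// (comparable_gt0 x cu).
Qed.

(** * Gibbs states and the descent step *)

Lemma confining_ub_gt0 c C V (y : Y) : confining c C V -> 0 < C.
Proof.
move=> [c_0 _ /(_ y)/andP[Vl Vu]]; have cb : 0 < c * b y by rewrite mulr_gt0.
have := le_trans Vl Vu; rewrite lerBlDr -[X in _ + X]mulr1 -mulrDr => cC.
rewrite -(pmulr_lgt0 _ (ltr_wpDr (@ler01 R) (b0 y))).
exact: lt_le_trans cb cC.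
Qed.

Lemma confining_norm c C V y : confining c C V -> `|V y| <= C * b y.
Proof.
move=> cV; have C0 := confining_ub_gt0 y cV; case: cV => c_0 _ /(_ y)/andP[Vl Vu].
rewrite ler_norml Vu andbT (le_trans _ Vl)//.
have cb : 0 < c * b y by rewrite mulr_gt0.
have : C <= C * b y by rewrite ler_peMr// ltW.
lra.
Qed.

Lemma confining_expR c C V y : confining c C V ->
  expR (- V y) <= expR C * expR (- (c * b y)).
Proof.
move=> [_ _ /(_ y)/andP[Vl _]]; rewrite -expRD ler_expR; lra.
Qed.

Let ibC c C : 0 < c ->
  nu.-integrable setT (EFin \o fun y => expR C * (b y * expR (- (c * b y)))).
Proof. by move=> c_0; apply: intgZ => //; exact: ib. Qed.

Let mexp V : measurable_fun setT V -> measurable_fun setT (fun y => expR (- V y)).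
Proof. by move=> mV; apply: measurableT_comp => //; exact: measurable_funN. Qed.

Lemma confining_intb c C V : confining c C V ->
  nu.-integrable setT (EFin \o fun y => b y * expR (- V y)).
Proof.
move=> cV; have [c_0 mV _] := cV; apply: intg_dominated (ibC C c_0) _ => //.
  by apply: measurable_funM => //; exact: mexp.
move=> y _; rewrite ger0_norm ?mulr_ge0 ?expR_ge0 ?(ltW (b0 y))// mulrCA.
by rewrite ler_pM2l// confining_expR.
Qed.

Lemma confining_int c C V : confining c C V ->
  nu.-integrable setT (EFin \o fun y => expR (- V y)).
Proof.
move=> cV; apply: intg_dominated (confining_intb cV) _ => //.
  by apply: mexp; case: cV.
by move=> y _; rewrite ger0_norm ?expR_ge0// ler_peMl// expR_ge0.
Qed.

Lemma partition_gt0 c C V : confining c C V -> 0 < partition V.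
Proof.
move=> cV; apply: Rint_gt0 => //; first exact: confining_int cV.
by move=> y _; exact: expR_gt0.
Qed.

Lemma gibbs_gt0 c C V y : confining c C V -> 0 < gibbs V y.
Proof. by move=> cV; rewrite divr_gt0 ?expR_gt0// (partition_gt0 cV). Qed.

Lemma ln_gibbs c C V y : confining c C V -> ln (gibbs V y) = - V y - ln (partition V).
Proof.
by move=> cV; rewrite ln_div ?expRK// posrE ?expR_gt0// (partition_gt0 cV).
Qed.

Lemma confining_intV c C V f : confining c C V -> density f ->
  nu.-integrable setT (EFin \o fun y => V y * f y).
Proof.
move=> cV [f0 mf ibf _ _].
apply: (intg_dominated mT (g := fun y => C * (b y * f y))) => [||y _].
- by apply: measurable_funM => //; case: cV.
- exact: intgZ.
- by rewrite normrM (ger0_norm (f0 y)) mulrA ler_wpM2r// (confining_norm y cV).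
Qed.

Lemma gibbs_density c C V : confining c C V -> density (gibbs V).
Proof.
move=> cV; have Z0 := partition_gt0 cV; have g0 y := gibbs_gt0 y cV.
have [_ mV _] := cV.
have mg : measurable_fun setT (gibbs V).
  by apply: measurable_funM => //; exact: mexp.
have ig : nu.-integrable setT (EFin \o gibbs V).
  apply: eq_intg (intgZ mT (partition V)^-1 (confining_int cV)) => // y _.
  by rewrite mulrC.
have ibg : nu.-integrable setT (EFin \o fun y => b y * gibbs V y).
  apply: eq_intg (intgZ mT (partition V)^-1 (confining_intb cV)) => // y _.
  by rewrite mulrCA [_^-1 * _]mulrC.
split; [by move=> y; exact/ltW|exact: mg|exact: ibg| |].
- rewrite RintegralZr//; last exact: confining_int cV.
  by rewrite -/(partition V) divff// gt_eqF.
- apply: (intg_dominated mT (g := fun y => C * (b y * gibbs V y) + `|ln (partition V)| * gibbs V y)).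
  + apply: measurable_funM => //.
    by apply: measurableT_comp => //; exact: measurable_ln.
  + by apply: intgD => //; exact: intgZ.
  + move=> y _; rewrite (ln_gibbs y cV) normrM (ger0_norm (ltW (g0 y))).
    rewrite mulrA -mulrDl [leRHS]mulrC ler_pM2l// (le_trans (ler_normB _ _))//.
    by rewrite normrN lerD2r (confining_norm y cV).
Qed.

Lemma ent_gibbs c C V : confining c C V ->
  ent (gibbs V) = - (\int[nu]_y (V y * gibbs V y)) - ln (partition V).
Proof.
move=> cV; have dg := gibbs_density cV; have ig := density_int dg.
have iV := confining_intV cV dg.
transitivity (\int[nu]_y ((-1) * (V y * gibbs V y) + (- ln (partition V)) * gibbs V y)).
  by apply: eq_Rint => y _; rewrite (ln_gibbs y cV); ring.
rewrite RintegralD//; try exact: intgZ.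
rewrite RintegralZl// RintegralZl//.
by have [_ _ _ -> _] := dg; rewrite mulN1r mulr1.
Qed.

(* The Gibbs variational principle. *)
Lemma ent_ge c C V f : confining c C V -> density f ->
  - (\int[nu]_y (V y * f y)) - ln (partition V) <= ent f.
Proof.
move=> cV df; have dg := gibbs_density cV; have ig := density_int dg.
have iV := confining_intV cV df; have i_f := density_int df.
have [f0 mf ibf f1 ief] := df; have [_ _ _ g1 _] := dg.
(* The pointwise bound is the tangent of x ln x at the Gibbs state; its terms f and - gibbs V cancel
   in the integral, both having mass one. *)
have -> : - (\int[nu]_y (V y * f y)) - ln (partition V) = \int[nu]_y
    ((-1) * (V y * f y) + (1 - ln (partition V)) * f y - gibbs V y).
  rewrite RintegralB//; last by apply: intgD => //; exact: intgZ.
  rewrite RintegralD//; try exact: intgZ.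
  by rewrite RintegralZl// RintegralZl// f1 g1; ring.
apply: le_Rintegral => //.
  by apply: intgB => //; apply: intgD => //; exact: intgZ.
move=> y _; have := xlnx_ge (f0 y) (gibbs_gt0 y cV); rewrite (ln_gibbs y cV).
by apply: le_trans; rewrite le_eqVlt; apply/orP; left; apply/eqP; ring.
Qed.

(* Jensen's inequality for [r |-> r `^ (- q)] and the probability measure
   with density proportional to [u `^ (- q)] *)
Lemma negmass_ge c C c' C' u v : comparable c C u -> comparable c' C' v ->
  let r := (\int[P]_(x in D) (v x * u x `^ (- (q + 1)))) / negmass u in
  0 < r /\ r `^ (- q) * negmass u <= negmass v.
Proof.
move=> cu cv r; have G0 := negmass_gt0 cu.
have [_ mv vb] := cv.
have iu := comparable_int cu; have iv := comparable_int cv.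
have iw : P.-integrable D (EFin \o fun x => v x * u x `^ (- (q + 1))).
  apply: (comparable_intM (M := C') cu); first exact: measurable_funS mv.
  by move=> x; have /andP[_ ->] := vb x; rewrite (ltW (comparable_gt0 x cv)).
have r0 : 0 < r.
  rewrite divr_gt0//; apply: Rint_gt0 => // x _.
  by rewrite mulr_gt0 ?powR_gt0 ?(comparable_gt0 x cu) ?(comparable_gt0 x cv).
split; first exact: r0.
have -> : r `^ (- q) * negmass u = \int[P]_(x in D)
  ((r `^ (- q) * (1 + q)) * u x `^ (- q) - (r `^ (- q) * (q / r)) * (v x * u x `^ (- (q + 1)))).
  rewrite RintegralB//; try exact: intgZ.
  rewrite RintegralZl// RintegralZl// -/(negmass u).
  have -> : \int[P]_(x in D) (v x * u x `^ (- (q + 1))) = r * negmass u.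
    by rewrite divfK// gt_eqF.
  by field; rewrite gt_eqF.
apply: le_Rintegral => //; first by apply: intgB => //; exact: intgZ.
move=> x _; have u0 := comparable_gt0 x cu; have v0 := comparable_gt0 x cv.
(* The tangent is taken at r u, where [r] is the mean of v / u, so that the linear terms cancel
   after integration. *)
have := powRN_tangent q0 v0 (mulr_gt0 r0 u0); apply: le_trans.
rewrite (@powRM _ r (u x)) ?(ltW r0) ?(ltW u0)// opprD.
rewrite (@powRD _ (u x) (- q) (-1)); last by apply/implyP; rewrite (gt_eqF u0).
rewrite powR_inv1 ?(ltW u0)// le_eqVlt; apply/orP; left; apply/eqP.
by field; rewrite !gt_eqF.
Qed.

(** Tonelli moves the kernel from [u] to [f]; pairing a density with the potential thus becomes an
    integral of K f over [D]. *)
Lemma potential_pairing c C u f : comparable c C u -> density f ->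
  \int[nu]_y (potential u y * f y) =
  ka / negmass u * \int[P]_(x in D) (kint f x * u x `^ (- (q + 1))).
Proof.
move=> cu df; have [f0 mf ibf f1 ief] := df; have [_ mu _] := cu.
pose F x y := u x `^ (- (q + 1)) * (K x y * f y).
have mF : measurable_fun setT (fun p : X * Y => F p.1 p.2).
  apply: measurable_funM.
    exact: (measurableT_comp (measurableT_comp (measurable_powR _) mu) measurable_fst).
  by apply: measurable_funM => //; exact: measurableT_comp.
have FE x : \int[nu]_y F x y = kint f x * u x `^ (- (q + 1)).
  by rewrite RintegralZl 1?mulrC//; exact: density_kint.
have FE2 y : \int[P]_(x in D) F x y =
    (\int[P]_(x in D) (K x y * u x `^ (- (q + 1)))) * f y.
  rewrite -RintegralZr//; last exact: comparable_intK cu.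
  by apply: eq_Rint => x _; rewrite /F; ring.
have [] := @Rint_tonelli _ _ _ _ _ P D mD nu F mF.
- by move=> x y; rewrite /F !mulr_ge0// powR_ge0.
- by move=> x; apply: intgZ => //; exact: density_kint.
- move=> y; apply: eq_intg (intgZ mD (f y) (comparable_intK y cu)) => // x _.
  by rewrite /F; ring.
- rewrite (_ : (fun x => _) = (fun x => kint f x * u x `^ (- (q + 1)))); last exact/funext.
  apply: (comparable_intM (M := c0 * \int[nu]_y (b y * f y)) cu).
    by apply: measurable_funS (measurable_kint df).
  move=> x; rewrite kint_le// andbT; apply: Rintegral_ge0 => y _.
  by rewrite mulr_ge0.
move=> iF eF; transitivity (ka / negmass u * \int[nu]_y \int[P]_(x in D) F x y).
  rewrite -RintegralZl//; apply: eq_Rint => y _.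
  by rewrite /potential FE2 mulrA.
by rewrite -eF; congr (_ * _); apply: eq_Rint => x _.
Qed.

(* [f |-> log (negmass (kint f))] is convex, so replacing it by its tangent at
   [f] bounds the free energy from above; the Gibbs state of the potential
   minimizes the resulting functional. *)
Lemma free_energy_potential c C c' C' f : density f -> comparable c C (kint f) ->
  confining c' C' (potential (kint f)) ->
  free_energy (gibbs (potential (kint f))) <= free_energy f.
Proof.
move=> df; have [u uE] : exists u, kint f = u by exists (kint f).
have [V VE] : exists V, potential u = V by exists (potential u).
rewrite /free_energy uE VE => cu cV.
have dg := gibbs_density cV.
have [c1 [C1 cv]] := comparable_kint dg.
have [r0 rG] := negmass_ge cu cv.
have [r rE] : exists r, (\int[P]_(x in D)
    (kint (gibbs V) x * u x `^ (- (q + 1)))) / negmass u = r by eexists.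
rewrite rE in r0 rG; have G0 := negmass_gt0 cu; have G0' := negmass_gt0 cv.
have Vg : \int[nu]_y (V y * gibbs V y) = ka * r.
  by have := potential_pairing cu dg; rewrite VE => ->; rewrite -rE mulrAC mulrA.
(* Paired with [f] itself, the potential gives exactly [ka], because u times the power -(q+1) of u
   is its power -q. *)
have Vf : \int[nu]_y (V y * f y) = ka.
  have := potential_pairing cu df; rewrite VE uE => ->.
  have -> : \int[P]_(x in D) (u x * u x `^ (- (q + 1))) = negmass u.
    apply: eq_Rint => x _; have u0 := comparable_gt0 x cu.
    have -> : - q = 1 + - (q + 1) by ring.
    rewrite powRD; last by apply/implyP; rewrite (gt_eqF u0).
    by rewrite powRr1// ltW.
  by rewrite -mulrA mulVf ?mulr1// (gt_eqF G0).
have He := ent_ge cV df; rewrite Vf in He.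
apply: (tangent_combine ka0 q0 r0 G0 rG _ He).
by rewrite (ent_gibbs cV) Vg.
Qed.

(** * A uniform class of potentials and continuity of the free energy on it *)

Lemma moddist_int y z :
  P.-integrable D (EFin \o fun x => `|K x y - K x z| * a x `^ (- (q + 1))).
Proof.
apply: (intg_dominated mD (g := fun x => (c0 * (b y + b z)) * a x `^ (- q))).
- apply: measurable_funM; last exact: mpow.
  by apply: measurableT_comp => //; apply: measurable_funB; exact: mK2.
- exact: intgZ.
- move=> x _; rewrite ger0_norm ?mulr_ge0 ?powR_ge0// -weight_powS mulrA.
  rewrite ler_wpM2r ?powR_ge0// (le_trans (ler_normB _ _))// !ger0_norm//.
  by have := Kab x y; have := Kab x z; lra.
Qed.

Lemma moddist_ge0 y z : 0 <= moddist y z.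
Proof. by apply: Rintegral_ge0 => x _; rewrite mulr_ge0 ?powR_ge0. Qed.

Definition tame c C V :=
  confining c C V /\ forall y z, `|V y - V z| <= C * moddist y z.

(** The point is uniformity: the new constants depend on [c] and [C] only, not on [u]. This places
    the whole normalized minimizing sequence in one class. *)
Lemma potential_tame c C : 0 < c -> 0 < C -> exists c' C',
  forall u, comparable c C u -> tame c' C' (potential u).
Proof.
move=> c_0 C_0.
have [g0 g0E] : exists g, \int[P]_(x in D) a x `^ (- q) = g by eexists.
have [g1 g1E] : exists g, \int[P]_(x in D) a x `^ (- (q + 1)) = g by eexists.
have g00 : 0 < g0 by rewrite -g0E; apply: Rint_gt0 => // x _; rewrite powR_gt0.
have g10 : 0 < g1.
  by rewrite -g1E; apply: Rint_gt0 => //; [exact: weight_pow_int|move=> x _; rewrite powR_gt0].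
(* [Gl] and [Gu] bound [negmass u] from below and above; [s] and [S] below compare the power -(q+1)
   of [u] with that of [a]. *)
pose Gl := C `^ (- q) * g0; pose Gu := c `^ (- q) * g0.
have Gl0 : 0 < Gl by rewrite mulr_gt0// powR_gt0.
have Gu0 : 0 < Gu by rewrite mulr_gt0// powR_gt0.
pose s := c `^ (- (q + 1)); pose S := C `^ (- (q + 1)).
have s0 : 0 < s by rewrite powR_gt0.
have S0 : 0 < S by rewrite powR_gt0.
have q10 : 0 <= q + 1 by rewrite addr_ge0// ltW.
have [M1 M1E] : exists M, M = ka / Gl * (c0 * (s * g0)) by eexists.
have [M2 M2E] : exists M, M = ka / Gl * (s * g0) by eexists.
have [M3 M3E] : exists M, M = ka / Gl * s by eexists.
have M10 : 0 < M1 by rewrite M1E !mulr_gt0 ?invr_gt0.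
have M20 : 0 < M2 by rewrite M2E !mulr_gt0 ?invr_gt0.
have M30 : 0 < M3 by rewrite M3E !mulr_gt0 ?invr_gt0.
(* [M1] is for the upper growth bound, [M2] for the additive loss in the lower bound, [M3] for the
   Lipschitz bound; their sum serves all three. *)
exists (ka / Gu * (c0^-1 * (S * g1))), (M1 + M2 + M3) => u cu.
have [_ mu _] := cu.
have iu := comparable_int cu; have iuS := comparable_intS cu.
have kG : 0 < ka / negmass u <= ka / Gl.
  rewrite divr_gt0 ?(negmass_gt0 cu)//= ler_pM2l// lef_pV2 ?posrE ?(negmass_gt0 cu)//.
  rewrite /Gl -g0E -RintegralZl; [|exact: mD|exact: ia].
  apply: le_Rintegral; [exact: mD|exact: intgZ|exact: iu|].
  by move=> x _; apply: comparable_pow_ge cu; exact: ltW.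
have kG' : ka / Gu <= ka / negmass u.
  rewrite ler_pM2l// lef_pV2 ?posrE ?(negmass_gt0 cu)//.
  rewrite /Gu -g0E -RintegralZl; [|exact: mD|exact: ia].
  apply: le_Rintegral; [exact: mD|exact: iu|exact: intgZ|].
  by move=> x _; apply: comparable_pow_le cu; exact: ltW.
have iau : P.-integrable D (EFin \o fun x => a x * u x `^ (- (q + 1))).
  apply: (comparable_intM (M := 1) cu); first exact: measurable_funS ma.
  by move=> x; rewrite mul1r lexx (ltW (a0 x)).
have au : \int[P]_(x in D) (a x * u x `^ (- (q + 1))) <= s * g0.
  rewrite -g0E -RintegralZl; [|exact: mD|exact: ia].
  apply: le_Rintegral; [exact: mD|exact: iau|exact: intgZ|].
  move=> x _; rewrite -weight_powS mulrCA ler_pM2l//.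
  exact: comparable_pow_le cu.
have uS : S * g1 <= \int[P]_(x in D) (u x `^ (- (q + 1))).
  rewrite -g1E -RintegralZl//; last exact: weight_pow_int.
  apply: le_Rintegral => //; first by apply: intgZ => //; exact: weight_pow_int.
  by move=> x _; exact: comparable_pow_ge cu.
have [kG0 kGl] := andP kG.
split; first split.
- by rewrite mulr_gt0 ?divr_gt0// mulr_gt0 ?invr_gt0// mulr_gt0.
- apply: measurable_funM => //; apply/measurable_EFinP.
  have mF : measurable_fun setT
      (fun p : X * Y => (K p.1 p.2 * u p.1 `^ (- (q + 1)))%:E).
    apply/measurable_EFinP/measurable_funM => //.
    exact: (measurableT_comp (measurableT_comp (measurable_powR _) mu) measurable_fst).
  rewrite (_ : _ \o _ = (fun y => \int[P]_(x in D) (K x y * u x `^ (- (q + 1)))%:E)%E).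
    by apply: (measurable_ge0_int2 P mD mF) => p; rewrite lee_fin mulr_ge0// powR_ge0.
  by apply/funext => y /=; rewrite integral_EFin//; exact: comparable_intK cu.
- move=> y; have iK := comparable_intK y cu; apply/andP; split.
  (* [bKa] gives K x y >= b y / c0 - a x, which is integrated against the power -(q+1) of [u]. *)
  + have lo : b y / c0 * (S * g1) - s * g0 <=
        \int[P]_(x in D) (K x y * u x `^ (- (q + 1))).
      apply: (@le_trans _ _ (\int[P]_(x in D)
        (b y / c0 * u x `^ (- (q + 1)) - a x * u x `^ (- (q + 1))))).
        rewrite RintegralB//; last exact: intgZ.
        rewrite RintegralZl// lerB// ler_pM2l// divr_gt0//.
      apply: le_Rintegral => //; first by apply: intgB => //; exact: intgZ.
      move=> x _; rewrite -mulrBl ler_wpM2r ?powR_ge0//.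
      by rewrite lerBlDr ler_pdivrMr// mulrC bKa.
    apply: (@le_trans _ _ (ka / negmass u * (b y / c0 * (S * g1) - s * g0))); last first.
      by rewrite /potential ler_pM2l.
    rewrite mulrBr lerB//.
      rewrite (_ : _ * b y = ka / Gu * (b y / c0 * (S * g1))); last by ring.
      by rewrite ler_wpM2r// mulr_ge0 ?divr_ge0// ?ltW// mulr_gt0.
    apply: (@le_trans _ _ M2); last by rewrite addrAC lerDr; apply: addr_ge0; exact: ltW.
    rewrite M2E; apply: ler_wpM2r kGl; exact/ltW/mulr_gt0.
  + apply: (@le_trans _ _ (M1 * b y)); last first.
      rewrite ler_pM2r; last exact: b0.
      by rewrite -addrA lerDl; apply: addr_ge0; exact: ltW.
    rewrite M1E -mulrA; apply: ler_pM => //; first exact: ltW.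
      by apply: Rintegral_ge0 => x _; rewrite mulr_ge0// powR_ge0.
    apply: (@le_trans _ _ (\int[P]_(x in D) (c0 * b y * (a x * u x `^ (- (q + 1)))))).
      apply: le_Rintegral => //; first exact: intgZ.
      move=> x _; rewrite mulrA ler_wpM2r ?powR_ge0//.
      by rewrite (le_trans (Kab x y))// -mulrA [b y * _]mulrC.
    rewrite RintegralZl// [leRHS]mulrAC; apply: ler_wpM2l au.
    exact/ltW/mulr_gt0.
- move=> y z; have iy := comparable_intK y cu; have iz := comparable_intK z cu.
  rewrite /potential -mulrBr normrM (gtr0_norm kG0) -RintegralB//.
  apply: (@le_trans _ _ (M3 * moddist y z)); last first.
    apply: ler_wpM2r; first exact: moddist_ge0.
    by rewrite lerDr; apply: addr_ge0; exact: ltW.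
  rewrite M3E -mulrA; apply: ler_pM => //; first exact: ltW.
  rewrite (le_trans (le_normr_Rintegral _ _))//; first exact: intgB.
  rewrite /moddist -RintegralZl//; last exact: moddist_int.
  apply: le_Rintegral => //.
  + by apply: intg_norm => //; exact: intgB.
  + by apply: intgZ => //; exact: moddist_int.
  + move=> x _; rewrite -mulrBl normrM (ger0_norm (powR_ge0 _ _)) mulrCA.
    by rewrite ler_wpM2l// (comparable_pow_le _ _ cu).
Qed.

Let Y0 : exists y : Y, True.
Proof.
suff /set0P[y _] : [set: Y] != set0 by exists y.
by apply/eqP => E; move: nuT; rewrite E measure0 ltxx.
Qed.

Lemma tame_cvg c C (V_ : nat -> Y -> R) V : (forall k, tame c C (V_ k)) ->
  (forall y, V_ ^~ y @ \oo --> V y) -> tame c C V.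
Proof.
move=> tV cV; have [[c_0 _ _] _] := tV 0%N; split; first split => //.
- apply: (measurable_fun_cvg (h := V_)) => // k; by have [[]] := tV k.
- move=> y; apply/andP; split.
  + by apply: (cvg_seq_ge_cst (cV y)) => k; have [[_ _ /(_ y)/andP[]]] := tV k.
  + by apply: (cvg_seq_le_cst (cV y)) => k; have [[_ _ /(_ y)/andP[]]] := tV k.
- move=> y z; apply: (cvg_seq_le_cst (cvg_norm (cvgB (cV y) (cV z)))) => k /=.
  by have [_ tVk] := tV k; exact: tVk.
Qed.

(** Dominated convergence for the partition function, for K f, for its negative mass and for the
    entropy. The negative power is the delicate one: it needs a lower bound on K f that is uniform
    along the sequence. *)
Lemma free_energy_cvg c C (V_ : nat -> Y -> R) V : (forall k, tame c C (V_ k)) ->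
  (forall y, V_ ^~ y @ \oo --> V y) ->
  (fun k => free_energy (gibbs (V_ k))) @ \oo --> free_energy (gibbs V).
Proof.
move=> tV_ cV; have tV := tame_cvg tV_ cV.
have cf := tV.1; have cf_ k := (tV_ k).1.
have [c_0 mV _] := cf; have mV_ k : measurable_fun setT (V_ k) by have [] := cf_ k.
have [y0 _] := Y0; have C0 := confining_ub_gt0 y0 cf.
have cE y : (fun k => expR (- V_ k y)) @ \oo --> expR (- V y).
  by apply: continuous_cvg; [exact: continuous_expR|apply: cvgN; exact: cV].
have [M ME] : exists M, \int[nu]_y (expR C * (b y * expR (- (c * b y)))) = M.
  by eexists.
have eM W : confining c C W -> forall y,
    expR (- W y) <= expR C * (b y * expR (- (c * b y))).
  move=> cW y; rewrite (le_trans (confining_expR y cW))// ler_pM2l ?expR_gt0//.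
  by rewrite ler_peMl// expR_ge0.
have ZM W : confining c C W -> partition W <= M.
  move=> cW; rewrite -ME; apply: le_Rintegral => //; first exact: confining_int cW.
    exact: ibC.
  by move=> y _; exact: eM.
have Z_ : (fun k => partition (V_ k)) @ \oo --> partition V.
  apply: (Rint_dominated mT (g := fun y => expR C * (b y * expR (- (c * b y))))).
  - by move=> k; exact: mexp.
  - exact: mexp.
  - by move=> y _; exact: cE.
  - exact: ibC.
  - by move=> k y _; rewrite ger0_norm ?expR_ge0// eM.
have Z0 := partition_gt0 cf; have Z0_ k := partition_gt0 (cf_ k).
have mulK3 (Z k e : R) : 0 < Z -> Z * (k * (e / Z)) = k * e.
  by move=> Zp; field; rewrite gt_eqF.
have Ve W : confining c C W -> \int[nu]_y (W y * gibbs W y) =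
    (\int[nu]_y (W y * expR (- W y))) / partition W.
  move=> cW; have Z0W := partition_gt0 cW.
  have iW : nu.-integrable setT (EFin \o fun y => W y * expR (- W y)).
    apply: eq_intg (intgZ mT (partition W) (confining_intV cW (gibbs_density cW))) => // y _.
    exact: mulK3 Z0W.
  rewrite -RintegralZr//; apply: eq_Rint => y _; by rewrite mulrA.
have Ke x W : confining c C W -> kint (gibbs W) x =
    (\int[nu]_y (K x y * expR (- W y))) / partition W.
  move=> cW; have Z0W := partition_gt0 cW.
  have iW : nu.-integrable setT (EFin \o fun y => K x y * expR (- W y)).
    apply: eq_intg (intgZ mT (partition W) (density_kint x (gibbs_density cW))) => // y _.
    exact: mulK3 Z0W.
  rewrite -RintegralZr//; apply: eq_Rint => y _; by rewrite mulrA.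
have cKe x : (fun k => kint (gibbs (V_ k)) x) @ \oo --> kint (gibbs V) x.
  rewrite (Ke x _ cf) (_ : (fun k => _) =
    (fun k => (\int[nu]_y (K x y * expR (- V_ k y))) / partition (V_ k))); last first.
    by apply/funext => k; rewrite (Ke x _ (cf_ k)).
  apply: cvgM; last by apply: cvgV => //; rewrite gt_eqF.
  apply: (Rint_dominated mT (g := fun y => c0 * a x * (expR C * (b y * expR (- (c * b y)))))).
  - by move=> k; apply: measurable_funM => //; exact: mexp.
  - by apply: measurable_funM => //; exact: mexp.
  - by move=> y _; apply: cvgM; [exact: cvg_cst|exact: cE].
  - by apply: intgZ => //; exact: ibC.
  - move=> k y _; rewrite ger0_norm ?mulr_ge0 ?expR_ge0//.
    apply: (@le_trans _ _ (c0 * (a x * b y) * expR (- V_ k y))).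
      by rewrite ler_wpM2r ?expR_ge0.
    rewrite (_ : c0 * (a x * b y) * _ = c0 * a x * (b y * expR (- V_ k y))); last by ring.
    rewrite ler_pM2l ?mulr_gt0// mulrCA ler_pM2l//; exact: confining_expR (cf_ k).
(* The largest confining potential with these constants. Every other one has exp(-W) >= exp(-W0) and
   a partition function at most [M], so its K f is at least a fixed multiple of the K f of this
   reference state. *)
pose W0 y := C * b y.
have cW0 : confining C C W0.
  by split => // [|y]; [exact: measurable_funM|rewrite lexx andbT lerBlDr lerDl ltW].
have [c1 [C1 cu]] := comparable_kint (gibbs_density cW0).
have [c10 _ _] := cu.
have M0 : 0 < M by exact: lt_le_trans Z0 (ZM _ cf).
have [Z1 Z1E] : exists Z, partition W0 = Z by eexists.
have Z10 : 0 < Z1 by rewrite -Z1E (partition_gt0 cW0).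
have e0 : 0 < Z1 / M by exact: divr_gt0.
have elo W x : confining c C W -> (Z1 / M * c1) * a x <= kint (gibbs W) x.
  move=> cW; apply: (@le_trans _ _ (Z1 / M * kint (gibbs W0) x)).
    by rewrite -mulrA ler_pM2l//; case: cu => _ _ /(_ x)/andP[].
  have d0 := gibbs_density cW0; have dW := gibbs_density cW.
  rewrite -RintegralZl//; last exact: density_kint.
  apply: le_Rintegral => //; [by apply: intgZ => //; exact: density_kint|exact: density_kint|].
  move=> y _; rewrite mulrCA ler_wpM2l//.
  rewrite /gibbs Z1E mulrCA mulrAC divff ?(gt_eqF Z10)// mul1r.
  apply: ler_pM; rewrite ?expR_ge0 ?invr_ge0 ?(ltW M0)//.
    by rewrite ler_expR lerN2; case: cW => _ _ /(_ y)/andP[].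
  by rewrite lef_pV2 ?posrE ?(partition_gt0 cW)// ZM.
have elo0 W x : confining c C W -> 0 < kint (gibbs W) x.
  by move=> cW; apply: lt_le_trans (elo _ x cW); rewrite !mulr_gt0 ?invr_gt0.
have Gcv : (fun k => negmass (kint (gibbs (V_ k)))) @ \oo --> negmass (kint (gibbs V)).
  have ee0 : 0 < Z1 / M * c1 by exact: mulr_gt0.
  apply: (Rint_dominated mD (g := fun x => (Z1 / M * c1) `^ (- q) * a x `^ (- q))).
  - by move=> k; apply: mpow; exact: measurable_kint (gibbs_density (cf_ k)).
  - by apply: mpow; exact: measurable_kint (gibbs_density cf).
  - move=> x _; apply: cvg_seq_powR; [exact: elo0|by move=> k; exact: elo0|exact: cKe].
  - exact: intgZ.
  - move=> k x _; rewrite ger0_norm ?powR_ge0// -powRM ?(ltW (a0 x)) ?(ltW ee0)//.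
    by apply: le_powRN; [exact: ltW|exact: mulr_gt0|exact: elo].
have EV : (fun k => ent (gibbs (V_ k))) @ \oo --> ent (gibbs V).
  rewrite (ent_gibbs cf) (Ve _ cf) (_ : (fun k => _) =
    (fun k => - ((\int[nu]_y (V_ k y * expR (- V_ k y))) / partition (V_ k)) -
      ln (partition (V_ k)))); last first.
    by apply/funext => k; rewrite (ent_gibbs (cf_ k)) (Ve _ (cf_ k)).
  apply: cvgB; last by apply: continuous_cvg => //; exact: continuous_ln.
  apply: cvgN; apply: cvgM; last by apply: cvgV => //; rewrite gt_eqF.
  apply: (Rint_dominated mT (g := fun y => C * (expR C * (b y * expR (- (c * b y)))))).
  - by move=> k; apply: measurable_funM => //; exact: mexp.
  - by apply: measurable_funM => //; exact: mexp.
  - by move=> y _; apply: cvgM; [exact: cV|exact: cE].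
  - by apply: intgZ => //; exact: ibC.
  - move=> k y _; rewrite normrM (ger0_norm (expR_ge0 _)).
    apply: (@le_trans _ _ (C * b y * expR (- V_ k y))).
      by rewrite ler_wpM2r ?expR_ge0// (confining_norm y (cf_ k)).
    rewrite -mulrA ler_pM2l// mulrCA ler_pM2l//; exact: confining_expR (cf_ k).
apply: cvgB; first exact: EV.
apply: cvgM; first exact: cvg_cst.
apply: continuous_cvg; last exact: Gcv.
apply: continuous_ln; have [c2 [C2 cu2]] := comparable_kint (gibbs_density cf).
exact: negmass_gt0 cu2.
Qed.

(** * Compactness of the class and existence of a minimizer *)

Section compactness.
Variable pt : nat -> Y.
Hypothesis pt_dense : forall y e, 0 < e -> exists i, moddist y (pt i) < e.

(** An accumulation point is upgraded to the limit of a subsequence: convergence is arranged on a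
    countable dense set and spread to every point by the common modulus. *)
Lemma tame_compact c C (V_ : nat -> Y -> R) : (forall k, tame c C (V_ k)) ->
  exists (V : Y -> R) (s : nat -> nat), (forall j, (j <= s j)%N) /\
    forall y, (fun j => V_ (s j) y) @ \oo --> V y.
Proof.
move=> tV.
have [|V accV] := @pointwise_accumulation R Y (fun y => c * b y - C) (fun y => C * b y) V_.
  by move=> k y; have [[_ _ /(_ y)]] := tV k.
have modV y z : `|V y - V z| <= C * moddist y z.
  apply/ler_addgt0Pr => e e0; have e2 : 0 < e / 2 by rewrite divr_gt0.
  have [k _ kV] := accV [:: y; z] (e / 2) 0%N e2.
  have [_ /(_ y z)] := tV k.
  have := kV y; rewrite !inE eqxx => /(_ isT).
  have := kV z; rewrite !inE eqxx orbT => /(_ isT).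
  rewrite !ltr_norml !ler_norml => /andP[? ?] /andP[? ?] /andP[? ?]; apply/andP; split; lra.
(* Diagonal choice: the j-th index is good to within 1/(j+1) at the first j+1 dense points. *)
have [s sV] : {s : nat -> nat & forall j, (j <= s j)%N /\
    forall i, (i <= j)%N -> `|V (pt i) - V_ (s j) (pt i)| < j.+1%:R^-1}.
  apply: (@choice _ _ (fun j k => (j <= k)%N /\
    forall i, (i <= j)%N -> `|V (pt i) - V_ k (pt i)| < j.+1%:R^-1)) => j.
  have [|k jk kV] := accV [seq pt i | i <- iota 0 j.+1] (j.+1%:R^-1) j.
    by rewrite invr_gt0.
  exists k; split=> // i ij; apply: kV; apply/mapP; exists i => //.
  by rewrite mem_iota.
exists V, s; split; first by move=> j; have [] := sV j.
have [y0 _] := Y0; have C0 := confining_ub_gt0 y0 (tV 0%N).1.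
move=> y; apply/cvgrPdist_le => /= e e0.
(* Three errors of e/4 each: the moduli of [V] and of the approximant between [y] and the dense
   point, and their difference at that point. *)
have [|i iy] := pt_dense y (e := e / (4 * C)); first by rewrite divr_gt0// mulr_gt0.
have Ciy : C * moddist y (pt i) <= e / 4.
  rewrite (le_trans (ler_wpM2l (ltW C0) (ltW iy)))// le_eqVlt; apply/orP; left.
  by apply/eqP; field; rewrite gt_eqF.
have [n _ en] : \forall j \near \oo, j.+1%:R^-1 < e / 4 :> R.
  have := @cvg_harmonic R; move/cvgrPdist_lt => /(_ (e / 4)).
  rewrite divr_gt0// => /(_ isT); apply: filterS => j /=.
  by rewrite sub0r normrN ger0_norm.
near=> j.
have [_ /(_ i)] := sV j; have -> : (i <= j)%N by near: j; exact: nbhs_infty_ge.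
move=> /(_ isT) Vi.
have {Vi} : `|V (pt i) - V_ (s j) (pt i)| < e / 4.
  by apply: lt_trans Vi _; apply: en => /=; near: j; exact: nbhs_infty_ge.
have := modV y (pt i); have [_ /(_ y (pt i))] := tV (s j).
rewrite ltr_norml !ler_norml => /andP[? ?] /andP[? ?] /andP[? ?].
by apply/andP; split; lra.
Unshelve. all: by end_near. Qed.

Theorem free_energy_min m : (exists f, [/\ density f, forall x, 1 <= kint f x &
    \int[nu]_y (b y * f y) <= m]) ->
  exists c C V, tame c C V /\ forall f, density f -> (forall x, 1 <= kint f x) ->
    \int[nu]_y (b y * f y) <= m -> free_energy (gibbs V) <= free_energy f.
Proof.
move=> [f1 [df1 f11 f1m]].
have m0 : 0 < m.
  apply: lt_le_trans f1m; have [f0 mf ibf If _] := df1.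
  rewrite (lt_le_trans (@ltr01 R))// -If; apply: le_Rintegral => //.
    exact: density_int df1.
  by move=> y _; rewrite ler_peMl.
pose c1 := (c0 * (1 + m))^-1; pose C1 := c0 * m.
have c10 : 0 < c1 by rewrite invr_gt0 mulr_gt0// addr_gt0.
have C10 : 0 < C1 by exact: mulr_gt0.
have [c [C tame_pot]] := potential_tame c10 C10.
have norm_comp f : density f -> (forall x, 1 <= kint f x) ->
    \int[nu]_y (b y * f y) <= m -> comparable c1 C1 (kint f).
  move=> df f1' fm; split => // [|x]; first exact: measurable_kint.
  apply/andP; split.
    rewrite /c1 ler_pdivrMl ?mulr_gt0 ?addr_gt0//.
    rewrite (le_trans (weight_le_kint x df))// -mulrA ler_pM2l//.
    rewrite mulrDl mul1r lerD2l (le_trans fm)// ler_peMr// ltW//.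
  rewrite (le_trans (kint_le x df))// ler_pM2r//.
  by rewrite /C1 ler_pM2l.
(* The infimum is taken over the compact class rather than over normalized densities; the descent
   step shows that it is no larger than the free energy of any such density. *)
pose S := [set free_energy (gibbs V) | V in [set V | tame c C V]].
have S_le f : density f -> (forall x, 1 <= kint f x) ->
    \int[nu]_y (b y * f y) <= m -> exists2 V, tame c C V & free_energy (gibbs V) <= free_energy f.
  move=> df f1' fm; have cu := norm_comp f df f1' fm.
  have tV := tame_pot _ cu; exists (potential (kint f)); first exact: tV.
  exact: free_energy_potential df cu tV.1.
have [V1 tV1 _] := S_le f1 df1 f11 f1m.
have S_cvg (V_ : nat -> Y -> R) : (forall k, tame c C (V_ k)) -> exists V s,
    [/\ tame c C V, forall j, (j <= s j)%N & (fun j => free_energy (gibbs (V_ (s j)))) @ \oo --> free_energy (gibbs V)].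
  move=> tV; have [V [s [js sV]]] := tame_compact tV; exists V, s; split; [|exact: js|].
    exact: tame_cvg (fun j => tV (s j)) sV.
  exact: free_energy_cvg (fun j => tV (s j)) sV.
have Sinf : has_inf S.
  split; first by exists (free_energy (gibbs V1)), V1.
  (* Boundedness below is itself a compactness fact: values tending to minus infinity would have a
     finite limit along a subsequence. *)
  apply: contrapT => nlb.
  have [V_ V_P] : {V_ : nat -> Y -> R & forall k,
      tame c C (V_ k) /\ free_energy (gibbs (V_ k)) < - k%:R}.
    apply: (@choice _ _ (fun k V => tame c C V /\ free_energy (gibbs V) < - k%:R)) => k.
    apply: contrapT => H; apply: nlb; exists (- k%:R) => _ [V tV <-].
    by rewrite leNgt; apply/negP => Vk; apply: H; exists V.
  have [V [s [tV js sV]]] := S_cvg V_ (fun k => (V_P k).1).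
  have VN N : free_energy (gibbs V) <= - N%:R.
    apply: (cvg_seq_le_cst_from (N := N) sV) => j Nj.
    rewrite (le_trans (ltW (V_P (s j)).2))// lerN2 ler_nat.
    exact: leq_trans (js j).
  move: VN; move: (free_energy (gibbs V)) => L LN.
  have := LN (Num.truncn `|L|).+1; have := truncnS_gt `|L|.
  by have := ler_norm (- L); rewrite normrN; lra.
have [V_ V_P] : {V_ : nat -> Y -> R & forall k,
    tame c C (V_ k) /\ free_energy (gibbs (V_ k)) <= inf S + harmonic k}.
  apply: (@choice _ _ (fun k V => tame c C V /\ free_energy (gibbs V) <= inf S + harmonic k)) => k.
  have [|_ [V tV <-] Vk] := @inf_adherent _ S (harmonic k) _ Sinf.
    exact: harmonic_gt0.
  by exists V; split => //; exact: ltW.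
have [V [s [tV js sV]]] := S_cvg V_ (fun k => (V_P k).1).
have Vinf : free_energy (gibbs V) <= inf S.
  have h : (fun j => inf S + harmonic j) @ \oo --> inf S.
    by rewrite -[X in _ --> X]addr0; apply: cvgD; [exact: cvg_cst|exact: cvg_harmonic].
  apply: (cvg_seq_le sV h) => j; rewrite (le_trans (V_P (s j)).2)// lerD2l.
  by rewrite /harmonic lef_pV2 ?posrE// ler_nat ltnS.
exists c, C, V; split; first exact: tV; move=> f df f1' fm.
have [V' tV' V'f] := S_le f df f1' fm.
apply: le_trans Vinf (le_trans _ V'f).
by apply: ge_inf; [exact: Sinf.2|exists V'].
Qed.

End compactness.

End log_kernel_functional.

(** * Lebesgue measure on R^k and on the half space *)

Section affine_line.
Context {R : realType} (a s : R).
Hypothesis s0 : 0 < s.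

Definition affine1 (x : measurableTypeR R) : measurableTypeR R := a + s * x.

Lemma measurable_affine1 : measurable_fun setT affine1.
Proof. by apply: measurable_funD => //; exact: measurable_funM. Qed.

(** By uniqueness of Lebesgue measure: the pushforward under the affine map, multiplied by [s], has
    the right value on intervals. *)
Lemma integral_affine1 (g : R -> \bar R) : measurable_fun setT g ->
  (forall x, 0 <= g x)%E ->
  (\int[lebesgue_measure]_x g (a + s * x)%R =
   (s^-1)%:E * \int[lebesgue_measure]_x g x)%E.
Proof.
move=> mg g0.
pose pf := [the {measure set (measurableTypeR R) -> \bar R} of
  pushforward (@lebesgue_measure R) affine1].
pose m := mscale (NngNum (ltW s0)) (pf measurable_affine1).
have mE A : measurable A -> lebesgue_measure A = m A.
  apply: lebesgue_measure_unique => _ [[x y] _ <-]; rewrite /fst /snd.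
  pose J : set R := `](x - a) / s, (y - a) / s]%classic.
  transitivity (s%:E * lebesgue_measure J)%E; last first.
    rewrite /m /mscale /=; congr (_ * lebesgue_measure _)%E; rewrite /J.
    apply/seteqP; split => z /=; rewrite !in_itv/= /affine1.
      by rewrite ltr_pdivrMr// ler_pdivlMr//; move=> /andP[? ?]; apply/andP; split; lra.
    by rewrite ltr_pdivrMr// ler_pdivlMr//; move=> /andP[? ?]; apply/andP; split; lra.
  rewrite /J !lebesgue_measure_itv /= !lte_fin ltr_pM2r ?invr_gt0// ltrD2r.
  case: ifPn => xy; last by rewrite mule0.
  by rewrite -!EFinB -EFinM; congr (_%:E); field; rewrite gt_eqF.
have -> : (\int[lebesgue_measure]_x g x = \int[m]_x g x)%E.
  by apply: eq_measure_integral => A mA _; exact: mE.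
rewrite ge0_integral_mscale// ge0_integral_pushforward//=; last exact: measurable_affine1.
by rewrite muleA -EFinM mulVf ?mul1e ?gt_eqF// preimage_setT.
Qed.

End affine_line.

Section affine_tuple.
Context {R : realType}.

Lemma integral_lebesgueT_cons k (g : k.+1.-tuple R -> \bar R) :
  measurable_fun setT g -> (forall x, 0 <= g x)%E ->
  (\int[lebesgueT k.+1]_y g y =
   \int[lebesgue_measure]_x \int[lebesgueT k]_v g (tcons (x, v)))%E.
Proof.
move=> mg g0.
transitivity (\int[pushforward (lebesgue_measure \x lebesgueT k) (@tcons R k)]_y g y)%E.
  by [].
rewrite ge0_integral_pushforward; [|exact: measurable_tcons|exact: measurableT|exact: mg|].
  rewrite preimage_setT fubini_tonelli1.
  - by [].
  - by apply: measurableT_comp mg _; exact: measurable_tcons.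
  - by move=> x; exact: g0.
by move=> y _; exact: g0.
Qed.

Definition affineT k (a : k.-tuple R) (s : R) (y : k.-tuple R) : k.-tuple R :=
  [tuple tnth a i + s * tnth y i | i < k].

Lemma measurable_affineT k (a : k.-tuple R) s : measurable_fun setT (affineT a s).
Proof.
apply/measurable_fun_tnthP => i.
rewrite (_ : _ \o _ = (fun y : k.-tuple R => tnth a i + s * tnth y i)).
  by apply: measurable_funD => //; apply: measurable_funM => //; exact: measurable_tnth.
by apply/funext => y /=; rewrite tnth_mktuple.
Qed.

Lemma integral_affineT k (a : k.-tuple R) s (g : k.-tuple R -> \bar R) : 0 < s ->
  measurable_fun setT g -> (forall x, 0 <= g x)%E ->
  (\int[lebesgueT k]_y g (affineT a s y) = ((s^-1) ^+ k)%:E * \int[lebesgueT k]_y g y)%E.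
Proof.
move=> s0; elim: k a g => [|k IH] a g mg g0.
  by rewrite expr0 mul1e; apply: eq_integral => y _; congr g; rewrite [LHS]tuple0 [RHS]tuple0.
have ms : measurable_fun setT (g \o affineT a s).
  by apply: measurableT_comp => //; exact: measurable_affineT.
rewrite integral_lebesgueT_cons// integral_lebesgueT_cons//.
have E x v : affineT a s (tcons (x, v)) =
    tcons (thead a + s * x, affineT [tuple of behead a] s v).
  apply: eq_from_tnth => i; rewrite tnth_mktuple.
  case: (unliftP ord0 i) => [j|] ->.
    by rewrite {1}(tuple_eta a) !tnthS tnth_mktuple.
  by rewrite /tcons/= !tnth0.
pose h x := (\int[lebesgueT k]_v g (tcons (x, v)))%E.
have mF : measurable_fun setT (fun p : R * k.-tuple R => g (tcons p)).
  by apply: measurableT_comp => //; exact: measurable_tcons.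
have mh : measurable_fun setT h.
  by have := @measurable_ge0_int _ _ _ _ _ (lebesgueT k) (fun p => g (tcons p)) mF; apply.
transitivity (\int[lebesgue_measure]_x (((s^-1) ^+ k)%:E * h (thead a + s * x)%R))%E.
  apply: eq_integral => x _.
  rewrite /h -(IH [tuple of behead a] (fun v => g (tcons (thead a + s * x, v)))).
  - by apply: eq_integral => v _; rewrite E.
  - by apply: (measurableT_comp mF); exact: measurable_pair1.
  - by move=> v; exact: g0.
have h0 x : (0 <= h x)%E by exact: integral_ge0.
have mha : measurable_fun setT (fun x => h (thead a + s * x)).
  by apply: (measurableT_comp mh); exact: measurable_affine1.
transitivity (((s^-1) ^+ k)%:E * \int[lebesgue_measure]_x h (thead a + s * x)%R)%E.
  apply: ge0_integralZl_EFin; [exact: measurableT| |exact: mha|].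
  - by move=> x _; exact: h0.
  - by rewrite exprn_ge0// invr_ge0 ltW.
by rewrite (integral_affine1 _ s0 mh h0) muleA -EFinM exprSr.
Qed.

End affine_tuple.

(** * Integrability of power weights *)

Section power_weight.
Context {R : realType}.
Implicit Types (x p r : R).

Lemma cvg_powRN_y r : 0 < r -> (1 + x) `^ (- r) @[x --> +oo] --> (0 : R).
Proof.
move=> r0; apply/cvgrPdist_le => /= e e0; near=> x.
have [xe x0] : e `^ (- r^-1) <= 1 + x /\ 0 < 1 + x.
  split; near: x; first by apply: (@filterS _ _ _ _ _ _ (nbhs_pinfty_ge (num_real (e `^ (- r^-1))))) => x /= /le_trans; apply; rewrite lerDr.
  apply: (@filterS _ _ _ _ _ _ (nbhs_pinfty_gt (num_real (0 : R)))) => x /= x0.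
  by rewrite addr_gt0.
rewrite sub0r normrN ger0_norm ?powR_ge0//.
have e1 : 0 < e `^ (- r^-1) by rewrite powR_gt0.
rewrite (le_trans (le_powRN (ltW r0) e1 xe))// -powRrM mulrNN mulVf ?gt_eqF//.
by rewrite powRr1// ltW.
Unshelve. all: by end_near. Qed.

Lemma continuous_onexsq p : continuous (fun x : R => (1 + x ^+ 2) `^ (- p)).
Proof.
move=> x; have pos (y : R) : 0 < 1 + y ^+ 2 by rewrite ltr_wpDr// sqr_ge0.
rewrite (_ : (fun x : R => _) = (fun x => expR (- p * ln (1 + x ^+ 2)))); last first.
  by apply/funext => y; rewrite /powR gt_eqF.
apply: continuous_comp; last exact: continuous_expR.
apply: cvgM; first exact: cvg_cst.
apply: continuous_comp; last exact: continuous_ln.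
by apply: cvgD; [exact: cvg_cst|exact: exprn_continuous].
Qed.

(** On the half line (1 + x)^2 <= 2 (1 + x^2), so the weight is dominated by a multiple of (1 +
    x)^(-2p), whose primitive is explicit. *)
Lemma integral_onexsq_lty p : 1 < 2 * p ->
  (\int[lebesgue_measure]_x ((1 + x ^+ 2) `^ (- p))%:E < +oo :> \bar R)%E.
Proof.
move=> p1; have p0 : 0 < p by lra.
rewrite ge0_symfun_integralT; last 3 first.
- by move=> x; exact: powR_ge0.
- exact: continuous_onexsq.
- by move=> x /=; rewrite sqrrN.
apply: lte_mul_pinfty => //.
pose r := 2 * p - 1; have r0 : 0 < r by rewrite /r; lra.
have dF x : -1 < x -> is_derive x 1 (fun x => - r^-1 * (1 + x) `^ (- r))
    ((1 + x) `^ (- (r + 1))).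
  move=> x1; have y0 : 0 < 1 + x by lra.
  have d1 := is_derive1_powR (- r) y0.
  have d2 : is_derive x 1 (fun x : R => 1 + x) (0 + 1) by apply: is_deriveD.
  have d3 := @is_derive1_comp R (fun y => y `^ (- r)) (fun x => 1 + x) x _ _ d1 d2.
  have d4 : is_derive x 1 (fun x => (- r^-1) *: (1 + x) `^ (- r)) _ := is_deriveZ (- r^-1) d3.
  apply: is_derive_eq d4 _.
  rewrite add0r /GRing.scale/= mulr1 mulrA mulrNN mulVf ?gt_eqF// mul1r.
  by congr (_ `^ _); ring.
have cpow (s x : R) : -1 < x -> {for x, continuous (fun x => (1 + x) `^ s)}.
  move=> x1; apply: (@continuous_comp _ _ _ (fun x => 1 + x) (fun y => y `^ s)).
    by apply: cvgD; [exact: cvg_cst|exact: cvg_id].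
  apply: differentiable_continuous; apply/derivable1_diffP.
  by apply: derivable_powR; rewrite in_itv/= andbT; lra.
have H : (\int[lebesgue_measure]_(x in `[0%R, +oo[) ((1 + x) `^ (- (r + 1)))%:E =
    0%:E - (- r^-1 * (1 + 0) `^ (- r))%:E)%E.
  apply: (@ge0_continuous_FTC2y R (fun x => (1 + x) `^ (- (r + 1))) (fun x => - r^-1 * (1 + x) `^ (- r))).
  - by move=> x _; exact: powR_ge0.
  - apply: continuous_in_subspaceT => x; rewrite inE/= in_itv/= andbT => x0.
    by apply: cpow; lra.
  - rewrite -[X in _ --> X](mulr0 (- r^-1)); apply: cvgM; first exact: cvg_cst.
    exact: cvg_powRN_y.
  - by move=> x x0; apply: ex_derive; apply: dF; lra.
  - apply: cvg_at_right_filter; apply: cvgM; first exact: cvg_cst.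
    by apply: cpow; lra.
  - move=> x; rewrite in_itv/= andbT => x0; rewrite derive1E.
    by apply: derive_val; apply: dF; lra.
apply: (@le_lt_trans _ _ ((2 `^ p)%:E *
    \int[lebesgue_measure]_(x in `[0%R, +oo[) ((1 + x) `^ (- (r + 1)))%:E)%E); last first.
  by rewrite H -EFinB -EFinM ltry.
have mpow : measurable_fun (`[0%R, +oo[%classic : set R) (fun x : R => (1 + x) `^ (- (r + 1))).
  apply: (measurableT_comp (measurable_powR _)).
  by apply: measurable_funD.
rewrite -set_itvcy.
apply: (@le_trans _ _ (\int[lebesgue_measure]_(x in `[0%R, +oo[)
    ((2 `^ p)%:E * ((1 + x) `^ (- (r + 1)))%:E))%E); last first.
  rewrite le_eqVlt; apply/orP; left; apply/eqP; apply: ge0_integralZl_EFin => //.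
  - by move=> x _; rewrite lee_fin powR_ge0.
  - exact/measurable_EFinP.
apply: ge0_le_integral => //.
- by move=> x _; rewrite lee_fin powR_ge0.
- apply/measurable_EFinP; apply: measurable_funS (continuous_measurable_fun (@continuous_onexsq p)) => //.
- by apply/measurable_EFinP; apply: measurable_funM.
- move=> x /=; rewrite in_itv/= andbT => x0; rewrite lee_fin.
  have -> : - (r + 1) = 2 * (- p) by rewrite /r; ring.
  have xx : 0 < 1 + x by lra.
  have yy : 0 < (1 + x) ^+ 2 / 2 by rewrite divr_gt0// exprn_gt0.
  rewrite powRrM (powR_mulrn _ (ltW xx)).
  have -> : 2 `^ p * ((1 + x) ^+ 2) `^ (- p) = ((1 + x) ^+ 2 / 2) `^ (- p).
    rewrite powRM ?exprn_ge0 ?(ltW xx)// mulrC; congr (_ * _).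
    by rewrite -[2^-1]powR_inv1// -powRrM mulN1r opprK.
  apply: (le_powRN (ltW p0) yy).
  by have := sqr_ge0 (x - 1); rewrite !expr2; lra.
Qed.

End power_weight.

(* [R] carries two sigma-algebra structures, equal but with different displays;
   this is the one on which [lebesgue_measure] is defined. *)
Notation halfpt R k := (k.-tuple R * measurableTypeR R)%type.

Definition upper {R : realType} k : set (halfpt R k) := half_space R k.+1.
Arguments upper {R} k.

Lemma measurable_upper {R : realType} k : measurable (@upper R k).
Proof.
rewrite (_ : upper k = setT `*` [set x : R | 0 < x]).
  by apply: measurableX => //; rewrite -set_itvoy; exact: measurable_itv.
by apply/seteqP; split => x /=; [split|case].
Qed.

Section half_measure.
Context (R : realType) (k : nat).

(** A named copy of the product measure, to which a sigma-finite structure can be attached. *)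
Definition halfmu : set (halfpt R k) -> \bar R :=
  (@lebesgueT R k \x @lebesgue_measure R)%E.

HB.instance Definition _ := Measure.on halfmu.

Let halfmu_sigma_finite : sigma_finite setT halfmu.
Proof.
have /sigma_finiteP[F [TF ndF Foo]] := sigma_finiteT (@lebesgueT R k).
have /sigma_finiteP[G [TG ndG Goo]] :=
  sigma_finiteT (@lebesgue_measure R : {sigma_finite_measure set _ -> \bar R}).
exists (fun n => F n `*` G n) => [|n].
  apply/seteqP; split => // -[x y] _.
  have : (\bigcup_i F i) x by rewrite -TF.
  have : (\bigcup_i G i) y by rewrite -TG.
  move=> [j _ Gy] [i _ Fx]; exists (maxn i j) => //; split.
  - by move: x Fx; exact/subsetPset/ndF/leq_maxl.
  - by move: y Gy; exact/subsetPset/ndG/leq_maxr.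
have [mF Fn] := Foo n; have [mG Gn] := Goo n.
split; first exact: measurableX.
by rewrite /halfmu product_measure1E// lte_mul_pinfty// ge0_fin_numE.
Qed.

HB.instance Definition _ := Measure_isSigmaFinite.Build _ _ _ halfmu
  halfmu_sigma_finite.

End half_measure.
Arguments halfmu R k : clear implicits.

Section euclidean.
Context {R : realType}.
Local Notation halfpt k := (halfpt R k).

Definition nsq k (y : k.-tuple R) : R := \sum_(i < k) tnth y i ^+ 2.

Definition sqdist k (x : k.-tuple R * R) (y : k.-tuple R) : R :=
  \sum_(i < k) (tnth x.1 i - tnth y i) ^+ 2 + x.2 ^+ 2.

Definition wsq k (x : k.-tuple R * R) : R := 1 + (nsq x.1 + x.2 ^+ 2).

Lemma nsq_ge0 k (y : k.-tuple R) : 0 <= nsq y.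
Proof. by apply: sumr_ge0 => i _; exact: sqr_ge0. Qed.

Lemma sqdist_ge0 k (x : k.-tuple R * R) y : 0 <= sqdist x y.
Proof. by rewrite addr_ge0 ?sqr_ge0// sumr_ge0// => i _; exact: sqr_ge0. Qed.

Lemma measurable_nsq k : measurable_fun setT (@nsq k).
Proof.
apply: measurable_sum => i; apply: measurable_funX; exact: measurable_tnth.
Qed.

Lemma measurable_wsq k : measurable_fun setT (@wsq k : halfpt k -> R).
Proof.
apply: measurable_funD => //; apply: measurable_funD.
  exact: measurableT_comp (@measurable_nsq k) _.
by apply: measurable_funX; exact: measurable_snd.
Qed.

Lemma measurable_sqdist k : measurable_fun setT
  (fun p : halfpt k * k.-tuple R => sqdist p.1 p.2).
Proof.
apply: measurable_funD; last first.
  by apply: measurable_funX; apply: measurableT_comp.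
apply: measurable_sum => i; apply: measurable_funX; apply: measurable_funB.
  by apply: (measurableT_comp (measurable_tnth i)); apply: measurableT_comp.
by apply: (measurableT_comp (measurable_tnth i)).
Qed.

(** All three are sums over the coordinates of (u + v)^2 <= 2 (u^2 + v^2), up to the sign of v; the
    squared height is carried along. *)
Lemma nsq_triangle k (x : k.-tuple R * R) y :
  [/\ sqdist x y <= 2 * (nsq x.1 + x.2 ^+ 2 + nsq y),
      nsq x.1 + x.2 ^+ 2 <= 2 * (sqdist x y + nsq y) &
      nsq y <= 2 * (sqdist x y + (nsq x.1 + x.2 ^+ 2))].
Proof.
have h := sqr_ge0 x.2.
have H (u v w : 'I_k -> R) : (forall i, w i = u i - v i \/ w i = u i + v i) ->
    \sum_(i < k) w i ^+ 2 <= 2 * (\sum_(i < k) u i ^+ 2 + \sum_(i < k) v i ^+ 2).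
  move=> wuv; rewrite -big_split mulr_sumr; apply: ler_sum => i _ /=.
  have := sqr_ge0 (u i + v i); have := sqr_ge0 (u i - v i).
  by have [->|->] := wuv i; rewrite !expr2; lra.
have H1 := H (fun i => tnth x.1 i) (fun i => tnth y i) (fun i => tnth x.1 i - tnth y i) (fun i => or_introl erefl).
have H2 := H (fun i => tnth x.1 i - tnth y i) (fun i => tnth y i) (fun i => tnth x.1 i).
have H3 := H (fun i => tnth x.1 i) (fun i => tnth x.1 i - tnth y i) (fun i => tnth y i).
have {}H2 := H2 (fun i => or_intror (esym (subrK _ _))).
have {}H3 := H3 (fun i => or_introl (esym (subKr _ _))).
rewrite /nsq /sqdist; split; lra.
Qed.

Lemma integral_prod_onexsq k p : 1 < 2 * p ->
  (\int[lebesgueT k]_y (\prod_(i < k) (1 + tnth y i ^+ 2) `^ (- p))%:E < +oo :> \bar R)%E.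
Proof.
move=> p1; elim: k => [|k IH].
  rewrite (_ : (\int[_]_y _)%E = \int[lebesgueT 0]_y (cst 1%E y))%E; last first.
    by apply: eq_integral => y _; rewrite big_ord0.
  rewrite integral_cst; last exact: measurableT.
  by rewrite mul1e /= diracT ltry.
have m1 : measurable_fun setT (fun x : R => (1 + x ^+ 2) `^ (- p)).
  exact: (continuous_measurable_fun (@continuous_onexsq R p)).
have mp j : measurable_fun setT (fun y : j.-tuple R => \prod_(i < j) (1 + tnth y i ^+ 2) `^ (- p)).
  by apply: measurable_prod => i _; apply: (measurableT_comp m1); exact: measurable_tnth.
have p0 j (y : j.-tuple R) : 0 <= \prod_(i < j) (1 + tnth y i ^+ 2) `^ (- p).
  by apply: prodr_ge0 => i _; exact: powR_ge0.
rewrite integral_lebesgueT_cons; last 2 first.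
- by apply/measurable_EFinP; exact: mp.
- by move=> y; rewrite lee_fin.
have [J JE] : exists J, (\int[lebesgueT k]_y
    (\prod_(i < k) (1 + tnth y i ^+ 2) `^ (- p))%:E)%E = J by eexists.
have J0 : (0 <= J)%E by rewrite -JE; apply: integral_ge0 => y _; rewrite lee_fin.
have Jf : J \is a fin_num by rewrite ge0_fin_numE// -JE.
have E1 x : (\int[lebesgueT k]_v
    (\prod_(i < k.+1) (1 + tnth (tcons (x, v)) i ^+ 2) `^ (- p))%:E =
    (fine J)%:E * ((1 + x ^+ 2) `^ (- p))%:E)%E.
  rewrite fineK// -JE muleC; transitivity (\int[lebesgueT k]_v
      (((1 + x ^+ 2) `^ (- p))%:E * (\prod_(i < k) (1 + tnth v i ^+ 2) `^ (- p))%:E))%E.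
    apply: eq_integral => v _; rewrite big_ord_recl -EFinM tnth0.
    by congr (_ * _)%:E; apply: eq_bigr => i _; rewrite tnthS.
  apply: ge0_integralZl_EFin => //.
  - by move=> y _; rewrite lee_fin.
  - by apply/measurable_EFinP; exact: mp.
  - exact: powR_ge0.
apply: (@le_lt_trans _ _
    (\int[lebesgue_measure]_x ((fine J)%:E * ((1 + x ^+ 2) `^ (- p))%:E))%E).
  by rewrite le_eqVlt; apply/orP; left; apply/eqP; apply: eq_integral => x _; rewrite -E1.
have -> : (\int[lebesgue_measure]_x ((fine J)%:E * ((1 + x ^+ 2) `^ (- p))%:E) =
    (fine J)%:E * \int[lebesgue_measure]_x ((1 + x ^+ 2) `^ (- p))%:E)%E.
  apply: ge0_integralZl_EFin => //.
  - by move=> y _; rewrite lee_fin powR_ge0.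
  - exact/measurable_EFinP.
  - exact: fine_ge0.
by apply: lte_mul_pinfty; [rewrite lee_fin fine_ge0|by []|exact: integral_onexsq_lty].
Qed.

(** Each 1 + y_i^2 is at most 1 + |y|^2, so the weight is dominated by a product of [k]
    one-dimensional weights. *)
Lemma nsq_weight_int k p : 1 < 2 * p -> (lebesgueT k).-integrable setT
  (EFin \o fun y : k.-tuple R => (1 + nsq y) `^ (- (p * k%:R))).
Proof.
move=> p1; have p0 : 0 <= p by lra.
have pos (y : k.-tuple R) : 0 < 1 + nsq y by rewrite ltr_wpDr ?nsq_ge0.
have m1 : measurable_fun setT (fun x : R => (1 + x ^+ 2) `^ (- p)).
  exact: (continuous_measurable_fun (@continuous_onexsq R p)).
have mp : measurable_fun setT (fun y : k.-tuple R => \prod_(i < k) (1 + tnth y i ^+ 2) `^ (- p)).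
  by apply: measurable_prod => i _; apply: (measurableT_comp m1); exact: measurable_tnth.
have ip : (lebesgueT k).-integrable setT (EFin \o fun y : k.-tuple R =>
    \prod_(i < k) (1 + tnth y i ^+ 2) `^ (- p)).
  apply: intg_lty => //; last exact: integral_prod_onexsq.
  by move=> y _; apply: prodr_ge0 => i _; exact: powR_ge0.
apply: intg_dominated ip _ => //.
  apply: (measurableT_comp (measurable_powR _)).
  by apply: measurable_funD => //; exact: measurable_nsq.
move=> y _; rewrite ger0_norm ?powR_ge0// -mulNr powRrM powR_mulrn ?powR_ge0//.
rewrite -[X in _ ^+ X](card_ord k) -prodr_const; apply: ler_prod => i _.
rewrite powR_ge0/=; apply: le_powRN => //; first by rewrite ltr_wpDr ?sqr_ge0.
by rewrite lerD2l /nsq (bigD1 i)//= lerDl sumr_ge0// => j _; exact: sqr_ge0.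
Qed.

(** The same domination with [k.+1] factors, the last one for the height. *)
Lemma wsq_weight_int k p : 1 < 2 * p ->
  (halfmu R k).-integrable (upper k)
  (EFin \o fun x : halfpt k => wsq x `^ (- (p * k.+1%:R))).
Proof.
move=> p1; have p0 : 0 <= p by lra.
set P := halfmu R k; set D := upper k.
have m1 : measurable_fun setT (fun x : R => (1 + x ^+ 2) `^ (- p)).
  exact: (continuous_measurable_fun (@continuous_onexsq R p)).
have mp : measurable_fun setT (fun y : k.-tuple R => \prod_(i < k) (1 + tnth y i ^+ 2) `^ (- p)).
  by apply: measurable_prod => i _; apply: (measurableT_comp m1); exact: measurable_tnth.
have p0' (y : k.-tuple R) : 0 <= \prod_(i < k) (1 + tnth y i ^+ 2) `^ (- p).
  by apply: prodr_ge0 => i _; exact: powR_ge0.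
pose g (x : halfpt k) :=
  (\prod_(i < k) (1 + tnth x.1 i ^+ 2) `^ (- p)) * (1 + x.2 ^+ 2) `^ (- p).
have mg : measurable_fun setT g.
  apply: measurable_funM; first exact: (measurableT_comp mp).
  exact: (measurableT_comp m1).
have ig : P.-integrable setT (EFin \o g).
  apply: intg_lty => //; first by move=> x _; rewrite mulr_ge0 ?powR_ge0.
  have Ioo := integral_onexsq_lty p1; have Joo := integral_prod_onexsq k p1.
  have [I IE] : exists I, (\int[lebesgue_measure]_x ((1 + x ^+ 2) `^ (- p))%:E)%E = I by eexists.
  rewrite IE in Ioo.
  have I0 : (0 <= I)%E by rewrite -IE; apply: integral_ge0 => y _; rewrite lee_fin powR_ge0.
  have If : I \is a fin_num by rewrite ge0_fin_numE.
  rewrite fubini_tonelli1; last 2 first.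
  - exact/measurable_EFinP.
  - by move=> x; rewrite lee_fin mulr_ge0 ?powR_ge0.
  apply: (@le_lt_trans _ _ (\int[lebesgueT k]_y ((fine I)%:E *
      (\prod_(i < k) (1 + tnth y i ^+ 2) `^ (- p))%:E))%E).
    rewrite le_eqVlt; apply/orP; left; apply/eqP; apply: eq_integral => y _.
    rewrite fineK// -IE muleC; transitivity (\int[lebesgue_measure]_x
        ((\prod_(i < k) (1 + tnth y i ^+ 2) `^ (- p))%:E * ((1 + x ^+ 2) `^ (- p))%:E))%E.
      by apply: eq_integral => x _; rewrite -EFinM.
    apply: ge0_integralZl_EFin => //.
    - by move=> x _; rewrite lee_fin powR_ge0.
    - exact/measurable_EFinP.
  rewrite ge0_integralZl_EFin//; last 3 first.
  - by move=> y _; rewrite lee_fin.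
  - exact/measurable_EFinP.
  - exact: fine_ge0.
  by apply: lte_mul_pinfty; rewrite ?lee_fin ?fine_ge0.
have mD := @measurable_upper R k.
have igD : P.-integrable D (EFin \o g) by exact: integrableS ig.
apply: (intg_dominated mD _ igD) => [|x _].
  apply: measurable_funTS; apply: (measurableT_comp (measurable_powR _)).
  exact: measurable_wsq.
rewrite ger0_norm ?powR_ge0// -mulNr powRrM powR_mulrn ?powR_ge0//.
rewrite exprSr; apply: ler_pM; rewrite ?exprn_ge0 ?powR_ge0//.
  rewrite -[X in _ ^+ X](card_ord k) -prodr_const; apply: ler_prod => i _.
  rewrite powR_ge0/=; apply: le_powRN => //; first by rewrite ltr_wpDr ?sqr_ge0.
  rewrite /wsq lerD2l /nsq (bigD1 i)//= -addrA lerDl addr_ge0 ?sqr_ge0// sumr_ge0// => j _.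
  exact: sqr_ge0.
apply: le_powRN => //; first by rewrite ltr_wpDr ?sqr_ge0.
by rewrite /wsq lerD2l lerDr nsq_ge0.
Qed.

End euclidean.

Section powR_extra.
Context {R : realType}.

Lemma powRD_le (be s t : R) : 0 <= be -> 0 <= s -> 0 <= t ->
  (s + t) `^ be <= 2 `^ be * (s `^ be + t `^ be).
Proof.
move=> be0; wlog st : s t / s <= t => [H s0 t0|s0 t0].
  have [/H|/ltW/H] := leP s t; first exact.
  by rewrite [s + t]addrC [s `^ _ + _]addrC; apply.
apply: (@le_trans _ _ ((2 * t) `^ be)).
  by rewrite ge0_ler_powR ?nnegrE ?addr_ge0 ?mulr_ge0//; lra.
by rewrite powRM// ler_wpM2l ?powR_ge0// lerDr powR_ge0.
Qed.

(** Exponential decay beats every power: z/N <= exp(z/N), raised to the power -N. *)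
Lemma expRN_le_powR (z N : R) : 0 < z -> 0 < N ->
  expR (- z) <= (z / N) `^ (- N).
Proof.
move=> z0 N0; have zN : 0 < z / N by rewrite divr_gt0.
have -> : - z = (z / N) * (- N) by field; rewrite gt_eqF.
rewrite expRM; apply: (le_powRN (ltW N0) zN).
by rewrite (le_trans _ (expR_ge1Dx _))// lerDr.
Qed.

Lemma cvg_seq_powR_ge0 (u : nat -> R) l be : 0 < be -> (forall n, 0 <= u n) ->
  u @ \oo --> l -> (fun n => u n `^ be) @ \oo --> l `^ be.
Proof.
move=> be0 u0 ul; have l0 : 0 <= l by exact: cvg_seq_ge_cst ul u0.
move: l0; rewrite le_eqVlt => /predU1P[l0|l0].
  rewrite -l0 in ul *; rewrite powR0 ?gt_eqF//.
  apply/cvgrPdist_le => /= e e0.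
  have ee : 0 < e `^ be^-1 by rewrite powR_gt0.
  move/cvgrPdist_le : ul => /(_ _ ee); apply: filterS => n /=.
  rewrite !sub0r !normrN !ger0_norm ?powR_ge0// => une.
  apply: (@le_trans _ _ ((e `^ be^-1) `^ be)).
    by rewrite ge0_ler_powR ?nnegrE// ltW.
  by rewrite -powRrM mulVf ?gt_eqF// powRr1// ltW.
have cc : {for l, continuous (fun y : R => y `^ be)}.
  apply: differentiable_continuous; apply/derivable1_diffP.
  by apply: derivable_powR; rewrite in_itv/= andbT.
exact: continuous_cvg cc ul.
Qed.

End powR_extra.

(** * The power kernel *)

Section kernel.
Context {R : realType} (k : nat) (be q : R).
Hypotheses (be0 : 0 < be) (q0 : 0 < q) (bq : k.+1%:R < 2 * (be * q)).
Hypothesis k0 : (0 < k)%N.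
Local Notation X := (halfpt R k).
Local Notation Y := (k.-tuple R).
Local Notation P := (halfmu R k).
Local Notation D := (@upper R k).
Local Notation nu := (@lebesgueT R k).

(** [sqdist] is a squared distance, so [be] stands for half of alpha - n. *)
Definition powdist (x : X) (y : Y) : R := sqdist x y `^ be.
Definition halfweight (x : X) : R := wsq x `^ be.
Definition bdryweight (y : Y) : R := (1 + nsq y) `^ be.
(** One factor 2^be pays for [nsq_triangle], another for [powRD_le]. *)
Definition c4 : R := 4 `^ be.

Lemma measurable_ker : measurable_fun setT (fun p : X * Y => powdist p.1 p.2).
Proof. exact: (measurableT_comp (measurable_powR _) (@measurable_sqdist R k)). Qed.

Lemma measurable_wtX : measurable_fun setT halfweight.
Proof. exact: (measurableT_comp (measurable_powR _) (@measurable_wsq R k)). Qed.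

Lemma measurable_wtY : measurable_fun setT bdryweight.
Proof.
apply: (measurableT_comp (measurable_powR _)).
by apply: measurable_funD => //; exact: measurable_nsq.
Qed.

Let wsq1 (x : X) : 1 <= wsq x.
Proof. by rewrite lerDl addr_ge0 ?nsq_ge0 ?sqr_ge0. Qed.

Let nsq1 (y : Y) : 1 <= 1 + nsq y.
Proof. by rewrite lerDl nsq_ge0. Qed.

Let powR_ge1 (x : R) : 1 <= x -> 1 <= x `^ be.
Proof.
by move=> x1; rewrite -(powRr0 x) ler_powR// ltW.
Qed.

Lemma wtX_ge1 x : 1 <= halfweight x. Proof. exact: powR_ge1. Qed.
Lemma wtY_ge1 y : 1 <= bdryweight y. Proof. exact: powR_ge1. Qed.
Lemma ker_ge0 x y : 0 <= powdist x y. Proof. exact: powR_ge0. Qed.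
Lemma c4_ge1 : 1 <= c4. Proof. by apply: powR_ge1; rewrite ler1n. Qed.

Let pow2_le (u v w : R) : 0 <= u -> 0 <= v -> 0 <= w -> u <= 2 * (v + w) ->
  u `^ be <= c4 * (v `^ be + w `^ be).
Proof.
move=> u0 v0 w0 uvw; have -> : c4 = 2 `^ be * 2 `^ be.
  by rewrite -powRM//; congr (_ `^ _); ring.
apply: (@le_trans _ _ ((2 * (v + w)) `^ be)).
  by rewrite ge0_ler_powR ?nnegrE ?mulr_ge0 ?addr_ge0// ltW.
rewrite powRM ?addr_ge0// -mulrA ler_wpM2l ?powR_ge0//.
by apply: powRD_le => //; exact: ltW.
Qed.

Lemma ker_le x y : powdist x y <= c4 * (halfweight x * bdryweight y).
Proof.
have [H _ _] := nsq_triangle x y; have x0 := wsq1 x; have y0 := nsq1 y.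
rewrite /halfweight /bdryweight -powRM; [|lra|lra].
rewrite /c4 -powRM//; last by rewrite mulr_ge0//; lra.
rewrite ge0_ler_powR ?nnegrE ?(ltW be0) ?sqdist_ge0 ?mulr_ge0//; [lra|lra|].
move: x0; rewrite /wsq; set s := nsq x.1 + _ in H *; set t := nsq y in H y0 *.
move=> x0; have : 0 <= s * t by rewrite mulr_ge0; lra.
have -> : (1 + s) * (1 + t) = 1 + s + t + s * t by ring.
lra.
Qed.

Lemma wtX_le x y : halfweight x <= c4 * (powdist x y + bdryweight y).
Proof.
have [_ H _] := nsq_triangle x y; have x0 := wsq1 x; have y0 := nsq1 y.
by apply: pow2_le; rewrite ?sqdist_ge0//; [lra|lra|rewrite /wsq; lra].
Qed.

Lemma wtY_le x y : bdryweight y <= c4 * (powdist x y + halfweight x).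
Proof.
have [_ _ H] := nsq_triangle x y; have x0 := wsq1 x; have y0 := nsq1 y.
by apply: pow2_le; rewrite ?sqdist_ge0//; [lra|lra|rewrite /wsq; lra].
Qed.

(** This is where [bq] enters: the decay exponent 2 be q must exceed the dimension [k.+1] of the
    half space. *)
Lemma wtX_int : P.-integrable D (EFin \o fun x => halfweight x `^ (- q)).
Proof.
have k1 : 0 < k.+1%:R :> R by rewrite ltr0n.
have := @wsq_weight_int R k (be * q / k.+1%:R); rewrite divfK ?gt_eqF//.
have p1 : 1 < 2 * (be * q / k.+1%:R) by rewrite mulrA ltr_pdivlMr// mul1r.
move=> /(_ p1); apply: (eq_intg (@measurable_upper R k)) => x _.
by rewrite /halfweight -powRrM mulrN.
Qed.

Lemma nsq_pow_int r c : 0 <= r -> 0 < c -> nu.-integrable setT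
  (EFin \o fun y : Y => (1 + nsq y) `^ r * expR (- (c * bdryweight y))).
Proof.
(* [N] solves r - be N = - k, which leaves the integrable weight of [nsq_weight_int] with p = 1. *)
move=> r0 c0; pose N := (r + k%:R) / be.
have N0 : 0 < N by rewrite divr_gt0// ltr_wpDl// ltr0n.
have i1 := @nsq_weight_int R k 1 (ltac:(lra)).
have mr : measurable_fun setT (fun y : Y => (1 + nsq y) `^ r).
  apply: (measurableT_comp (measurable_powR _)).
  by apply: measurable_funD => //; exact: measurable_nsq.
apply: (intg_dominated measurableT (g := fun y => (c / N) `^ (- N) * (1 + nsq y) `^ (- (1 * k%:R)))).
- apply: measurable_funM => //.
  apply: measurableT_comp => //; apply: measurable_funN.
  by apply: measurable_funM => //; exact: measurable_wtY.
- exact: intgZ.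
- move=> y _; have y1 := wtY_ge1 y; have y0 := nsq1 y.
  have b0 : 0 < bdryweight y by lra.
  have p0 : 0 < 1 + nsq y by lra.
  rewrite ger0_norm ?mulr_ge0 ?expR_ge0 ?powR_ge0//.
  have := expRN_le_powR (mulr_gt0 c0 b0) N0.
  rewrite -(ler_pM2l (powR_gt0 r p0)) => /le_trans; apply.
  rewrite mulrAC powRM ?(ltW b0)//; last by rewrite divr_ge0 ?ltW.
  rewrite mulrCA ler_wpM2l ?powR_ge0//.
  rewrite /bdryweight -powRrM -powRD; last by apply/implyP; rewrite (gt_eqF p0).
  rewrite le_eqVlt; apply/orP; left; apply/eqP; congr (_ `^ _).
  by rewrite /N; field; rewrite gt_eqF.
Qed.

Lemma wtY_int c : 0 < c ->
  nu.-integrable setT (EFin \o fun y => bdryweight y * expR (- (c * bdryweight y))).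
Proof. exact: nsq_pow_int (ltW be0). Qed.

Definition box (c : Y) (e : R) : set Y :=
  [set v | forall i, tnth v i \in `[tnth c i - e, tnth c i + e]].

Lemma measurable_box c e : measurable (box c e).
Proof.
rewrite (_ : box c e = \bigcap_(i in [set: 'I_k])
    ((fun v : Y => tnth v i) @^-1` `[tnth c i - e, tnth c i + e]%classic)).
  apply: fin_bigcap_measurable => // i _.
  by rewrite -[X in measurable X]setTI; exact: measurable_tnth.
by apply/seteqP; split => [v Av i _|v Av i]; exact: Av.
Qed.

Lemma box_measure c e : 0 < e -> nu (box c e) = ((2 * e) ^+ k)%:E.
Proof.
move=> e0; rewrite (lebesgueT_box (A := fun i => `[tnth c i - e, tnth c i + e]%classic))//.
rewrite (eq_bigr (fun=> (2 * e)%:E)) => [|i _].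
  by rewrite prodEFin prodr_const card_ord.
rewrite lebesgue_measure_itv/= lte_fin ifT; last by lra.
by rewrite -EFinB; congr _%:E; ring.
Qed.

Lemma box_gt0 c e : 0 < e -> (0 < nu (box c e))%E.
Proof. by move=> e0; rewrite box_measure// lte_fin exprn_gt0// mulr_gt0. Qed.

Lemma lebesgueT_gt0 : (0 < nu setT)%E.
Proof.
have h := @box_gt0 [tuple (0 : R) | i < k] 1 ltr01; apply: (lt_le_trans h).
by apply: le_measure; rewrite ?inE//; exact: measurable_box.
Qed.

Lemma upper_gt0 : (0 < P D)%E.
Proof.
have h := @box_gt0 [tuple (0 : R) | i < k] 1 ltr01.
apply: (@lt_le_trans _ _ (P (box [tuple (0 : R) | i < k] 1 `*` `[1%R, 2%R]%classic))).
  rewrite /halfmu product_measure1E//; last exact: measurable_box.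
  apply: mule_gt0; first exact: h.
  have := @lebesgue_measure_itv R `[1%R, 2%R]; rewrite /= lte_fin ltr1n => ->.
  by rewrite -EFinB lte_fin subr_gt0 ltr1n.
apply: le_measure; rewrite ?inE.
- by apply: measurableX => //; exact: measurable_box.
- exact: measurable_upper.
- by move=> x [_] /=; rewrite in_itv/= => /andP[x1 _]; rewrite /upper/half_space/=; lra.
Qed.

(** Finite entropy forbids concentration. In a small box around x', the part where f <= M has mass
    at most M times the volume, and the part where f > M at most A / ln M. Half of the mass
    therefore lies outside the box, where the kernel is at least (e^2)^be, uniformly in [x]. *)
Lemma ker_pos (f : Y -> R) : density nu bdryweight f ->
  exists2 c, 0 < c & forall x, c <= kint nu powdist f x.
Proof.
move=> df; have i_f := density_int wtY_ge1 df.
have [f0 mf ibf f1 ief] := df.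
pose A := \int[nu]_y `|f y * ln (f y)|.
have A0 : 0 <= A by exact: Rintegral_ge0.
(* Makes A / ln M at most 1/4. *)
pose M := expR (4 * A + 1).
have M1 : 1 <= M by rewrite -expR0 ler_expR; lra.
have lM : ln M = 4 * A + 1 by rewrite expRK.
(* Makes M (2e)^k at most M (2e) = 1/4, because 2e <= 1 and k >= 1. *)
pose e := (8 * M)^-1.
have e0 : 0 < e by rewrite invr_gt0; lra.
have k2 : 0 < e ^+ 2 by rewrite exprn_gt0.
exists ((e ^+ 2) `^ be / 2); first by rewrite divr_gt0// powR_gt0.
move=> x; pose B := box x.1 e.
have mB : measurable B by exact: measurable_box.
have nuB : nu B = ((2 * e) ^+ k)%:E by exact: box_measure.
have iB : nu.-integrable setT (EFin \o (\1_B : Y -> R)).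
  apply: intg_lty => //.
  by rewrite integral_indic// setIT -[X in (X < _)%E]/(nu B) nuB ltry.
have IB : \int[nu]_y (\1_B y : R) = (2 * e) ^+ k.
  by rewrite /Rintegral integral_indic// setIT -[X in fine X]/(nu B) nuB.
have iK := density_kint measurable_ker ker_ge0 ker_le x df.
pose c := (e ^+ 2) `^ be; have c0 : 0 < c by rewrite powR_gt0.
pose L := ln M; have L0 : 0 < L by rewrite /L lM; lra.
have ieN := intg_norm ief.
(* A pointwise minorant of K f: non-positive inside the box, whether f <= M or f > M, and at most c
   f outside. *)
apply: (@le_trans _ _ (\int[nu]_y (c * (f y - M * \1_B y - L^-1 * `|f y * ln (f y)|)))).
  rewrite RintegralZl//; last by apply: intgB; [|apply: intgB|]; try exact: intgZ.
  rewrite RintegralB//; [|apply: intgB => //; exact: intgZ|exact: intgZ].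
  rewrite RintegralB//; last exact: intgZ.
  rewrite RintegralZl// RintegralZl// IB f1 -/A ler_pM2l//.
  have h1 : M * (2 * e) ^+ k <= 4^-1.
    have e2 : 2 * e = (4 * M)^-1 by rewrite /e; field; lra.
    apply: (@le_trans _ _ (M * (2 * e))); last by rewrite e2; rewrite le_eqVlt; apply/orP; left; apply/eqP; field; lra.
    rewrite ler_pM2l; last by lra.
    rewrite -[leRHS]expr1 ler_wiXn2l// ?e2 ?invr_ge0; [lra|].
    by rewrite invf_le1; lra.
  have h2 : L^-1 * A <= 4^-1.
    by rewrite ler_pdivrMl// /L lM; lra.
  lra.
apply: le_Rintegral => //.
  by apply: intgZ => //; apply: intgB; [|apply: intgB|]; try exact: intgZ.
move=> y _; have Ax : 0 <= `|f y * ln (f y)| by [].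
have L1 : 0 <= L^-1 * `|f y * ln (f y)| by rewrite mulr_ge0// invr_ge0 ltW.
rewrite indicE; have [yB|yB] := boolP (y \in B).
  apply: (@le_trans _ _ 0); last by rewrite mulr_ge0// ker_ge0.
  rewrite pmulr_rle0// mulr1 -addrA -opprD subr_le0.
  have [fM|Mf] := leP (f y) M; first by rewrite (le_trans fM)// lerDl.
  have f1y : 1 < f y by exact: le_lt_trans Mf.
  have lf : L <= ln (f y) by rewrite /L ler_ln ?posrE ?(ltW Mf) ?expR_gt0 ?(lt_trans ltr01).
  rewrite ger0_norm ?mulr_ge0// ?(le_trans (ltW L0))//.
  apply: (@le_trans _ _ (L^-1 * (f y * ln (f y)))); last by rewrite lerDr; lra.
  by rewrite mulrCA ler_peMr// ler_pdivlMl// mulr1.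
rewrite mulr0 subr0; apply: (@le_trans _ _ (c * f y)).
  by rewrite ler_pM2l// lerBlDr lerDl.
rewrite ler_wpM2r// /powdist /c ge0_ler_powR ?nnegrE ?sqdist_ge0 ?(ltW be0) ?(ltW k2)//.
have [i yi] : exists i, tnth y i \notin `[tnth x.1 i - e, tnth x.1 i + e].
  apply: contrapT => H; move/negP: yB; apply; rewrite inE => i.
  by apply/negPn/negP => Hi; apply: H; exists i.
apply: (@le_trans _ _ ((tnth x.1 i - tnth y i) ^+ 2)).
  move: yi; rewrite in_itv/= negb_and -!ltNge => /orP[h|h].
    by rewrite ler_sqr ?nnegrE; lra.
  by rewrite -[leRHS]sqrrN ler_sqr ?nnegrE; lra.
rewrite /sqdist (bigD1 i)//= -addrA lerDl addr_ge0 ?sqr_ge0// sumr_ge0// => j _.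
exact: sqr_ge0.
Qed.

Lemma cvg_ker (z : nat -> Y) y x :
  (forall i, (fun j => tnth (z j) i) @ \oo --> tnth y i) ->
  (fun j => powdist x (z j)) @ \oo --> powdist x y.
Proof.
move=> zy; apply: cvg_seq_powR_ge0 => //; first by move=> n; exact: sqdist_ge0.
apply: cvgD; last exact: cvg_cst.
apply: (cvg_big (@add_continuous R)) => i _.
have h : (fun j => tnth x.1 i - tnth (z j) i) @ \oo --> tnth x.1 i - tnth y i.
  by apply: cvgB; [exact: cvg_cst|exact: zy].
exact: (cvgM h h).
Qed.

Lemma cvg_moddist (z : nat -> Y) y M :
  (forall i, (fun j => tnth (z j) i) @ \oo --> tnth y i) ->
  (forall j, bdryweight (z j) <= M) ->
  (fun j => moddist P D powdist halfweight q y (z j)) @ \oo --> 0.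
Proof.
move=> zy zM.
have <- : \int[P]_(x in D) (0 : R) = 0.
  by rewrite Rintegral_cst ?mul0r//; exact: measurable_upper.
have mK (v : Y) : measurable_fun D (powdist ^~ v).
  by apply: measurable_funTS; exact: (measurableT_comp measurable_ker (measurable_pair2 v)).
have mpow : measurable_fun D (fun x => halfweight x `^ (- (q + 1))).
  apply: measurable_funTS; exact: (measurableT_comp (measurable_powR _) measurable_wtX).
apply: (Rint_dominated (@measurable_upper R k)
  (g := fun x => (c4 * (bdryweight y + M)) * halfweight x `^ (- q))).
- move=> j; apply: measurable_funM => //.
  by apply: measurableT_comp => //; apply: measurable_funB.
- exact: measurable_cst.
- move=> x _; rewrite -(mul0r (halfweight x `^ (- (q + 1)))).
  apply: cvgM; last exact: cvg_cst.
  rewrite -(normr0 R) -(subrr (powdist x y)); apply: cvg_norm.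
  by apply: cvgB; [exact: cvg_cst|exact: cvg_ker].
- by apply: intgZ; [exact: measurable_upper|exact: wtX_int].
- move=> j x _; have a0 : 0 < halfweight x by apply: lt_le_trans (wtX_ge1 x).
  rewrite ger0_norm ?mulr_ge0 ?powR_ge0//.
  rewrite (_ : halfweight x `^ (- q) = halfweight x * halfweight x `^ (- (q + 1))); last first.
    by rewrite (weight_powS q wtX_ge1).
  rewrite mulrA ler_wpM2r ?powR_ge0// (le_trans (ler_normB _ _))//.
  rewrite !ger0_norm ?ker_ge0//.
  have := ker_le x y; have := ker_le x (z j).
  have : c4 * (halfweight x * bdryweight (z j)) <= c4 * (halfweight x * M).
    by rewrite !ler_wpM2l ?(ltW a0)// (le_trans _ c4_ge1).
  have -> : c4 * (bdryweight y + M) * halfweight x = c4 * (halfweight x * bdryweight y) + c4 * (halfweight x * M) by ring.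
  lra.
Qed.

Lemma near_point_wtY (z : nat -> Y) y : (forall j i, `|tnth y i - tnth (z j) i| <= 1) ->
  forall j, bdryweight (z j) <= (1 + 2 * (nsq y + k%:R)) `^ be.
Proof.
move=> zy j; have h := nsq_ge0 y.
rewrite /bdryweight ge0_ler_powR ?nnegrE ?(ltW be0) ?addr_ge0 ?mulr_ge0 ?addr_ge0 ?nsq_ge0//.
rewrite lerD2l /nsq -[X in _ + X%:R](card_ord k) -sum1_card natr_sum -big_split mulr_sumr.
apply: ler_sum => i _ /=; have := zy j i; rewrite ler_norml => /andP[h1 h2].
set s := tnth y i in h1 h2 *; set t := tnth _ i in h1 h2 *.
have h3 : 0 <= (1 - (s - t)) * (1 + (s - t)) by rewrite mulr_ge0//; lra.
by have := sqr_ge0 (s + (s - t)); rewrite !expr2; lra.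
Qed.

(** Enumerates the rational points through their codes; a number that codes none is sent to the
    origin. *)
Definition rpt (i : nat) : Y :=
  map_tuple ratr (odflt [tuple (0 : rat) | _ < k] (unpickle i : option (k.-tuple rat))).

Lemma rpt_dense y e : 0 < e -> exists i, moddist P D powdist halfweight q y (rpt i) < e.
Proof.
move=> e0.
have H (j : nat) (i : 'I_k) : exists r : rat, `|tnth y i - ratr r| < j.+1%:R^-1.
  have : 0 < j.+1%:R^-1 :> R by rewrite invr_gt0.
  move: (j.+1%:R^-1) => d j0.
  have yj : tnth y i - d < tnth y i + d.
    by rewrite ltrD2l (lt_trans _ j0)// oppr_lt0.
  have [r] := rat_in_itvoo yj.
  by rewrite in_itv/= => /andP[? ?]; exists r; rewrite ltr_norml; apply/andP; split; lra.
pose r j i := xchoose (H j i).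
pose idx j := pickle [tuple r j i | i < k].
have rptE j i : tnth (rpt (idx j)) i = ratr (r j i).
  by rewrite /rpt /idx pickleK /= tnth_map tnth_mktuple.
have zy j i : `|tnth y i - tnth (rpt (idx j)) i| < j.+1%:R^-1.
  by rewrite rptE; exact: xchooseP (H j i).
have z1 j i : `|tnth y i - tnth (rpt (idx j)) i| <= 1.
  by rewrite (le_trans (ltW (zy j i)))// invf_le1// ler1n.
have cv i : (fun j => tnth (rpt (idx j)) i) @ \oo --> tnth y i.
  apply/cvgrPdist_lt => /= d d0; have /cvgrPdist_lt := @cvg_harmonic R.
  move=> /(_ _ d0); apply: filterS => j /=; rewrite sub0r normrN ger0_norm//.
  exact: lt_trans.
have /cvgrPdist_lt := cvg_moddist cv (near_point_wtY z1).
move=> /(_ _ e0) [N _ /(_ N (leqnn N))] /=.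
rewrite sub0r normrN => HN; exists (idx N); exact: le_lt_trans (ler_norm _) HN.
Qed.

End kernel.

(** * Reflections *)

Section reflection.
Context {R : realType} (k : nat) (e : k.-tuple R) (s : R).
Local Notation Y := (k.-tuple R).
Local Notation nu := (@lebesgueT R k).
Hypothesis e0 : 0 < nsq e.

Definition dot (x y : Y) : R := \sum_(i < k) tnth x i * tnth y i.
(** The signed distance to the hyperplane, multiplied by the length of [e], which is not
    normalized. *)
Definition side (y : Y) : R := dot e y - s.
Definition refl (y : Y) : Y :=
  [tuple tnth y i - 2 * side y / nsq e * tnth e i | i < k].

(** The linear part of [refl]. It is what a translation turns into when it is moved across the
    reflection, see [refl_affine]. *)
Let refl_dir (y : Y) : Y := [tuple tnth y i - 2 * dot e y / nsq e * tnth e i | i < k].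

Let dot_sub (y : Y) c : \sum_(i < k) tnth e i * (tnth y i - c * tnth e i) =
  dot e y - c * nsq e.
Proof.
rewrite /nsq mulr_sumr -sumrB; apply: eq_bigr => i _; ring.
Qed.

Lemma side_refl y : side (refl y) = - side y.
Proof.
rewrite {1}/side /dot (eq_bigr (fun i => tnth e i * (tnth y i - 2 * side y / nsq e * tnth e i))).
  by rewrite dot_sub /side; field; rewrite gt_eqF.
by move=> i _; rewrite tnth_mktuple.
Qed.

Lemma reflK : involutive refl.
Proof.
move=> y; apply: eq_from_tnth => i; rewrite !tnth_mktuple side_refl; ring.
Qed.

(** The sign of the extra term decides every kernel comparison: a point on the side of [x] is
    carried away from [x]. *)
Lemma sqdist_refl (x : halfpt R k) y :
  sqdist x (refl y) = sqdist x y + 4 * side x.1 * side y / nsq e.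
Proof.
pose c := 2 * side y / nsq e.
have E : \sum_(i < k) (tnth x.1 i - tnth (refl y) i) ^+ 2 =
  \sum_(i < k) (tnth x.1 i - tnth y i) ^+ 2 + 2 * c * (dot e x.1 - dot e y) + c ^+ 2 * nsq e.
  rewrite /dot -sumrB /nsq !mulr_sumr -!big_split; apply: eq_bigr => i _ /=.
  by rewrite tnth_mktuple -/c; ring.
rewrite /sqdist E; have -> : dot e x.1 - dot e y = side x.1 - side y by rewrite /side; ring.
by rewrite /c; field; rewrite gt_eqF.
Qed.

Lemma sqdist_refll (x : halfpt R k) y : sqdist (refl x.1, x.2) y = sqdist x (refl y).
Proof.
have H (u v : Y) h : sqdist (u, h) v = sqdist (v, h) u.
  by rewrite /sqdist; congr (_ + _); apply: eq_bigr => i _ /=; rewrite -sqrrN opprB.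
by rewrite sqdist_refl H sqdist_refl/= H; case: x => x h /=; ring.
Qed.

Lemma measurable_side : measurable_fun setT side.
Proof.
apply: measurable_funB => //; apply: measurable_sum => i.
by apply: measurable_funM => //; exact: measurable_tnth.
Qed.

Lemma measurable_refl : measurable_fun setT refl.
Proof.
apply/measurable_fun_tnthP => i.
rewrite (_ : _ \o _ = (fun y : Y => tnth y i - 2 * side y / nsq e * tnth e i)).
  apply: measurable_funB; first exact: measurable_tnth.
  apply: measurable_funM => //; apply: measurable_funM => //.
  by apply: measurable_funM => //; exact: measurable_side.
by apply/funext => y /=; rewrite tnth_mktuple.
Qed.

Let refl_affine x y : affineT y 1 (refl x) = refl (affineT (refl_dir y) 1 x).
Proof.
have sE : side (affineT (refl_dir y) 1 x) = side x - dot e y.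
  have dE : dot e (affineT (refl_dir y) 1 x) =
      dot e x + (dot e y - 2 * dot e y / nsq e * nsq e).
    rewrite -dot_sub {1}/dot [X in X + _]/dot -big_split; apply: eq_bigr => i _ /=.
    by rewrite !tnth_mktuple; ring.
  by rewrite /side dE; field; rewrite gt_eqF.
apply: eq_from_tnth => i; rewrite !tnth_mktuple sE; ring.
Qed.

(** A probe that depends on the distance only: it is compatible with reflections, and its total mass
    is finite and independent of the centre. *)
Let rho (x y : Y) : R := (1 + sqdist (x, 0) y) `^ (- (1 * k%:R)).
Let rho0 (x : Y) : R := (1 + nsq x) `^ (- (1 * k%:R)).

Let mrho : measurable_fun setT (fun p : Y * Y => rho p.1 p.2).
Proof.
apply: (measurableT_comp (measurable_powR _)); apply: measurable_funD => //.
have mp : measurable_fun setT (fun p : Y * Y => (((p.1, 0) : halfpt R k), p.2)).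
  by apply: measurable_fun_pair => //; apply: measurable_fun_pair.
exact: (measurableT_comp (@measurable_sqdist R k) mp).
Qed.

Let mrho1 x : measurable_fun setT (rho x).
Proof. exact: (measurableT_comp mrho (measurable_pair1 x)). Qed.

Let mrho0 : measurable_fun setT rho0.
Proof.
apply: (measurableT_comp (measurable_powR _)).
by apply: measurable_funD => //; exact: measurable_nsq.
Qed.

Let rho_refl x y : rho x (refl y) = rho (refl x) y.
Proof. by rewrite /rho -(sqdist_refll (x, 0)). Qed.

Let rho_shift x y : rho (affineT x 1 y) x = rho0 y.
Proof.
rewrite /rho /rho0 /sqdist /= expr0n addr0; congr ((1 + _) `^ _).
by apply: eq_bigr => i _; rewrite tnth_mktuple; congr (_ ^+ 2); ring.
Qed.

Let rho_shift2 x y : rho x (affineT x 1 y) = rho0 y.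
Proof.
rewrite /rho /rho0 /sqdist /= expr0n addr0; congr ((1 + _) `^ _).
by apply: eq_bigr => i _; rewrite tnth_mktuple -sqrrN; congr (_ ^+ 2); ring.
Qed.

Let translate (a : Y) (g : Y -> \bar R) : measurable_fun setT g -> (forall x, 0 <= g x)%E ->
  (\int[nu]_y g (affineT a 1 y) = \int[nu]_y g y)%E.
Proof.
by move=> mg g0; rewrite integral_affineT// invr1 expr1n mul1e.
Qed.

(** Only translation invariance and Tonelli are used. The integral of g o refl times the mass of the
    probe is the double integral of g(y + refl x) rho0(y); substituting w = y + refl x and letting
    the reflection pass to [w] inside [rho] turns it into the integral of [g] times the same
    mass. *)
Lemma integral_refl (g : Y -> \bar R) : measurable_fun setT g -> (forall x, 0 <= g x)%E ->
  (\int[nu]_y g (refl y) = \int[nu]_y g y)%E.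
Proof.
move=> mg g0.
have i0 := @nsq_weight_int R k 1 (ltac:(lra)).
have [c cE] : exists c, \int[nu]_y rho0 y = c by eexists.
have c0 : 0 < c.
  rewrite -cE; apply: Rint_gt0 => //; first exact: lebesgueT_gt0.
  by move=> y _; rewrite powR_gt0// ltr_wpDr// nsq_ge0.
have ec : (\int[nu]_y (rho0 y)%:E = c%:E)%E by rewrite integral_EFin// cE.
have ec2 x : (\int[nu]_y (rho x y)%:E = c%:E)%E.
  rewrite -ec -(@translate x (fun y => (rho x y)%:E)).
  - by apply: eq_integral => y _; rewrite rho_shift2.
  - exact/measurable_EFinP.
  - by move=> y; rewrite lee_fin powR_ge0.
have mgr : measurable_fun setT (g \o refl).
  by apply: measurableT_comp => //; exact: measurable_refl.
have [A AE] : exists A, (\int[nu]_y g (refl y) = A)%E by eexists.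
have A0 : (0 <= A)%E by rewrite -AE; exact: integral_ge0.
have r00 y : (0 <= (rho0 y)%:E)%E by rewrite lee_fin powR_ge0.
have r0 x y : (0 <= (rho x y)%:E)%E by rewrite lee_fin powR_ge0.
have mE0 : measurable_fun setT (fun y => (rho0 y)%:E) by exact/measurable_EFinP.
have mE1 x : measurable_fun setT (fun y => (rho x y)%:E) by exact/measurable_EFinP.
pose F (p : Y * Y) := (g (affineT p.1 1 (refl p.2)) * (rho0 p.1)%:E)%E.
have maff : measurable_fun setT (fun p : Y * Y => affineT p.1 1 (refl p.2)).
  apply/measurable_fun_tnthP => i.
  rewrite (_ : _ \o _ = (fun p : Y * Y => tnth p.1 i + 1 * tnth (refl p.2) i)).
    apply: measurable_funD; first exact: (measurableT_comp (measurable_tnth i)).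
    apply: measurable_funM => //; apply: (measurableT_comp (measurable_tnth i)).
    by apply: (measurableT_comp measurable_refl).
  by apply/funext => p /=; rewrite tnth_mktuple.
have mF : measurable_fun setT F.
  apply: emeasurable_funM; first exact: (measurableT_comp mg maff).
  exact: (measurableT_comp mE0 measurable_fst).
have F0 p : (0 <= F p)%E by rewrite mule_ge0.
pose G (p : Y * Y) := (g p.2 * (rho p.2 (refl p.1))%:E)%E.
have mG : measurable_fun setT G.
  apply: emeasurable_funM; first exact: (measurableT_comp mg measurable_snd).
  apply/measurable_EFinP; apply: (measurableT_comp mrho (g := fun p : Y * Y => (p.2, refl p.1))).
  apply: measurable_fun_pair => //.
  by apply: (measurableT_comp measurable_refl).
have G0 p : (0 <= G p)%E by rewrite mule_ge0.
have AcE : (A * c%:E = \int[nu]_y \int[nu]_x F (y, x))%E.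
  rewrite -ec -ge0_integralZl//; apply: eq_integral => y _.
  transitivity ((\int[nu]_x g (affineT y 1 (refl x))) * (rho0 y)%:E)%E.
    congr (_ * _)%E; rewrite -AE -(@translate (refl_dir y) (g \o refl))//.
      by apply: eq_integral => x _; rewrite /= refl_affine.
    by move=> x; exact: g0.
  apply/esym; rewrite /F /=; apply: ge0_integralZr => //.
  exact: (measurableT_comp (measurableT_comp mg maff) (measurable_pair1 y)).
have BcE : (\int[nu]_x \int[nu]_w G (x, w) = (\int[nu]_w g w) * c%:E)%E.
  transitivity (\int[nu]_w \int[nu]_x G (x, w))%E; first exact: fubini_tonelli mG G0.
  transitivity (\int[nu]_w (g w * c%:E))%E.
    apply: eq_integral => w _; rewrite -(ec2 (refl w)); rewrite /G /=.
    transitivity (\int[nu]_x (g w * (rho (refl w) x)%:E))%E.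
      by apply: eq_integral => x _; rewrite rho_refl.
    by apply: ge0_integralZl.
  by apply: ge0_integralZr => //; rewrite lee_fin ltW.
(* For fixed [x], the inner integral is translated by [refl x]. *)
have FG : (\int[nu]_y \int[nu]_x F (y, x) = \int[nu]_x \int[nu]_w G (x, w))%E.
  transitivity (\int[nu]_x \int[nu]_y F (y, x))%E; first exact: fubini_tonelli mF F0.
  apply: eq_integral => x _.
  rewrite -(@translate (refl x) (fun w => G (x, w))).
  - apply: eq_integral => y _; rewrite /F /G /= rho_shift; congr (g _ * _)%E.
    by apply: eq_from_tnth => i; rewrite !tnth_mktuple; ring.
  - exact: (measurableT_comp mG (measurable_pair1 x)).
  - by move=> w; exact: G0.
have AB : (A * c%:E = (\int[nu]_w g w) * c%:E)%E by rewrite AcE FG BcE.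
rewrite AE; move: AB; move: (\int[nu]_w g w)%E => B.
move/(congr1 (fun z => z * (c^-1)%:E)%E).
by rewrite -[LHS]muleA -[RHS]muleA -!EFinM (divff (lt0r_neq0 c0)) !mule1.
Qed.

End reflection.

(** * Change of variables for signed integrands *)

Section change_of_variables.
Context {d} {T : measurableType d} {R : realType}.
Context (mu : {measure set T -> \bar R}) (D : set T) (mD : measurable D).
Context (phi : T -> T) (c : R).
Hypothesis mphi : measurable_fun setT phi.
Hypothesis phiP : forall g : T -> \bar R, measurable_fun setT g ->
  (forall x, 0 <= g x)%E ->
  (\int[mu]_(x in D) g (phi x) = c%:E * \int[mu]_(x in D) g x)%E.

Lemma ge0_intg_comp (g : T -> R) : measurable_fun setT g -> (forall x, 0 <= g x) ->
  mu.-integrable D (EFin \o g) ->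
  mu.-integrable D (EFin \o fun x => g (phi x)) /\
  \int[mu]_(x in D) g (phi x) = c * \int[mu]_(x in D) g x.
Proof.
move=> mg g0 ig.
have E : (\int[mu]_(x in D) (g (phi x))%:E = c%:E * \int[mu]_(x in D) (g x)%:E)%E.
  apply: (phiP (g := fun x => (g x)%:E)); first exact/measurable_EFinP.
  by move=> x; rewrite lee_fin.
have ip : mu.-integrable D (EFin \o fun x => g (phi x)).
  apply: intg_lty.
  - by apply: measurable_funTS; exact: measurableT_comp mg mphi.
  - by move=> x _; exact: g0.
  - by rewrite E (integral_EFin mD ig) -EFinM ltry.
split=> //; apply: EFin_inj; rewrite -(integral_EFin mD ip) E.
by rewrite (integral_EFin mD ig).
Qed.

Lemma intg_comp (g : T -> R) : measurable_fun setT g ->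
  mu.-integrable D (EFin \o g) ->
  mu.-integrable D (EFin \o fun x => g (phi x)) /\
  \int[mu]_(x in D) g (phi x) = c * \int[mu]_(x in D) g x.
Proof.
move=> mg ig.
pose p x := Num.max (g x) 0; pose n x := Num.max (- g x) 0.
have gpn x : g x = p x - n x.
  rewrite /p /n; have [g0|g0] := leP (g x) 0; have [h0|h0] := leP (- g x) 0; lra.
have mp : measurable_fun setT p by exact: measurable_maxr.
have mn : measurable_fun setT n by apply: measurable_maxr => //; exact: measurable_funN.
have ip : mu.-integrable D (EFin \o p).
  apply: intg_dominated (intg_norm ig) _ => //; first exact: measurable_funTS.
  by move=> x _; rewrite ger0_norm ?le_max ?lexx ?orbT// ge_max ler_norm normr_ge0.
have i_n : mu.-integrable D (EFin \o n).
  apply: intg_dominated (intg_norm ig) _ => //; first exact: measurable_funTS.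
  move=> x _; rewrite ger0_norm ?le_max ?lexx ?orbT// ge_max normr_ge0 andbT.
  by rewrite -normrN ler_norm.
have p0 x : 0 <= p x by rewrite le_max lexx orbT.
have n0 x : 0 <= n x by rewrite le_max lexx orbT.
have [ip' pE] := ge0_intg_comp mp p0 ip.
have [in' nE] := ge0_intg_comp mn n0 i_n.
split.
  apply: (eq_intg mD (f := fun x => p (phi x) - n (phi x))); last exact: intgB.
  by move=> x _; rewrite gpn.
transitivity (\int[mu]_(x in D) (p (phi x) - n (phi x))).
  by apply: eq_Rint => x _; rewrite gpn.
rewrite RintegralB// pE nE -mulrBr -RintegralB//; congr (_ * _).
by apply: eq_Rint => x _; rewrite gpn.
Qed.

End change_of_variables.

(** * Dilations and reflections of the half space *)

Section half_space_maps.
Context {R : realType} (k : nat).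
Local Notation X := (halfpt R k).
Local Notation Y := (k.-tuple R).
Local Notation P := (halfmu R k).
Local Notation D := (@upper R k).
Local Notation nu := (@lebesgueT R k).

Let mI : measurable_fun setT (fun h : R => (\1_[set x : R | (0 < x)%R] h)%:E : \bar R).
Proof.
apply/measurable_EFinP; apply: measurable_indic.
by rewrite -set_itvoy; exact: measurable_itv.
Qed.

Let mIg (g : X -> \bar R) : measurable_fun setT g ->
  measurable_fun setT (fun x : X => (\1_[set x : R | (0 < x)%R] x.2)%:E * g x)%E.
Proof.
by move=> mg; apply: emeasurable_funM => //; exact: (measurableT_comp mI measurable_snd).
Qed.

Lemma integral_upper (g : X -> \bar R) : measurable_fun setT g -> (forall x, 0 <= g x)%E ->
  (\int[P]_(x in D) g x =
   \int[nu]_y \int[lebesgue_measure]_h ((\1_[set x : R | (0 < x)%R] h)%:E * g (y, h)))%E.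
Proof.
move=> mg g0; rewrite integral_mkcond.
transitivity (\int[P]_x ((\1_[set x : R | (0 < x)%R] x.2)%:E * g x))%E.
  apply: eq_integral => x _; rewrite patchE indicE.
  have -> : (x \in D) = (x.2 \in [set x : R | 0 < x]) by [].
  by case: ifP => _; rewrite ?mul1e ?mul0e.
apply: (fubini_tonelli1 (fun x : X => (\1_[set x : R | (0 < x)%R] x.2)%:E * g x)%E).
  exact: mIg.
by move=> x; rewrite mule_ge0// lee_fin.
Qed.

Definition affineX (a : Y) (s : R) (x : X) : X := (affineT a s x.1, s * x.2).
Definition reflX (e : Y) (s : R) (x : X) : X := (refl e s x.1, x.2).

Lemma measurable_affineX a s : measurable_fun setT (affineX a s).
Proof.
apply: measurable_fun_pair.
  exact: (measurableT_comp (@measurable_affineT _ _ _ _) measurable_fst).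
by apply: measurable_funM => //.
Qed.

Lemma measurable_reflX e s : measurable_fun setT (reflX e s).
Proof.
apply: measurable_fun_pair => //.
exact: (measurableT_comp (@measurable_refl _ _ _ _) measurable_fst).
Qed.

Let mphi (g : X -> \bar R) : measurable_fun setT g -> (forall x, 0 <= g x)%E ->
  measurable_fun setT (fun y => \int[lebesgue_measure]_h
    ((\1_[set x : R | (0 < x)%R] h)%:E * g (y, h)))%E.
Proof.
move=> mg g0.
apply: (measurable_fun_fubini_tonelli_F
  (fun x : X => (\1_[set x : R | (0 < x)%R] x.2)%:E * g x)%E); first exact: mIg.
by move=> x; rewrite mule_ge0// lee_fin.
Qed.

Lemma integral_reflX e s (g : X -> \bar R) : 0 < nsq e -> measurable_fun setT g ->
  (forall x, 0 <= g x)%E ->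
  (\int[P]_(x in D) g (reflX e s x) = 1%:E * \int[P]_(x in D) g x)%E.
Proof.
move=> e0 mg g0; rewrite mul1e integral_upper//; last first.
  by apply: (measurableT_comp mg); exact: measurable_reflX.
rewrite (integral_upper mg g0).
rewrite -(integral_refl s e0 (mphi mg g0))// => y.
by apply: integral_ge0 => h _; rewrite mule_ge0// lee_fin.
Qed.

Lemma integral_affineX a s (g : X -> \bar R) : 0 < s -> measurable_fun setT g ->
  (forall x, 0 <= g x)%E ->
  (\int[P]_(x in D) g (affineX a s x) = ((s^-1) ^+ k.+1)%:E * \int[P]_(x in D) g x)%E.
Proof.
move=> s0 mg g0; rewrite integral_upper//; last first.
  by apply: (measurableT_comp mg); exact: measurable_affineX.
rewrite (integral_upper mg g0).
pose G (y : Y) := (\int[lebesgue_measure]_h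
    ((\1_[set x : R | (0 < x)%R] h)%:E * g (y, h)))%E.
have G0 y : (0 <= G y)%E.
  by apply: integral_ge0 => h _; rewrite mule_ge0// lee_fin.
transitivity (\int[nu]_y ((s^-1)%:E * G (affineT a s y)))%E.
  apply: eq_integral => y _.
  rewrite -(@integral_affine1 R 0 s s0 (fun h => (\1_[set x : R | (0 < x)%R] h)%:E * g (affineT a s y, h))%E).
  - apply: eq_integral => h _; rewrite add0r; congr (_ * _)%E.
    congr (_%:E); rewrite !indicE; congr (nat_of_bool _)%:R.
    by apply/idP/idP; rewrite !inE/= pmulr_rgt0.
  - exact: (measurableT_comp (mIg mg) (measurable_pair1 (affineT a s y))).
  - by move=> h; rewrite mule_ge0// lee_fin.
transitivity ((s^-1)%:E * \int[nu]_y G (affineT a s y))%E.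
  apply: ge0_integralZl_EFin => //.
    by apply: (measurableT_comp (mphi mg g0)); exact: measurable_affineT.
  by rewrite invr_ge0 ltW.
by rewrite (integral_affineT a s0 (mphi mg g0) G0) muleA -EFinM exprS.
Qed.

End half_space_maps.

(** * Sequential continuity and strict positivity of integrals *)

Section sequential_continuity.
Context {R : realType} (k : nat).
Local Notation Y := (k.-tuple R).
Local Notation nu := (@lebesgueT R k).
Implicit Types g h : Y -> R.

(** Continuity is tested on coordinatewise convergent sequences, the form in which dominated
    convergence delivers it. *)
Definition seq_continuous g := forall (z : nat -> Y) y,
  (forall i, (fun j => tnth (z j) i) @ \oo --> tnth y i) ->
  (fun j => g (z j)) @ \oo --> g y.

Lemma seq_continuousB g h : seq_continuous g -> seq_continuous h ->
  seq_continuous (fun y => g y - h y).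
Proof. by move=> cg ch z y zy; apply: cvgB; [exact: cg|exact: ch]. Qed.

Lemma seq_continuous_side e s : seq_continuous (@side R k e s).
Proof.
move=> z y zy; apply: cvgB; last exact: cvg_cst.
apply: (cvg_big (@add_continuous R)) => i _.
by apply: cvgM; [exact: cvg_cst|exact: zy].
Qed.

Lemma seq_continuous_refl e s g : seq_continuous g ->
  seq_continuous (fun y => g (@refl R k e s y)).
Proof.
move=> cg z y zy; apply: cg => i; rewrite tnth_mktuple.
rewrite (_ : (fun j => _) = (fun j => tnth (z j) i - 2 * side e s (z j) / nsq e * tnth e i)).
  apply: cvgB; first exact: zy.
  apply: cvgM; last exact: cvg_cst.
  apply: cvgM; last exact: cvg_cst.
  by apply: cvgM; [exact: cvg_cst|exact: seq_continuous_side].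
by apply/funext => j; rewrite tnth_mktuple.
Qed.

Lemma box_pos g (y : Y) : seq_continuous g -> 0 < g y ->
  exists2 e, 0 < e & forall z : Y, box y e z -> 0 < g z.
Proof.
move=> cg gy; apply: contrapT => H.
have [z zP] : {z : nat -> Y & forall j, box y j.+1%:R^-1 (z j) /\ g (z j) <= 0}.
  apply: (@choice _ _ (fun j z => box y j.+1%:R^-1 z /\ g z <= 0)) => j.
  apply: contrapT => Hj; apply: H; exists j.+1%:R^-1; first by rewrite invr_gt0.
  by move=> z yz; rewrite ltNge; apply/negP => gz; apply: Hj; exists z.
have zy i : (fun j => tnth (z j) i) @ \oo --> tnth y i.
  apply/cvgrPdist_le => /= d d0; have /cvgrPdist_lt := @cvg_harmonic R.
  move=> /(_ _ d0); apply: filterS => j /=; rewrite sub0r normrN ger0_norm// => jd.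
  have [/(_ i) + _] := zP j; rewrite in_itv/= => /andP[].
  move: (j.+1%:R^-1) jd => r rd h1 h2.
  by rewrite ler_norml; apply/andP; split; lra.
have := cvg_seq_le_cst (cg z y zy) (fun j => (zP j).2).
by rewrite leNgt gy.
Qed.

Lemma sub_box (y : Y) (e e' : R) z : e <= e' -> box y e z -> box y e' z.
Proof.
move=> ee yz i; have := yz i; rewrite !in_itv/= => /andP[? ?]; apply/andP; split; lra.
Qed.

Lemma box_pos2 g h (y : Y) : seq_continuous g -> seq_continuous h -> 0 < g y -> 0 < h y ->
  exists2 e, 0 < e & forall z : Y, box y e z -> 0 < g z /\ 0 < h z.
Proof.
move=> cg ch gy hy; have [e1 e10 H1] := box_pos cg gy; have [e2 e20 H2] := box_pos ch hy.
exists (Num.min e1 e2); first by rewrite lt_min e10.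
move=> z yz; split; [apply: H1|apply: H2]; apply: sub_box yz; rewrite ge_min lexx ?orbT//.
Qed.

(** Two functions are needed since strictness is asked on an open half space ([h1] is then [side])
    where, moreover, [f] differs from its reflection in a given direction ([h2]). *)
Lemma Rint_gt0_box g h1 h2 (y : Y) : nu.-integrable setT (EFin \o g) -> (forall z, 0 <= g z) ->
  seq_continuous h1 -> seq_continuous h2 -> 0 < h1 y -> 0 < h2 y ->
  (forall z, 0 < h1 z -> 0 < h2 z -> 0 < g z) -> 0 < \int[nu]_z g z.
Proof.
move=> ig g0 c1 c2 p1 p2 H; rewrite lt_neqAle Rintegral_ge0 ?andbT//.
apply/eqP => /esym gE; have [e e0 He] := box_pos2 c1 c2 p1 p2.
have [z yz gz] := Rint_eq0 measurableT ig (fun z _ => g0 z) gE (measurable_box y e)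
  (@subsetT _ _) (box_gt0 y e0).
have [h1z h2z] := He _ yz; have := H z h1z h2z; by rewrite gz ltxx.
Qed.

End sequential_continuity.

(** * Existence, normalization and symmetry of minimizers *)

Section normalization.
Context {R : realType} (k : nat) (be q ka : R).
Hypotheses (be0 : 0 < be) (q0 : 0 < q) (bq : k.+1%:R < 2 * (be * q)).
Hypothesis k0 : (0 < k)%N.
Hypothesis kaE : ka * (2 * be - k.+1%:R / q) = k%:R.
Local Notation X := (halfpt R k).
Local Notation Y := (k.-tuple R).
Local Notation P := (halfmu R k).
Local Notation D := (@upper R k).
Local Notation nu := (@lebesgueT R k).
Local Notation ker := (@powdist R k be).
Local Notation wtX := (@halfweight R k be).
Local Notation wtY := (@bdryweight R k be).
Local Notation kin := (kint nu ker).
Local Notation dens := (density nu wtY).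
Local Notation neg := (negmass P D q).
Local Notation FE := (free_energy P D nu ker q ka).

Lemma ka_gt0 : 0 < ka.
Proof.
have h : 0 < 2 * be - k.+1%:R / q.
  by rewrite subr_gt0 ltr_pdivrMr// -mulrA.
by rewrite -(pmulr_lgt0 _ h) kaE ltr0n.
Qed.

Let mD := @measurable_upper R k.
Let mker := @measurable_ker R k be.
Let mwtX := @measurable_wtX R k be.
Let mwtY := @measurable_wtY R k be.
Let wtX1 := @wtX_ge1 R k be be0.
Let wtY1 := @wtY_ge1 R k be be0.
Let ker0 := @ker_ge0 R k be.
Let kerle := @ker_le R k be be0.
Let wtXle := @wtX_le R k be be0.
Let wtYle := @wtY_le R k be be0.
Let wtXi := @wtX_int R k be q bq.
Let kerpos := @ker_pos R k be be0 k0.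
Let c41 := @c4_ge1 R be be0.

Lemma dens_int f : dens f -> nu.-integrable setT (EFin \o f).
Proof. exact: density_int. Qed.

Lemma dens_ker f x : dens f -> nu.-integrable setT (EFin \o fun y => ker x y * f y).
Proof. exact: (density_kint mker ker0 kerle). Qed.

Lemma dens_comparable f : dens f -> exists c C, comparable wtX c C (kin f).
Proof. exact: (comparable_kint mker wtY1 ker0 c41 kerle wtXle kerpos). Qed.

(** Finiteness of K f at a single point already bounds the moment. This shows that rescaled and
    polarized densities are densities, and that K f is infinite everywhere when the moment is. *)
Lemma moment_le (f : Y -> R) (x : X) : (forall y, 0 <= f y) -> measurable_fun setT f ->
  nu.-integrable setT (EFin \o f) ->
  nu.-integrable setT (EFin \o fun y => ker x y * f y) ->
  nu.-integrable setT (EFin \o fun y => wtY y * f y) /\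
  \int[nu]_y (wtY y * f y) <= c4 be * (kin f x + wtX x * \int[nu]_y f y).
Proof.
move=> f0 mf i_f ik.
have ib : nu.-integrable setT (EFin \o fun y => c4 be * (ker x y * f y + wtX x * f y)).
  by apply: intgZ => //; apply: intgD => //; exact: intgZ.
have le y : wtY y * f y <= c4 be * (ker x y * f y + wtX x * f y).
  by rewrite -mulrDl mulrA ler_wpM2r.
have b0 y : 0 <= wtY y * f y.
  by rewrite mulr_ge0// (le_trans ler01).
have iw : nu.-integrable setT (EFin \o fun y => wtY y * f y).
  apply: (intg_dominated measurableT _ ib) => [|y _].
    by apply: measurable_funM.
  by rewrite ger0_norm.
split => //; rewrite -(RintegralZl _ measurableT i_f) -RintegralD//; last exact: intgZ.
rewrite -RintegralZl//; last by apply: intgD => //; exact: intgZ.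
exact: le_Rintegral.
Qed.

(** * Invariance under dilations and translations of the boundary *)

Section scaling.
Variables (a : Y) (s : R).
Hypothesis s0 : 0 < s.
Implicit Type f : Y -> R.

Definition rescale f (y : Y) : R := s ^+ k * f (affineT a s y).

Let A := @affineT R k a s.
Let mA : measurable_fun setT A. Proof. exact: measurable_affineT. Qed.

Let AP (g : Y -> \bar R) : measurable_fun setT g -> (forall x, 0 <= g x)%E ->
  (\int[nu]_y g (A y) = ((s^-1) ^+ k)%:E * \int[nu]_y g y)%E.
Proof. by move=> mg g0; exact: integral_affineT. Qed.

Let sk0 : 0 < s ^+ k. Proof. exact: exprn_gt0. Qed.

Let skV : s ^+ k * s^-1 ^+ k = 1.
Proof. by rewrite -exprMn divff ?expr1n// gt_eqF. Qed.

Lemma ker_affine x y : ker (affineX a s x) (A y) = s `^ (2 * be) * ker x y.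
Proof.
rewrite /powdist powRrM powR_mulrn ?(ltW s0)// -powRM ?sqdist_ge0 ?exprn_ge0 ?(ltW s0)//.
congr (_ `^ _); rewrite /sqdist /affineX /A /= mulrDr mulr_sumr; congr (_ + _); last by ring.
by apply: eq_bigr => i _; rewrite !tnth_mktuple; ring.
Qed.

Let s2 : 0 < s `^ (2 * be). Proof. exact: powR_gt0. Qed.

Lemma rescale_ker f x : dens f ->
  nu.-integrable setT (EFin \o fun y => ker x y * rescale f y) /\
  kin (rescale f) x = (s `^ (2 * be))^-1 * kin f (affineX a s x).
Proof.
move=> df; have [f0 mf _ _ _] := df.
have i1 := dens_ker (affineX a s x) df.
have mg : measurable_fun setT (fun y => ker (affineX a s x) y * f y).
  by apply: measurable_funM => //; exact: (measurableT_comp mker (measurable_pair1 _)).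
have [i2 E] := intg_comp measurableT mA AP mg i1.
have pt y : ker x y * rescale f y =
    (s `^ (2 * be))^-1 * s ^+ k * (ker (affineX a s x) (A y) * f (A y)).
  by rewrite ker_affine /rescale -/A; field; rewrite gt_eqF.
split.
  apply: (eq_intg measurableT (f := fun y => (s `^ (2 * be))^-1 * s ^+ k * (ker (affineX a s x) (A y) * f (A y)))).
    by move=> y _; rewrite pt.
  exact: intgZ.
rewrite /kint (eq_Rint nu (fun y _ => pt y)) RintegralZl// E.
by rewrite -mulrA; congr (_ * _); rewrite mulrA skV mul1r.
Qed.

Lemma rescale_mass f : dens f -> nu.-integrable setT (EFin \o rescale f) /\
  \int[nu]_y rescale f y = 1.
Proof.
move=> df; have [f0 mf _ f1 _] := df; have i_f := dens_int df.
have [i2 E] := intg_comp measurableT mA AP mf i_f.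
by split; [exact: intgZ|rewrite RintegralZl// E f1 mulr1].
Qed.

Lemma rescale_ent f : dens f ->
  nu.-integrable setT (EFin \o fun y => rescale f y * ln (rescale f y)) /\
  ent nu (rescale f) = ent nu f + k%:R * ln s.
Proof.
move=> df; have [f0 mf _ f1 ief] := df; have i_f := dens_int df.
have [i2 E2] := intg_comp measurableT mA AP mf i_f.
have mfl : measurable_fun setT (fun y => f y * ln (f y)).
  by apply: measurable_funM => //; apply: measurableT_comp => //; exact: measurable_ln.
have [i3 E3] := intg_comp measurableT mA AP mfl ief.
have pt y : rescale f y * ln (rescale f y) =
    s ^+ k * (f (A y) * ln (f (A y))) + s ^+ k * (k%:R * ln s) * f (A y).
  rewrite /rescale -/A; have := f0 (A y); rewrite le_eqVlt => /predU1P[<-|fp].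
    by rewrite !mul0r !mulr0 mul0r addr0.
  rewrite lnM ?posrE// lnXn// -mulr_natl; ring.
split.
  apply: (eq_intg measurableT (f := fun y => s ^+ k * (f (A y) * ln (f (A y))) + s ^+ k * (k%:R * ln s) * f (A y))).
    by move=> y _; rewrite pt.
  by apply: intgD => //; exact: intgZ.
rewrite /ent (eq_Rint nu (fun y _ => pt y)) RintegralD//; try exact: intgZ.
rewrite RintegralZl// RintegralZl// E2 E3 f1 mulr1 mulrA skV mul1r; congr (_ + _).
by rewrite mulrAC skV mul1r.
Qed.

Lemma rescale_dens f : dens f -> dens (rescale f).
Proof.
move=> df; have [f0 mf _ f1 ief] := df.
have r0 y : 0 <= rescale f y by rewrite mulr_ge0// ltW.
have mr : measurable_fun setT (rescale f).
  by apply: measurable_funM => //; exact: (measurableT_comp mf mA).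
have [im m1] := rescale_mass df; have [ie _] := rescale_ent df.
(* The moment of the rescaled density is recovered from the value of its kernel potential at one
   point. *)
pose x0 : X := ([tuple (0 : R) | i < k], 0).
have [ik _] := rescale_ker x0 df.
by have [iw _] := moment_le r0 mr im ik; split.
Qed.

(** The entropy gains k ln s and the logarithm of the negative mass (2 be q - k - 1) ln s; [kaE] is
    exactly the balance of the two. *)
Lemma rescale_FE f : dens f -> FE (rescale f) = FE f.
Proof.
move=> df; have [_ E] := rescale_ent df; rewrite /free_energy E.
have [c [C cf]] := dens_comparable df.
have [_ mk _] := cf.
have iN := comparable_int mD wtX1 q0 wtXi cf.
have mp : measurable_fun setT (fun x => kin f x `^ (- q)).
  exact: (measurableT_comp (measurable_powR _) mk).
have XP (g : X -> \bar R) : measurable_fun setT g -> (forall x, 0 <= g x)%E ->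
  (\int[P]_(x in D) g (affineX a s x) = ((s^-1) ^+ k.+1)%:E * \int[P]_(x in D) g x)%E.
  by move=> mg g0; exact: integral_affineX.
have [i2 E2] := intg_comp mD (@measurable_affineX R k a s) XP mp iN.
have kp x : 0 < kin f x by exact: (comparable_gt0 wtX1 x cf).
have -> : neg (kin (rescale f)) = s `^ (2 * be * q - k.+1%:R) * neg (kin f).
  transitivity (\int[P]_(x in D) (s `^ (2 * be * q) * kin f (affineX a s x) `^ (- q))).
    apply: eq_Rint => x _; have [_ ->] := rescale_ker x df.
    rewrite powRM ?invr_ge0 ?(ltW s2) ?(ltW (kp _))//; congr (_ * _).
    by rewrite -powRN -powRrM mulrNN.
  rewrite (RintegralZl _ mD i2) E2 mulrA; congr (_ * _).
  rewrite powRD; last by apply/implyP; rewrite (gt_eqF s0).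
  by rewrite powRN powR_mulrn ?(ltW s0)// exprVn.
have G0 : 0 < neg (kin f) by exact: (negmass_gt0 mD wtX1 q0 wtXi (@upper_gt0 R k) cf).
rewrite lnM ?posrE ?powR_gt0// ln_powR mulrDr.
have : ka / q * ((2 * be * q - k.+1%:R) * ln s) = k%:R * ln s.
  by rewrite mulrA -kaE; congr (_ * _); field; rewrite gt_eqF.
by move=> ->; ring.
Qed.

End scaling.

Lemma ker_boundary_le (x : X) y : ker (x.1, 0) y <= ker x y.
Proof.
apply: ge0_ler_powR; rewrite ?nnegrE ?sqdist_ge0 ?(ltW be0)//.
by rewrite /sqdist /= expr0n addr0 lerDl sqr_ge0.
Qed.

(* Translating and rescaling so that the minimum over the boundary of the
   kernel potential is (almost) attained at the origin, with value about 1. *)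
Lemma normalize f : dens f -> exists f', [/\ dens f', FE f' = FE f,
  forall x, 1 <= kin f' x & \int[nu]_y (wtY y * f' y) <= c4 be * (2 + 1)].
Proof.
move=> df; have [c c0 cf] := kerpos df.
pose S := [set kin f (y, 0) | y in [set: Y]].
have S0 : has_lbound S by exists c => _ [y _ <-].
have Sinf : has_inf S by split => //; exists (kin f ([tuple (0 : R) | i < k], 0)); eexists.
have [e0 e0E] : exists r, inf S = r by eexists.
have ce : c <= e0.
  by rewrite -e0E; apply: lb_le_inf; [exact: Sinf.1|move=> _ [y _ <-]].
have e00 : 0 < e0 by exact: lt_le_trans ce.
(* The tolerance is the infimum itself, so the value at [a] is below 2 [e0]: the origin of the 2 in
   the moment bound. *)
have [_ [a _ <-]] := inf_adherent e00 Sinf; rewrite e0E => ae.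
(* Raising a point above the boundary only increases its distances, so the boundary infimum bounds K
   f on the whole half space. *)
have ef x : e0 <= kin f x.
  apply: (@le_trans _ _ (kin f (x.1, 0))).
    by rewrite -e0E; apply: ge_inf => //; exists x.1.
  apply: le_Rintegral => //; [exact: dens_ker|exact: dens_ker|].
  by move=> y _; apply: ler_wpM2r; [case: df|exact: ker_boundary_le].
(* Rescaling divides K f by s^(2 be), here made equal to [e0]. *)
pose s := e0 `^ (2 * be)^-1.
have s0 : 0 < s by rewrite powR_gt0.
have sE : s `^ (2 * be) = e0.
  by rewrite -powRrM mulVf ?mulf_neq0 ?gt_eqF// powRr1// ltW.
have df' := rescale_dens a s0 df.
exists (rescale a s f); split.
- exact: df'.
- exact: rescale_FE.
- move=> x; have [_ ->] := rescale_ker a s0 x df.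
  by rewrite sE ler_pdivlMl// mulr1.
pose x0 : X := ([tuple (0 : R) | i < k], 0).
have [ik kE] := rescale_ker a s0 x0 df.
have [im mE] := rescale_mass a s0 df.
have [f0' mf' _ _ _] := df'.
have [_ le] := moment_le f0' mf' im ik.
apply: (le_trans le); rewrite mE mulr1; apply: ler_wpM2l; first exact: powR_ge0.
have w1 : wtX x0 = 1.
  rewrite /halfweight /wsq /nsq /x0 /= expr0n addr0 big1 ?addr0 ?powR1// => i _.
  by rewrite tnth_mktuple expr0n.
rewrite w1 lerD2r kE sE ler_pdivrMl//.
have -> : affineX a s x0 = (a, 0).
  rewrite /affineX /x0 /= mulr0; congr pair; apply: eq_from_tnth => i.
  by rewrite !tnth_mktuple mulr0 addr0.
by rewrite mulr_natr mulr2n ltW.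
Qed.

Lemma minimizer : exists c C V, tame P D ker wtX wtY q c C V /\
  forall f, dens f -> FE (gibbs nu V) <= FE f.
Proof.
have nuT := @lebesgueT_gt0 R k.
have ib := @wtY_int R k be be0 k0.
(* The Gibbs state of the weight itself shows that normalized densities exist. *)
have cw : confining wtY 1 1 wtY.
  by split => // y; rewrite mul1r lexx andbT lerBlDr lerDl.
have dw := gibbs_density mwtY wtY1 ib nuT cw.
have [f1 [df1 _ f11 f1m]] := normalize dw.
have [|c [C [V [tV Vmin]]]] := free_energy_min mD mker mwtX mwtY wtX1 wtY1 ker0
  c41 kerle wtXle wtYle q0 ka_gt0 wtXi (@upper_gt0 R k) ib nuT kerpos
  (@rpt_dense R k be q be0 bq) (m := c4 be * (2 + 1)).
  by exists f1.
exists c, C, V; split; first exact: tV.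
move=> f df; have [f' [df' <- f'1 f'm]] := normalize df.
exact: Vmin.
Qed.

(** * Polarization in a hyperplane *)

Section reflection_sym.
Variables (e : Y) (s : R).
Hypothesis e0 : 0 < nsq e.
Local Notation sg := (refl e s).
Local Notation m := (side e s).
Local Notation sX := (reflX e s).
Implicit Types (f g h : Y -> R) (x : X) (y : Y).

Let sgK : involutive sg := @reflK R k e s e0.
Let msg y : m (sg y) = - m y. Proof. exact: side_refl. Qed.
Let mesg : measurable_fun setT sg. Proof. exact: measurable_refl. Qed.

Let sgP (g : Y -> \bar R) : measurable_fun setT g -> (forall y, 0 <= g y)%E ->
  (\int[nu]_y g (sg y) = 1%:E * \int[nu]_y g y)%E.
Proof. by move=> mg g0; rewrite mul1e; exact: integral_refl. Qed.

Let sXP (g : X -> \bar R) : measurable_fun setT g -> (forall x, 0 <= g x)%E ->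
  (\int[P]_(x in D) g (sX x) = 1%:E * \int[P]_(x in D) g x)%E.
Proof. by move=> mg g0; exact: integral_reflX. Qed.

Let sg_fix y : m y = 0 -> sg y = y.
Proof.
by move=> my; apply: eq_from_tnth => i; rewrite tnth_mktuple my mulr0 mul0r mul0r subr0.
Qed.

Lemma refl_intg h : measurable_fun setT h -> nu.-integrable setT (EFin \o h) ->
  nu.-integrable setT (EFin \o fun y => h (sg y)) /\
  \int[nu]_y h (sg y) = \int[nu]_y h y.
Proof.
by move=> mh ih; have [? ->] := intg_comp measurableT mesg sgP mh ih; rewrite mul1r.
Qed.

(** Symmetrizing an integrand over the reflection often yields one of constant sign. *)
Lemma Rint_sym h g : measurable_fun setT h -> nu.-integrable setT (EFin \o h) ->
  (forall y, h y + h (sg y) = g y) -> 2 * \int[nu]_y h y = \int[nu]_y g y.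
Proof.
move=> mh ih hg; have [ih' E] := refl_intg mh ih.
rewrite -(eq_Rint nu (fun y _ => hg y)) RintegralD// E; ring.
Qed.

Lemma ker_refl x y : ker (sX x) y = ker x (sg y).
Proof. by rewrite /powdist /reflX sqdist_refll. Qed.

Lemma ker_side_le x y : 0 <= m x.1 * m y -> ker x y <= ker x (sg y).
Proof.
move=> xy; apply: ge0_ler_powR; rewrite ?nnegrE ?sqdist_ge0 ?(ltW be0)//.
by rewrite sqdist_refl// lerDl divr_ge0 ?(ltW e0)// -mulrA mulr_ge0.
Qed.

Lemma ker_side_lt x y : 0 < m x.1 * m y -> ker x y < ker x (sg y).
Proof.
move=> xy; apply: gt0_ltr_powR; rewrite ?nnegrE ?sqdist_ge0//.
by rewrite sqdist_refl// ltrDl divr_gt0// -mulrA mulr_gt0.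
Qed.

Lemma ker_side_ge x y : m x.1 * m y <= 0 -> ker x (sg y) <= ker x y.
Proof.
by move=> xy; rewrite -{2}[y]sgK ker_side_le// msg mulrN oppr_ge0.
Qed.

Section polarization.
Variable f : Y -> R.
Hypothesis df : dens f.

(** The two-point rearrangement: in each pair of mirror points, the larger value goes to the side
    where [side] is non-negative. *)
Definition polar y :=
  if 0 <= m y then Num.max (f y) (f (sg y)) else Num.min (f y) (f (sg y)).

Let f0 y : 0 <= f y. Proof. by case: df. Qed.
Let mf : measurable_fun setT f. Proof. by case: df. Qed.
Let mfs : measurable_fun setT (fun y => f (sg y)).
Proof. exact: measurableT_comp mf mesg. Qed.

(** On each pair of mirror points the values are kept or exchanged; invariance of mass, entropy and
    sums over pairs follows. *)
Lemma polarP y : (polar y = f y /\ polar (sg y) = f (sg y)) \/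
  (polar y = f (sg y) /\ polar (sg y) = f y).
Proof.
have [my|my] := eqVneq (m y) 0; first by left; rewrite !sg_fix// /polar my lexx sg_fix// maxxx.
rewrite /polar msg sgK oppr_ge0; have [m0|m0] := leP 0 (m y).
  have -> : (m y <= 0) = false by apply/negbTE; rewrite -ltNge lt_neqAle eq_sym my.
  by rewrite [Num.min _ _]minC maxEle minEle; case: leP => h; [right|left].
rewrite (ltW m0) [Num.max _ _]maxC maxEle minEle.
by case: leP => h; [left|right].
Qed.

Lemma polarD y : polar y + polar (sg y) = f y + f (sg y).
Proof. by have [[-> ->]|[-> ->]] := polarP y => //; rewrite addrC. Qed.

Lemma polar_ge0 y : 0 <= polar y.
Proof. by have [[-> _]|[-> _]] := polarP y. Qed.

Lemma measurable_polar : measurable_fun setT polar.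
Proof.
have mm := @measurable_side R k e s.
have mI : measurable_fun setT (fun y => 0 <= m y) by exact: measurable_fun_ler.
apply: measurable_fun_ifT => //; first exact: measurable_maxr.
exact: measurable_minr.
Qed.

Let i_f : nu.-integrable setT (EFin \o f). Proof. exact: dens_int df. Qed.
Let ifs : nu.-integrable setT (EFin \o fun y => f (sg y)).
Proof. by have [] := refl_intg mf i_f. Qed.

Let mkerf x : measurable_fun setT (fun y => ker x y * f y).
Proof. by apply: measurable_funM => //; exact: (measurableT_comp mker (measurable_pair1 _)). Qed.

Lemma kin_refl x : nu.-integrable setT (EFin \o fun y => ker x y * f (sg y)) /\
  kin f (sX x) = \int[nu]_y (ker x y * f (sg y)).
Proof.
have [i1 E1] := refl_intg (mkerf (sX x)) (dens_ker (sX x) df).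
have pt y : ker (sX x) (sg y) * f (sg y) = ker x y * f (sg y) by rewrite ker_refl sgK.
split; first by apply: (eq_intg measurableT _ i1) => y _; exact: pt.
by rewrite /kint -E1; apply: eq_Rint => y _; exact: pt.
Qed.

Let polar_int (w : Y -> R) : measurable_fun setT w -> (forall y, 0 <= w y) ->
  nu.-integrable setT (EFin \o fun y => w y * f y) ->
  nu.-integrable setT (EFin \o fun y => w y * f (sg y)) ->
  nu.-integrable setT (EFin \o fun y => w y * polar y).
Proof.
move=> mw w0 i1 i2; apply: (intg_dominated measurableT _ (intgD measurableT i1 i2)).
  by apply: measurable_funM => //; exact: measurable_polar.
move=> y _; rewrite ger0_norm ?mulr_ge0 ?polar_ge0// -mulrDr ler_wpM2l//.
by have [[-> _]|[-> _]] := polarP y; rewrite ?lerDl ?lerDr.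
Qed.

Lemma polar_ker x : nu.-integrable setT (EFin \o fun y => ker x y * polar y).
Proof.
apply: polar_int => //; first exact: (measurableT_comp mker (measurable_pair1 _)).
  exact: dens_ker.
by have [] := kin_refl x.
Qed.

Lemma polar_mass : nu.-integrable setT (EFin \o polar) /\ \int[nu]_y polar y = 1.
Proof.
have i1 : nu.-integrable setT (EFin \o polar).
  apply: (intg_dominated measurableT measurable_polar (intgD measurableT i_f ifs)) => y _.
  rewrite ger0_norm ?polar_ge0//.
  by have [[-> _]|[-> _]] := polarP y; rewrite ?lerDl ?lerDr.
split=> //; have := Rint_sym measurable_polar i1 polarD.
have <- := Rint_sym mf i_f (fun y => erefl).
by have [_ _ _ -> _] := df; lra.
Qed.

Lemma polar_ent : nu.-integrable setT (EFin \o fun y => polar y * ln (polar y)) /\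
  ent nu polar = ent nu f.
Proof.
have [_ _ _ _ ief] := df.
have mfl (g : Y -> R) : measurable_fun setT g -> measurable_fun setT (fun y => g y * ln (g y)).
  by move=> mg; apply: measurable_funM => //; apply: measurableT_comp => //; exact: measurable_ln.
have [ies _] := refl_intg (mfl f mf) ief.
have i1 : nu.-integrable setT (EFin \o fun y => polar y * ln (polar y)).
  apply: (intg_dominated measurableT (mfl _ measurable_polar)
    (intgD measurableT (intg_norm ief) (intg_norm ies))) => y _.
  by have [[-> _]|[-> _]] := polarP y; rewrite ?lerDl ?lerDr.
split=> //.
have pt y : polar y * ln (polar y) + polar (sg y) * ln (polar (sg y)) =
    f y * ln (f y) + f (sg y) * ln (f (sg y)).
  by have [[-> ->]|[-> ->]] := polarP y => //; rewrite addrC.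
have := Rint_sym (mfl _ measurable_polar) i1 pt.
have <- := Rint_sym (mfl f mf) ief (fun y => erefl).
by rewrite /ent; lra.
Qed.

Lemma polar_dens : dens polar.
Proof.
have [i1 m1] := polar_mass; have [i2 _] := polar_ent.
have [iw _] := moment_le polar_ge0 measurable_polar i1 (polar_ker ([tuple (0 : R) | i < k], 0)).
by split => //; [exact: polar_ge0|exact: measurable_polar].
Qed.

Lemma kin_polarD x : kin polar x + kin polar (sX x) = kin f x + kin f (sX x).
Proof.
have [i1 E1] := kin_refl x.
have kp : kin polar (sX x) = \int[nu]_y (ker x y * polar (sg y)).
  have mp : measurable_fun setT (fun y => ker (sX x) y * polar y).
    apply: measurable_funM; last exact: measurable_polar.
    exact: (measurableT_comp mker (measurable_pair1 _)).
  have [_ E] := refl_intg mp (polar_ker (sX x)); rewrite /kint -E.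
  by apply: eq_Rint => y _; rewrite ker_refl sgK.
have ip : nu.-integrable setT (EFin \o fun y => ker x y * polar (sg y)).
  apply: (eq_intg measurableT (f := fun y => ker x y * f y + ker x y * f (sg y) - ker x y * polar y)).
    by move=> y _; rewrite -mulrDr -polarD; ring.
  apply: intgB => //; last exact: polar_ker.
  by apply: intgD => //; exact: dens_ker.
rewrite kp E1 -RintegralD//; last exact: polar_ker.
rewrite -RintegralD//; last exact: dens_ker.
by apply: eq_Rint => y _; rewrite -!mulrDr polarD.
Qed.

(* [gap g x y] is the symmetrized integrand of [kin g x - kin polar x], for
   [g = f] or [g = f o refl]; it has a sign. *)
Let gap (g : Y -> R) x y := (ker x y - ker x (sg y)) * (g y - polar y).

Lemma kin_gap (g : Y -> R) x : measurable_fun setT g ->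
  nu.-integrable setT (EFin \o fun y => ker x y * g y) ->
  (forall y, g y + g (sg y) = f y + f (sg y)) ->
  nu.-integrable setT (EFin \o gap g x) /\
  2 * (kin g x - kin polar x) = \int[nu]_y gap g x y.
Proof.
move=> mg ig gE.
pose h y := ker x y * g y - ker x y * polar y.
have mh : measurable_fun setT h.
  apply: measurable_funB; apply: measurable_funM => //.
  - exact: (measurableT_comp mker (measurable_pair1 _)).
  - exact: (measurableT_comp mker (measurable_pair1 _)).
  - exact: measurable_polar.
have ih : nu.-integrable setT (EFin \o h).
  by apply: intgB => //; exact: polar_ker.
have hE y : h y + h (sg y) = gap g x y.
  rewrite /h /gap.
  have -> : g (sg y) = f y + f (sg y) - g y by rewrite -gE; ring.
  have -> : polar (sg y) = f y + f (sg y) - polar y by rewrite -polarD; ring.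
  ring.
have [ihs _] := refl_intg mh ih.
split.
  apply: (eq_intg measurableT (f := fun y => h y + h (sg y))) => [y _|]; first exact: hE.
  exact: intgD.
by rewrite -(Rint_sym mh ih hE) /h RintegralB//; exact: polar_ker.
Qed.

Lemma polar_upper y : 0 <= m y -> f y <= polar y /\ f (sg y) <= polar y.
Proof. by move=> my; rewrite /polar my !le_max !lexx orbT. Qed.

Lemma polar_lower y : m y <= 0 -> polar y <= f y /\ polar y <= f (sg y).
Proof.
rewrite le_eqVlt => /orP[/eqP my|my].
  by rewrite /polar my lexx sg_fix// maxxx.
by rewrite /polar [0 <= m y]leNgt my /= !ge_min !lexx orbT.
Qed.

(** Polarization moves mass towards the side of [x] and the kernel grows with the distance: the two
    factors of [gap] have the same sign. *)
Lemma kin_polar_le x : 0 <= m x.1 -> kin polar x <= kin f x /\ kin polar x <= kin f (sX x).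
Proof.
move=> mx; have [is2 E2] := kin_refl x.
have [i1 G1] := kin_gap mf (dens_ker x df) (fun y => erefl).
have gs y : f (sg y) + f (sg (sg y)) = f y + f (sg y) by rewrite sgK addrC.
have [i2 G2] := kin_gap mfs is2 gs.
have gap0 (g : Y -> R) : (forall y, 0 <= m y -> g y <= polar y) ->
    (forall y, m y <= 0 -> polar y <= g y) -> 0 <= \int[nu]_y gap g x y.
  move=> gu gl; apply: Rintegral_ge0 => y _; rewrite /gap.
  have [my|my] := leP 0 (m y).
    rewrite mulr_le0// subr_le0; first by rewrite ker_side_le// mulr_ge0.
    exact: gu.
  rewrite mulr_ge0// subr_ge0; last by apply: gl; exact: ltW.
  by rewrite ker_side_ge// mulr_ge0_le0// ltW.
have H1 := gap0 f (fun y my => (polar_upper my).1) (fun y my => (polar_lower my).1).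
have H2 := gap0 (fun y => f (sg y)) (fun y my => (polar_upper my).2) (fun y my => (polar_lower my).2).
rewrite E2; split.
  by move: H1; rewrite -G1 pmulr_rge0 ?ltr0n// subr_ge0.
by move: H2; rewrite -G2 pmulr_rge0 ?ltr0n// subr_ge0.
Qed.

(** [y1] yields strictness against [f] and [y2] against its reflection; continuity spreads each
    inequality to a box of positive measure. *)
Lemma kin_polar_lt x y1 y2 : seq_continuous f -> 0 < m x.1 ->
  0 < m y1 -> f y1 < f (sg y1) -> 0 < m y2 -> f (sg y2) < f y2 ->
  kin polar x < kin f x /\ kin polar x < kin f (sX x).
Proof.
move=> cf mx m1 l1 m2 l2; have [is2 E2] := kin_refl x.
have [i1 G1] := kin_gap mf (dens_ker x df) (fun y => erefl).
have gs y : f (sg y) + f (sg (sg y)) = f y + f (sg y) by rewrite sgK addrC.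
have [i2 G2] := kin_gap mfs is2 gs.
have cfs := @seq_continuous_refl R k e s f cf.
have gap0 (g : Y -> R) : nu.-integrable setT (EFin \o gap g x) ->
    (forall y, 0 <= m y -> g y <= polar y) ->
    (forall y, m y <= 0 -> polar y <= g y) ->
    (exists2 h : Y -> R, seq_continuous h & (exists2 y, 0 < m y & 0 < h y) /\
      forall y, 0 < m y -> 0 < h y -> g y < polar y) ->
    0 < \int[nu]_y gap g x y.
  move=> ig gu gl [h ch [[y my hy] H]].
  apply: (Rint_gt0_box (h1 := m) (h2 := h) (y := y) ig) => //.
  - move=> z; rewrite /gap; have [mz|mz] := leP 0 (m z).
      rewrite mulr_le0// subr_le0; first by rewrite ker_side_le// mulr_ge0// ltW.
      exact: gu.
    rewrite mulr_ge0// subr_ge0; last by apply: gl; exact: ltW.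
    by rewrite ker_side_ge// mulr_ge0_le0// ltW.
  - exact: seq_continuous_side.
  - move=> z mz hz; rewrite /gap nmulr_rgt0 subr_lt0; first exact: H.
    by rewrite ker_side_lt// mulr_gt0.
have H1 : 0 < \int[nu]_y gap f x y.
  apply: (gap0 f i1 (fun y my => (polar_upper my).1) (fun y my => (polar_lower my).1)).
  exists (fun y => f (sg y) - f y); first exact: seq_continuousB.
  split; first by exists y1 => //; rewrite subr_gt0.
  by move=> y my; rewrite subr_gt0 => l; apply: lt_le_trans l (polar_upper (ltW my)).2.
have H2 : 0 < \int[nu]_y gap (fun y => f (sg y)) x y.
  apply: (gap0 _ i2 (fun y my => (polar_upper my).2) (fun y my => (polar_lower my).2)).
  exists (fun y => f y - f (sg y)); first exact: seq_continuousB.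
  split; first by exists y2 => //; rewrite subr_gt0.
  by move=> y my; rewrite subr_gt0 => l; apply: lt_le_trans l (polar_upper (ltW my)).1.
rewrite E2; split.
  by move: H1; rewrite -G1 pmulr_rgt0 ?ltr0n// subr_gt0.
by move: H2; rewrite -G2 pmulr_rgt0 ?ltr0n// subr_gt0.
Qed.

End polarization.
(** At a pair of mirror points, the potentials of [f] and of its polarization have the same sum, but
    the latter are further apart, so by convexity their negative powers have a larger sum, strictly
    if both alternatives fail. This contradicts minimality. *)
Lemma polar_dichotomy f : dens f -> (forall g, dens g -> FE f <= FE g) ->
  seq_continuous f ->
  (forall y, 0 <= m y -> f (sg y) <= f y) \/ (forall y, 0 <= m y -> f y <= f (sg y)).
Proof.
move=> df fmin cf; apply: contrapT => /not_orP[H1 H2].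
have pos_of y : 0 <= m y -> f (sg y) != f y -> 0 < m y.
  rewrite le_eqVlt => /orP[/eqP my|//].
  by rewrite sg_fix ?eqxx//.
have [y2 m2 l2] : exists2 y, 0 < m y & f (sg y) < f y.
  apply: contrapT => H; apply: H2 => y my; rewrite leNgt; apply/negP => l.
  by apply: H; exists y => //; apply: pos_of => //; rewrite lt_eqF.
have [y1 m1 l1] : exists2 y, 0 < m y & f y < f (sg y).
  apply: contrapT => H; apply: H1 => y my; rewrite leNgt; apply/negP => l.
  by apply: H; exists y => //; apply: pos_of => //; rewrite gt_eqF.
have dp := polar_dens df.
have [c [C cuf]] := dens_comparable df; have [c' [C' cup]] := dens_comparable dp.
have [_ mkf _] := cuf; have [_ mkp _] := cup.
have kf0 x : 0 < kin f x := comparable_gt0 wtX1 x cuf.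
have kp0 x : 0 < kin (polar f) x := comparable_gt0 wtX1 x cup.
have inf_ := comparable_int mD wtX1 q0 wtXi cuf.
have inp := comparable_int mD wtX1 q0 wtXi cup.
have mpw u : measurable_fun setT u -> measurable_fun setT (fun x : X => u x `^ (- q)).
  by move=> mu; exact: (measurableT_comp (measurable_powR _) mu).
have [ifs Efs] := intg_comp mD (@measurable_reflX R k e s) sXP (mpw _ mkf) inf_.
have [ips Eps] := intg_comp mD (@measurable_reflX R k e s) sXP (mpw _ mkp) inp.
have Nf0 : 0 < neg (kin f) by exact: (negmass_gt0 mD wtX1 q0 wtXi (@upper_gt0 R k) cuf).
have Np0 : 0 < neg (kin (polar f)) by exact: (negmass_gt0 mD wtX1 q0 wtXi (@upper_gt0 R k) cup).
(* The entropies agree, so minimality of [f] compares the negative masses alone. *)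
have Nle : neg (kin (polar f)) <= neg (kin f).
  have := fmin _ dp; have [_ E] := polar_ent df.
  rewrite /free_energy E lerD2l lerN2 ler_pM2l; last by rewrite divr_gt0// ka_gt0.
  have Pf : neg (kin f) \is Num.pos by rewrite posrE; exact: Nf0.
  have Pp : neg (kin (polar f)) \is Num.pos by rewrite posrE; exact: Np0.
  by move=> h; rewrite -(ler_ln Pp Pf); exact: h.
pose phi x := (kin (polar f) x `^ (- q) + kin (polar f) (sX x) `^ (- q)) -
  (kin f x `^ (- q) + kin f (sX x) `^ (- q)).
have sXK x : sX (sX x) = x.
  by case: x => x h; rewrite /reflX /= sgK.
have uE (u : X -> R) x : u (sX x) `^ (- q) + u (sX (sX x)) `^ (- q) =
    u x `^ (- q) + u (sX x) `^ (- q) by rewrite sXK addrC.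
have phis x : phi (sX x) = phi x.
  exact: (f_equal2 (fun u v => u - v) (uE (kin (polar f)) x) (uE (kin f) x)).
have phi0 x : 0 <= phi x.
  wlog mx : x / 0 <= m x.1 => [H|].
    have [/H//|mx] := leP 0 (m x.1); rewrite -phis; apply: H => /=.
    by rewrite msg oppr_ge0 ltW.
  have [h1 h2] := kin_polar_le df mx; have hD := kin_polarD df x.
  have [h _] := powRN_spread q0 (kf0 x) (kf0 (sX x)) (kp0 x) (kp0 (sX x)) h1 h2 hD.
  by rewrite subr_ge0; exact: h.
have phip x : 0 < m x.1 -> 0 < phi x.
  move=> mx; have [h1 h2] := kin_polar_le df (ltW mx); have hD := kin_polarD df x.
  have [l3 l4] := kin_polar_lt df cf mx m1 l1 m2 l2.
  have [_ h] := powRN_spread q0 (kf0 x) (kf0 (sX x)) (kp0 x) (kp0 (sX x)) h1 h2 hD.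
  by rewrite subr_gt0; exact: h l3 l4.
have i3 := intgD mD inp ips; have i4 := intgD mD inf_ ifs.
have iphi : P.-integrable D (EFin \o phi) := intgB mD i3 i4.
(* By reflection invariance the integral of [phi] is twice the difference of the negative masses,
   hence not positive. *)
have Ephi : \int[P]_(x in D) phi x = 0.
  apply/eqP; rewrite eq_le (Rintegral_ge0 _ (fun x _ => phi0 x)) andbT.
  have Ep := etrans (RintegralD mD inp ips) (f_equal2 +%R erefl (etrans Eps (mul1r _))).
  have Ef := etrans (RintegralD mD inf_ ifs) (f_equal2 +%R erefl (etrans Efs (mul1r _))).
  have E := etrans (RintegralB mD i3 i4) (f_equal2 (fun u v => u - v) Ep Ef).
  apply: (@eq_ind_r _ _ (fun r => r <= 0) _ _ E).
  by rewrite subr_le0; apply: lerD; exact: Nle.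
have [r r0 rm] := box_pos (@seq_continuous_side R k e s) m1.
pose A : set X := box y1 r `*` `]0%R, +oo[%classic.
have mA : measurable A by apply: measurableX => //; exact: measurable_box.
have AD : A `<=` D.
  by move=> x [_] /=; rewrite in_itv/= andbT.
have A0 : (0 < P A)%E.
  rewrite /halfmu product_measure1E//; last exact: measurable_box.
  apply: mule_gt0; first exact: box_gt0.
  have := @lebesgue_measure_itv R `]0%R, +oo[; rewrite /= ltry => ->.
  exact: ltry.
have [x [xb _] px] := Rint_eq0 mD iphi (fun x _ => phi0 x) Ephi mA AD A0.
by have := phip x (rm _ xb); rewrite px ltxx.
Qed.

End reflection_sym.

(** * Monotonicity of the minimizer about its barycenter *)

Section minimizer_shape.
Variables (c C : R) (V : Y -> R).
Hypothesis tV : tame P D ker wtX wtY q c C V.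
Hypothesis Vmin : forall g, dens g -> FE (gibbs nu V) <= FE g.
Let f := gibbs nu V.
Let cV : confining wtY c C V. Proof. by case: tV. Qed.
Let c0 : 0 < c. Proof. by case: cV. Qed.
Let ib := @wtY_int R k be be0 k0.
Let nuT := @lebesgueT_gt0 R k.

Lemma gibbs_dens : dens f. Proof. exact: (gibbs_density mwtY wtY1 ib nuT cV). Qed.

Let Z0 : 0 < partition nu V. Proof. exact: (partition_gt0 mwtY wtY1 ib nuT cV). Qed.

Lemma gibbs_bounded : exists M, forall y, f y <= M.
Proof.
exists (expR C / partition nu V) => y.
rewrite ler_pM2r ?invr_gt0// ler_expR; case: cV => _ _ /(_ y)/andP[h _].
have : 0 <= c * wtY y by rewrite mulr_ge0 ?ltW// (lt_le_trans ltr01).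
lra.
Qed.

Lemma gibbs_continuous : seq_continuous f.
Proof.
move=> z y zy; apply: cvgM; last exact: cvg_cst.
apply: continuous_cvg; first exact: continuous_expR.
apply: cvgN.
have [M zM] : exists M, forall j, wtY (z j) <= M.
  pose x0 : X := (y, 0).
  have /cvgP/cvg_seq_bounded := cvg_ker be0 (x := x0) zy.
  move=> [N [_ HN]]; exists (c4 be * ((N + 1) + wtX x0)) => j.
  apply: (le_trans (wtYle x0 (z j))); rewrite ler_wpM2l ?powR_ge0// lerD2r.
  have := HN (N + 1); rewrite ltrDl ltr01 => /(_ isT j I) /=.
  exact: le_trans (ler_norm _).
have := cvg_moddist be0 bq zy zM => cm.
have cm2 : (fun j => C * moddist P D ker wtX q y (z j)) @ \oo --> 0.
  by rewrite -(mulr0 C); apply: cvgM => //; exact: cvg_cst.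
apply/cvgrPdist_le => /= d d0; move/cvgrPdist_le : cm2 => /(_ _ d0).
apply: filterS => j /=; rewrite sub0r normrN => h.
by have [_ /(_ y (z j))] := tV; move=> /le_trans; apply; apply: le_trans h; exact: ler_norm.
Qed.

(** The moment in [density] has order 2 be, possibly below one; the first moments come from the
    exponential decay instead. *)
Lemma gibbs_coord_int i : nu.-integrable setT (EFin \o fun y => tnth y i * f y).
Proof.
have [_ mf _ _ _] := gibbs_dens.
have ig := @nsq_pow_int R k be be0 k0 1 c ler01 c0.
apply: (intg_dominated measurableT _ (intgZ measurableT (expR C / partition nu V) ig)).
  by apply: measurable_funM => //; exact: measurable_tnth.
move=> y _; have f0 : 0 <= f y by rewrite mulr_ge0 ?expR_ge0// invr_ge0 ltW.
rewrite powRr1 ?addr_ge0 ?nsq_ge0// normrM (ger0_norm f0).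
have yi : `|tnth y i| <= 1 + nsq y.
  have : tnth y i ^+ 2 <= nsq y.
    by rewrite /nsq (bigD1 i)//= lerDl sumr_ge0// => j _; exact: sqr_ge0.
  by rewrite -real_normK ?num_real//; have := normr_ge0 (tnth y i); nra.
have fy : f y <= expR C / partition nu V * expR (- (c * wtY y)).
  rewrite mulrAC ler_pM2r ?invr_gt0// -expRD ler_expR.
  by case: cV => _ _ /(_ y)/andP[h _]; lra.
rewrite [leRHS]mulrCA; exact: (ler_pM (normr_ge0 _) f0 yi fy).
Qed.

Definition barycenter : Y := [tuple \int[nu]_y (tnth y i * f y) | i < k].

Lemma side_barycenter e s : nu.-integrable setT (EFin \o fun y => side e s y * f y) /\
  \int[nu]_y (side e s y * f y) = side e s barycenter.
Proof.
have [_ _ _ f1 _] := gibbs_dens; have i_f := dens_int gibbs_dens.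
have [i1 E1] := intg_sum measurableT
  (fun i => intgZ measurableT (tnth e i) (gibbs_coord_int i)).
have pt y : side e s y * f y = \sum_(i < k) tnth e i * (tnth y i * f y) - s * f y.
  by rewrite /side /dot mulrBl mulr_suml; congr (_ - _); apply: eq_bigr => i _; rewrite mulrA.
have i2 := intgZ measurableT s i_f.
split; first by apply: (eq_intg measurableT (fun y _ => esym (pt y))); exact: intgB.
apply: (etrans (eq_Rint nu (fun y _ => pt y))).
apply: (etrans (RintegralB measurableT i1 i2)).
rewrite RintegralZl// f1 mulr1 E1; congr (_ - _); apply: eq_bigr => i _.
by rewrite (RintegralZl _ measurableT (gibbs_coord_int i)) tnth_mktuple.
Qed.

Lemma gibbs_monotone y z : sqdist (y, 0) barycenter <= sqdist (z, 0) barycenter ->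
  f z <= f y.
Proof.
have E w : sqdist (w, 0) barycenter = nsq w - 2 * dot w barycenter + nsq barycenter.
  rewrite /sqdist /= expr0n addr0 /nsq /dot mulr_sumr -sumrB -big_split.
  by apply: eq_bigr => i _ /=; ring.
rewrite !E => yz; pose e : Y := [tuple tnth y i - tnth z i | i < k].
have dote w : dot e w = dot y w - dot z w.
  by rewrite /dot -sumrB; apply: eq_bigr => i _; rewrite tnth_mktuple mulrBl.
have [e00|e0] := leP (nsq e) 0.
  suff -> : y = z by [].
  apply: eq_from_tnth => i; apply/eqP; rewrite -subr_eq0 -sqrf_eq0 eq_le sqr_ge0 andbT.
  apply: le_trans e00; rewrite /nsq (bigD1 i)//= tnth_mktuple lerDl.
  by rewrite sumr_ge0// => j _; exact: sqr_ge0.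
(* With e = y - z this is the bisecting hyperplane, with [y] on its positive side. *)
pose s := (nsq y - nsq z) / 2.
have nE (w : Y) : dot w w = nsq w by apply: eq_bigr => i _; rewrite expr2.
have dotC (u w : Y) : dot u w = dot w u by apply: eq_bigr => i _; rewrite mulrC.
have sy : side e s y = nsq e / 2.
  have E1 : dot e y = nsq y - dot y z by rewrite dote nE (dotC z y).
  have E2 : nsq e = nsq y - 2 * dot y z + nsq z.
    by rewrite -nE dote (dotC y e) (dotC z e) !dote !nE (dotC z y); ring.
  by rewrite /side E1 E2 /s; lra.
(* The barycenter is at most as far from [y] as from [z], so it lies on the side of [y]. *)
have sb : 0 <= side e s barycenter by rewrite /side dote /s; lra.
have yz' : refl e s y = z.
  apply: eq_from_tnth => i; rewrite !tnth_mktuple sy; field; by rewrite gt_eqF.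
have sy0 : 0 < side e s y by rewrite sy divr_gt0.
have [H|H] := polar_dichotomy s e0 gibbs_dens Vmin gibbs_continuous.
  by rewrite -yz'; apply: H; exact: ltW.
rewrite leNgt; apply/negP => fyz.
have [_ mf _ _ _] := gibbs_dens; have [i1 E1] := side_barycenter e s.
have mm : measurable_fun setT (fun y => side e s y * f y).
  by apply: measurable_funM => //; exact: measurable_side.
(* The integral of [g] is twice the first moment orthogonal to the hyperplane. In this alternative
   [g] is never positive, and it is negative near [y], so the barycenter would lie strictly on the
   other side. *)
pose g y := side e s y * (f y - f (refl e s y)).
have hg w : side e s w * f w + side e s (refl e s w) * f (refl e s w) = g w.
  by rewrite side_refl// /g; ring.
have g0 w : 0 <= - g w.
  rewrite /g -mulrN opprB; have [w0|w0] := leP 0 (side e s w).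
    by rewrite mulr_ge0// subr_ge0; exact: H.
  rewrite nmulr_rge0// subr_le0 -[in leRHS](reflK s e0 w); apply: H.
  by rewrite side_refl// oppr_ge0 ltW.
have [i2 _] := refl_intg s e0 mm i1.
have ig : nu.-integrable setT (EFin \o g).
  by apply: (eq_intg measurableT (fun y _ => hg y)); exact: intgD.
have p2 : 0 < f (refl e s y) - f y by rewrite yz' subr_gt0.
have pos := Rint_gt0_box (intgN measurableT ig) g0 (@seq_continuous_side R k e s)
  (seq_continuousB (seq_continuous_refl gibbs_continuous) gibbs_continuous) sy0 p2.
have E2 := Rint_sym e0 mm i1 hg.
have E3 := RintegralZl (-1) measurableT ig.
have E4 : \int[nu]_w (- g w) = -1 * (2 * side e s barycenter).
  rewrite -E1; apply: (etrans _ (f_equal (fun u => -1 * u) (esym E2))).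
  by apply: (etrans _ E3); apply: eq_Rint => w _; rewrite mulN1r.
have : 0 < -1 * (2 * side e s barycenter).
  rewrite -E4; apply: pos => w w1 w2.
  by rewrite /g -mulrN opprB mulr_gt0.
by rewrite mulN1r oppr_gt0 ltNge mulr_ge0.
Qed.

End minimizer_shape.

Lemma extremal_density : exists f, [/\ dens f, forall g, dens g -> FE f <= FE g,
  exists M, forall y, f y <= M & radial_nonincreasing f].
Proof.
have [c [C [V [tV Vmin]]]] := minimizer.
have df := gibbs_dens tV.
(* Translation brings the barycenter to the origin without changing the free energy. *)
pose b := barycenter V; pose f := rescale b 1 (gibbs nu V).
have fE y : f y = gibbs nu V (affineT b 1 y) by rewrite /f /rescale expr1n mul1r.
have dist_b y : sqdist (affineT b 1 y, 0) b = nsq y.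
  rewrite /sqdist /= expr0n addr0; apply: eq_bigr => i _.
  by rewrite tnth_mktuple; congr (_ ^+ 2); ring.
have fmono y z : nsq y <= nsq z -> f z <= f y.
  by move=> yz; rewrite !fE; apply: (gibbs_monotone tV Vmin); rewrite !dist_b.
exists f; split.
- exact: rescale_dens.
- by move=> g dg; rewrite (rescale_FE b ltr01 df); exact: Vmin.
- by have [M HM] := gibbs_bounded tV; exists M => y; rewrite fE.
(* The radial profile is read along the first coordinate axis, which exists since k > 0. *)
pose pt (r : R) : Y := [tuple (if val i == 0%N then r else 0) | i < k].
have nsq_pt r : nsq (pt r) = r ^+ 2.
  rewrite /nsq (bigD1 (Ordinal k0))//= tnth_mktuple /= big1 ?addr0// => i i0.
  rewrite tnth_mktuple ifN ?expr0n//; apply: contra i0 => /eqP i0.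
exists (fun r => f (pt r)); split.
  move=> r r'; rewrite !nnegrE => r0 r'0 rr'; apply: fmono.
  by rewrite !nsq_pt ler_pXn2r.
move=> y; have E : nsq (pt (enorm y)) = nsq y by rewrite nsq_pt sqr_sqrtr// nsq_ge0.
by apply/eqP; rewrite eq_le !fmono ?E.
Qed.

End normalization.

(** * From the free energy to the logarithmic functional *)

Section log_functional_free_energy.
Context {R : realType} (k : nat) (alpha t t' : R).
Hypotheses (k0 : (0 < k)%N) (alpha0 : k.+1%:R < alpha).
Hypotheses (t0 : k.+1%:R / alpha < t) (t1 : t < 1) (tt' : t^-1 + t'^-1 = 1).
Local Notation X := (halfpt R k).
Local Notation Y := (k.-tuple R).
Local Notation P := (halfmu R k).
Local Notation D := (@upper R k).
Local Notation nu := (@lebesgueT R k).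
Let be := (alpha - k.+1%:R) / 2.
Let q := - t'.
Let ka := (k.+1%:R - 1) / (alpha - k.+1%:R / t).
Local Notation ker := (@powdist R k be).
Local Notation wtY := (@bdryweight R k be).
Local Notation kin := (kint nu ker).
Local Notation dens := (density nu wtY).
Local Notation neg := (negmass P D q).
Local Notation FE := (free_energy P D nu ker q ka).
Implicit Type f : Y -> R.

Let n0 : 0 < k.+1%:R :> R. Proof. by rewrite ltr0n. Qed.
Let alpha_gt0 : 0 < alpha. Proof. exact: lt_trans alpha0. Qed.
Let t_gt0 : 0 < t. Proof. by apply: lt_trans t0; rewrite divr_gt0. Qed.
Let tVE : t'^-1 = 1 - t^-1. Proof. by rewrite -tt' addrC addKr. Qed.
Let t'0 : t' < 0.
Proof. by rewrite -invr_lt0 tVE subr_lt0 invf_gt1. Qed.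
Let q0 : 0 < q. Proof. by rewrite oppr_gt0. Qed.
Let qVE : q^-1 = t^-1 - 1. Proof. by rewrite /q invrN tVE opprB. Qed.
Let be0 : 0 < be. Proof. by rewrite divr_gt0// subr_gt0. Qed.
Let be2 : 2 * be = alpha - k.+1%:R. Proof. by rewrite /be mulrC divfK. Qed.

Let alpha_t : 0 < alpha - k.+1%:R / t.
Proof. by rewrite subr_gt0 ltr_pdivrMr// mulrC -ltr_pdivrMr. Qed.

(** Since 1/q = 1/t - 1, positivity of alpha - n/t yields both [bq] and the positivity of [ka]. *)
Let bqE : 2 * be - k.+1%:R / q = alpha - k.+1%:R / t.
Proof. rewrite be2 qVE; ring. Qed.

Let bq : k.+1%:R < 2 * (be * q).
Proof. by rewrite mulrA -ltr_pdivrMr// -subr_gt0 bqE. Qed.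

Let kaE : ka * (2 * be - k.+1%:R / q) = k%:R.
Proof. by rewrite bqE /ka divfK ?gt_eqF// -addn1 natrD addrK. Qed.

Let ka0 : 0 < ka. Proof. exact: (ka_gt0 q0 bq k0 kaE). Qed.

Let mD := @measurable_upper R k.
Let wtX1 := @wtX_ge1 R k be be0.
Let wtXi := @wtX_int R k be q bq.

Lemma edist_ker (x : X) (y : Y) : Defs.edist x y `^ (alpha - k.+1%:R) = ker x y.
Proof.
rewrite /Defs.edist -/(sqdist x y) -powR12_sqrt ?sqdist_ge0// -powRrM.
by rewrite mulrC.
Qed.

Lemma EtildeE f x : Etilde k.+1 alpha f x = (\int[nu]_y (ker x y * f y)%:E)%E.
Proof. by apply: eq_integral => y _; rewrite edist_ker. Qed.

Lemma epowE (r s : R) : 0 < r -> epow r%:E s = (r `^ s)%:E.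
Proof.
move=> r0; rewrite /epow; case: ifPn => // s0.
by rewrite poweR_EFin inver gt_eqF ?powR_gt0// -powRN opprK.
Qed.

(** By [moment_le], a finite value at one point would make the moment finite and [f] a density. *)
Lemma Etilde_pinfty f : entropy_class f -> ~ dens f -> forall x, Etilde k.+1 alpha f x = +oo%E.
Proof.
move=> [f0 i_f f1 ief] ndf x; apply/eqP; rewrite EtildeE -leye_eq leNgt; apply/negP => Eoo.
have mf : measurable_fun setT f by exact: intg_measurable i_f.
have mk : measurable_fun setT (fun y => ker x y * f y).
  apply: measurable_funM => //.
  exact: (measurableT_comp (@measurable_ker R k be) (measurable_pair1 _)).
have ik : nu.-integrable setT (EFin \o fun y => ker x y * f y).
  by apply: intg_lty => // y _; rewrite mulr_ge0// ker_ge0.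
have [iw _] := moment_le be0 f0 mf i_f ik.
by apply: ndf; split => //; rewrite /Rintegral f1.
Qed.

Lemma dens_entropy_class f : dens f -> entropy_class f.
Proof.
move=> df; have [f0 mf _ f1 ief] := df; have i_f := dens_int be0 df.
by split => //; rewrite (integral_EFin measurableT i_f) f1.
Qed.

Lemma log_functional_pinfty C f : 0 < C -> entropy_class f -> ~ dens f ->
  log_functional k.+1 alpha t t' C f = +oo%E.
Proof.
move=> C0 ef ndf; have [_ _ _ ief] := ef.
have Ly : Lp_half_space k.+1 t' (Etilde k.+1 alpha f) = +oo%E.
  (* As t' < 0, the integrand is the value of [epow] at +oo, that is 0; the integral vanishes, and
     its power 1/t' is +oo again. *)
  rewrite /Lp_half_space integral0_eq => [|x _].
    rewrite /epow [(0 <= _)%R]leNgt invr_lt0 t'0 /=.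
    by rewrite powR0 ?inve0// oppr_eq0 invr_eq0 lt_eqF.
  rewrite (Etilde_pinfty ef ndf) /epow [(0 <= _)%R]leNgt t'0 /=.
  by rewrite oppr_eq0 lt_eqF// invey.
rewrite /log_functional Ly inver gt_eqF// gt0_mulye ?lte_fin ?invr_gt0//.
rewrite gt0_muley ?lte_fin// addey// /entropy (integral_EFin measurableT ief).
by [].
Qed.

(** As t' = - q, the logarithm of the norm is - 1/q times that of the negative mass: the interaction
    term up to the factor [ka]. *)
Lemma log_functionalE C f : 0 < C -> dens f ->
  log_functional k.+1 alpha t t' C f = (FE f - ka * ln C)%:E.
Proof.
move=> C0 df; have [_ _ _ _ ief] := df.
have [c [C1 cf]] := dens_comparable be0 k0 df.
have kp x : 0 < kin f x by exact: (comparable_gt0 wtX1 x cf).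
have Ek x : Etilde k.+1 alpha f x = (kin f x)%:E.
  by rewrite EtildeE; exact: (integral_EFin measurableT (dens_ker be0 x df)).
have iN := comparable_int mD wtX1 q0 wtXi cf.
have N0 : 0 < neg (kin f) := negmass_gt0 mD wtX1 q0 wtXi (@upper_gt0 R k) cf.
have LE : Lp_half_space k.+1 t' (Etilde k.+1 alpha f) = (neg (kin f) `^ t'^-1)%:E.
  rewrite /Lp_half_space -(epowE _ N0); congr (epow _ _).
  rewrite -(integral_EFin mD iN); apply: eq_integral => x _.
  by rewrite Ek abse_EFin gtr0_norm// epowE// /q opprK.
rewrite /log_functional LE inver gt_eqF// -EFinM lne_EFin ?divr_gt0 ?powR_gt0//.
rewrite /entropy (integral_EFin measurableT ief) -EFinM -EFinD; congr (_%:E).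
rewrite ln_div ?posrE ?powR_gt0// ln_powR /free_energy -/(ent nu f) -/ka.
by rewrite /q invrN; ring.
Qed.

Theorem sharp_log_functional : exists C : R,
  [/\ 0 < C,
      forall f, entropy_class f -> (0 <= log_functional k.+1 alpha t t' C f)%E,
      forall C' : R, 0 < C' ->
        (forall f, entropy_class f -> (0 <= log_functional k.+1 alpha t t' C' f)%E) ->
        C' <= C &
      exists f, [/\ entropy_class f, radial_nonincreasing f,
        exists M : R, forall y, f y <= M &
        log_functional k.+1 alpha t t' C f = 0%E]].
Proof.
have [f [df fmin fM fr]] := extremal_density be0 q0 bq k0 kaE.
have [r rE] : exists r, FE f = r by eexists.
have C0 := expR_gt0 (r / ka).
have rC : ka * ln (expR (r / ka)) = r by rewrite expRK mulrC divfK ?gt_eqF.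
exists (expR (r / ka)); split.
- exact: C0.
(* The class does not include a moment condition: without a finite moment the functional is +oo. *)
- move=> g eg; have [dg|ndg] := pselect (dens g); last first.
    by rewrite (log_functional_pinfty C0 eg ndg).
  have := fmin g dg; rewrite rE (log_functionalE C0 dg) rC lee_fin => rg.
  by rewrite subr_ge0.
- move=> C' C'0 /(_ _ (dens_entropy_class df)).
  rewrite (log_functionalE C'0 df) lee_fin rE => h.
  by rewrite -[C']lnK ?posrE// ler_expR ler_pdivlMr// mulrC -subr_ge0.
- exists f; split; [exact: dens_entropy_class|exact: fr|exact: fM|].
  by rewrite (log_functionalE C0 df) rC rE subrr.
Qed.

End log_functional_free_energy.

Theorem theorem1p9 (R : realType) (n : nat) (alpha t t' : R)
  (hn : (2 <= n)%N) (halpha : n%:R < alpha)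
  (ht0 : n%:R / alpha < t) (ht1 : t < 1) (htt' : t^-1 + t'^-1 = 1) :
  exists C : R,
    [/\ 0 < C,
        forall f : n.-1.-tuple R -> R, entropy_class f ->
          (0 <= log_functional n alpha t t' C f)%E,
        forall C' : R, 0 < C' ->
          (forall f : n.-1.-tuple R -> R, entropy_class f ->
             (0 <= log_functional n alpha t t' C' f)%E) ->
          C' <= C &
        exists f : n.-1.-tuple R -> R,
          [/\ entropy_class f, radial_nonincreasing f,
              exists M : R, forall y, f y <= M &
              log_functional n alpha t t' C f = 0%E]].
Proof.
case: n hn halpha ht0 => // -[//|k] _ halpha ht0.
exact: (@sharp_log_functional R k.+1 alpha t t' isT halpha ht0 ht1 htt').
Qed.
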